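(* Let $\Bbbk$ be an algebraically closed field of arbitrary characteristic. For $(d,n)\in\{(3,7),(3,8),(4,8)\}$, the explicit polynomials $\psi_{I,J}$ ($I\in\binom{[d+4]}{6}$, $J\in\binom{[n]}{d+4}$) defined in the context cut out $V_{d,n}$ set-theoretically in $(\mathbb{P}^d)^n$; that is, $W_{d,n}=V_{d,n}$ as sets.
   Context: Notation: $[n]=\{1,\dots,n\}$, and $\binom{[n]}{m}$ is the set of subsets of $[n]$ of cardinality $m$. A rational normal curve in $\mathbb{P}^d$ is the image of the $d$-th Veronese embedding $\mathbb{P}^1\hookrightarrow\mathbb{P}^d$ up to projective automorphism. Let $U_{d,n}\subseteq(\mathbb{P}^d)^n$ be the locus of configurations $(p_1,\dots,p_n)$ of $n$ distinct points such that some rational normal curve in $\mathbb{P}^d$ contains all the $p_i$. $V_{d,n}\subseteq(\mathbb{P}^d)^n$ (the Veronese compactification) is the Zariski closure of $U_{d,n}$ with the reduced induced scheme structure. Definition of $\psi_{I,J}$ and $W_{d,n}$ (for $d\ge3$, $n\ge d+4$). For $J=\{j_1<\dots<j_k\}$ put $S_J=\sum_{l=1}^k(j_l-l)$. First let $n=d+4$. For $K\in\binom{[d+4]}{d+1}$ let $m_K$ be the maximal minor, with columns indexed by $K$, of the $(d+1)\times(d+4)$ matrix of homogeneous coordinates on $(\mathbb{P}^d)^{d+4}$. For $J\in\binom{[d+4]}{3}$ put $\widehat{m}_J:=(-1)^{S_J+d+1}m_{J^c}$, where $J^c=[d+4]\setminus J$. For $I=\{i_1<\dots<i_6\}\in\binom{[d+4]}{6}$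 define $$\psi_I:=\widehat m_{\{i_1,i_2,i_3\}}\widehat m_{\{i_1,i_4,i_5\}}\widehat m_{\{i_2,i_4,i_6\}}\widehat m_{\{i_3,i_5,i_6\}}-\widehat m_{\{i_1,i_2,i_4\}}\widehat m_{\{i_1,i_3,i_5\}}\widehat m_{\{i_2,i_3,i_6\}}\widehat m_{\{i_4,i_5,i_6\}}.$$ For general $n\ge d+4$ and $J\in\binom{[n]}{d+4}$, let $\pi_J:(\mathbb{P}^d)^n\to(\mathbb{P}^d)^{d+4}$, $(p_i)\mapsto(p_i)_{i\in J}$ (indices in increasing order), and $\psi_{I,J}:=\pi_J^*\psi_I$. $W_{d,n}\subseteq(\mathbb{P}^d)^n$ is the closed subscheme defined by all $\psi_{I,J}$. *)

(* Defs.v *)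
(* MathComp, with multivariate polynomials from multinomials. *)
From HB Require Import structures.
From mathcomp Require Import all_boot all_order all_algebra.
From mathcomp Require Import mpoly.

Set Implicit Arguments.
Unset Strict Implicit.
Unset Printing Implicit Defensive.
Import GRing.Theory.
Local Open Scope ring_scope.

(* k-points of P^d, as the lines of k^(d+1).  Over an algebraically closed
   field, a closed subset of (P^d)^n is determined by its k-points. *)
Definition proj (k : fieldType) (d : nat) : Type :=
  {L : {vspace 'cV[k]_d.+1} | \dim L == 1%N}.

Definition conf (k : fieldType) (d n : nat) : Type := 'I_n -> proj k d.

(* Column i of A is a (necessarily nonzero) vector of homogeneous coordinates
   of the i-th point. *)
Definition hcoords (k : fieldType) (d n : nat)
    (p : conf k d n) (A : 'M[k]_(d.+1, n)) : Prop :=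
  forall i, val (p i) = <[col i A]>%VS.

(* The homogeneous coordinate ring of (P^d)^n: the variable of index
   [mxvec_index i j] is the i-th homogeneous coordinate of the j-th point. *)
Definition mhpoly (k : fieldType) (d n : nat) : Type := {mpoly k[d.+1 * n]}.

Definition multihomogeneous (k : fieldType) (d n : nat)
    (f : mhpoly k d n) : Prop :=
  exists deg : 'I_n -> nat, forall m : 'X_{1..(d.+1 * n)}, m \in msupp f ->
    forall j, (\sum_(i < d.+1) m (mxvec_index i j))%N = deg j.

Definition vanishes_at (k : fieldType) (d n : nat)
    (f : mhpoly k d n) (p : conf k d n) : Prop :=
  forall A : 'M[k]_(d.+1, n), hcoords p A -> f.@[fun v => mxvec A ord0 v] = 0.

Definition zariski_closure (k : fieldType) (d n : nat)
    (S : conf k d n -> Prop) (p : conf k d n) : Prop :=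
  forall f : mhpoly k d n, multihomogeneous f ->
    (forall q, S q -> vanishes_at f q) -> vanishes_at f p.

(* [s : t] |-> [s^d : s^(d-1) t : ... : t^d], on homogeneous coordinates *)
Definition veronese (k : fieldType) (d : nat) (v : 'cV[k]_2) : 'cV[k]_d.+1 :=
  \col_(i < d.+1) (v 0 0 ^+ (d - i) * v 1 0 ^+ i).

Definition rational_normal_curve (k : fieldType) (d : nat)
    (C : proj k d -> Prop) : Prop :=
  exists2 g : 'M[k]_d.+1, g \in unitmx &
    forall x, C x <->
      exists2 v : 'cV[k]_2, v != 0 & val x = <[g *m veronese d v]>%VS.

Definition U_locus (k : fieldType) (d n : nat) (p : conf k d n) : Prop :=
  injective p /\
  exists2 C : proj k d -> Prop, rational_normal_curve C & forall i, C (p i).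

Definition V_locus (k : fieldType) (d n : nat) : conf k d n -> Prop :=
  zariski_closure (@U_locus k d n).

(* The columns of A with index in J, in increasing order; used only when
   #|J| = m, so that the default value 0 plays no role. *)
Definition cols (R : comNzRingType) (r n m : nat)
    (A : 'M[R]_(r, n)) (J : {set 'I_n}) : 'M[R]_(r, m) :=
  \matrix_(i, l) nth 0 [seq A i j | j <- enum J] l.

(* Indices start from 0 here; shifting both j_l and l by 1 leaves each
   difference j_l - l unchanged, and j_l >= l, so nothing is truncated. *)
Definition S_ (n : nat) (J : {set 'I_n}) : nat :=
  (\sum_(l < #|J|) (nth 0 [seq val j | j <- enum J] l - l))%N.

Definition minor (R : comNzRingType) (d : nat)
    (A : 'M[R]_(d.+1, d.+4)) (K : {set 'I_d.+4}) : R :=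
  \det (cols d.+1 A K).

Definition mhat (R : comNzRingType) (d : nat)
    (A : 'M[R]_(d.+1, d.+4)) (J : {set 'I_d.+4}) : R :=
  (-1) ^+ (S_ J + d + 1) * minor A (~: J).

(* mhat at {i_a, i_b, i_c}, where I = {i_1 < ... < i_6} and a, b, c start from 1 *)
Definition mhat_at (R : comNzRingType) (d : nat)
    (A : 'M[R]_(d.+1, d.+4)) (I : {set 'I_d.+4}) (a b c : nat) : R :=
  let i l := nth ord0 (enum I) l.-1 in mhat A [set i a; i b; i c].

Definition psi (R : comNzRingType) (d : nat)
    (A : 'M[R]_(d.+1, d.+4)) (I : {set 'I_d.+4}) : R :=
  mhat_at A I 1 2 3 * mhat_at A I 1 4 5 * mhat_at A I 2 4 6 * mhat_at A I 3 5 6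
  - mhat_at A I 1 2 4 * mhat_at A I 1 3 5 * mhat_at A I 2 3 6
    * mhat_at A I 4 5 6.

Definition generic_coords (k : fieldType) (d n : nat) :
    'M[{mpoly k[d.+1 * n]}]_(d.+1, n) :=
  \matrix_(i, j) 'X_(mxvec_index i j).

Definition psi_poly (k : fieldType) (d n : nat)
    (I : {set 'I_d.+4}) (J : {set 'I_n}) : mhpoly k d n :=
  psi (cols d.+4 (generic_coords k d n) J) I.

Definition W_locus (k : fieldType) (d n : nat) (p : conf k d n) : Prop :=
  forall (I : {set 'I_d.+4}) (J : {set 'I_n}),
    #|I| = 6%N -> #|J| = d.+4 -> vanishes_at (psi_poly k I J) p.

(* Main.v *)
Require Import Defs.
From mathcomp Require Import all_boot all_order all_algebra.
From mathcomp Require Import perm mpoly ring zify.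

(* Everything is phrased for a property Z of coordinate matrices that survives
   limits along polynomial curves ("vanishing of f" is one); such a Z holds on
   V as soon as it holds on the configurations of distinct points of rational
   normal curves.

   Write B for a Gale dual of the coordinate matrix A (A B^T = 0).  A lies on a
   rational normal curve iff B does, and maximal minors of A and B correspond,
   so for n = d + 4 the equations psi_I say that every six columns of B lie on
   a conic of P^2; then all of them do, and a conic through B, smooth or a pair
   of lines, deforms together with B to a smooth one.

   If A is degenerate and n = d + 4 <= 8, its dual lives in P^3, where the
   pencil of quadrics through the n <= 8 dual points contains a cone;
   projecting from its vertex gives a dual in P^2 lying on a conic.

   For (d, n) = (3, 8) and A nondegenerate, the equations say that every point
   of the dual configuration in P^3 is the vertex of a quadric cone through the
   configuration.  Looking at a plane with as many points as possible, either
   the points lie on a twisted cubic, or on the union of a plane conic and a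
   line meeting it, and the latter is a limit of twisted cubics.  For planar A,
   plane nodal cubics through 8 points are unobstructed, so a general planar
   configuration lies on the projection of a twisted cubic. *)

Set Implicit Arguments.
Unset Strict Implicit.
Unset Printing Implicit Defensive.
Import Order.TTheory GRing.Theory Num.Theory.
Local Open Scope ring_scope.

(** Arbitrary characteristic shapes the treatment of quadrics: a form is any square matrix, its
    polar form is not halved, and a vertex has to be a zero of the form as well as a radical vector
    of the polar form. Closedness is tested on polynomial curves because it then passes to the dual
    side: a relation A B^T = 0 at x = 0 extends along any deformation of B. One can thus work with B
    alone, whose zero columns and coincident points are absorbed by limits. For (d, n) = (3, 8) the
    dual curves are twisted cubics, so the cone that settles a degenerate A with d + 4 points does
    not help with a planar A. There a polynomial f vanishing on U is restricted to a line from a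
    nodal configuration to A and shown to vanish to all orders at its origin; this uses f itself,
    not only a curve-closed property. The number 8 enters three times: 10 coefficients minus 8
    conditions leave a pencil of quadrics; 8 tangent conditions match the 8 coefficients of a form
    of degree 7; a plane with at least 4 points leaves at most 4 outside it. *)

Definition at_pt (k : fieldType) (r n : nat) (x : k)
    (B : 'M[{poly k}]_(r, n)) : 'M[k]_(r, n) := map_mx (horner_eval x) B.

(** [q] may vanish at 0; this is what makes the value at 0 a limit. *)
Definition curve_closed (k : fieldType) (r n : nat)
    (Z : 'M[k]_(r, n) -> Prop) : Prop :=
  forall (B : 'M[{poly k}]_(r, n)) (q : {poly k}), q != 0 ->
    (forall x, q.[x] != 0 -> Z (at_pt x B)) -> Z (at_pt 0 B).

(* Column j is c_j times the point [s_j : t_j] of the curve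
   [s : t] |-> [s^e : s^(e-1) t : ... : t^e]. *)
Definition moment (R : comNzRingType) (e n : nat) (c s t : 'I_n -> R) :
    'M[R]_(e.+1, n) :=
  \matrix_(i, j) (c j * s j ^+ (e - i) * t j ^+ i).

(** Only nonzero weights and distinct affine parameters, without the point at infinity;
    [curve_closed_moment] recovers the rest. *)
Definition contains_good (k : fieldType) (e n : nat)
    (Z : 'M[k]_(e.+1, n) -> Prop) : Prop :=
  forall (M : 'M[k]_e.+1) (c a : 'I_n -> k),
    M \in unitmx -> (forall j, c j != 0) -> injective a ->
    Z (M *m moment e c (fun=> 1) a).

Lemma closed_inj (k : closedFieldType) (n : nat) :
  exists a : 'I_n -> k, injective a.
Proof.
suff [s [us ss]] : exists s : seq k, uniq s /\ size s = n.
  exists (fun i : 'I_n => nth 0 s i) => i j /eqP.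
  by rewrite nth_uniq ?ss // => /eqP/val_inj.
elim: n => [|n [s [us ss]]]; first by exists [::].
have nz : \prod_(x <- s) ('X - x%:P) != 0 :> {poly k}.
  by rewrite monic_neq0 // monic_prod_XsubC.
have /closed_nonrootP[x] := nz.
by rewrite root_prod_XsubC => xs; exists (x :: s); rewrite /= xs us ss.
Qed.

Lemma at_ptM (k : fieldType) (m n p : nat) (x : k)
    (A : 'M[{poly k}]_(m, n)) (B : 'M_(n, p)) :
  at_pt x (A *m B) = at_pt x A *m at_pt x B.
Proof. exact: map_mxM. Qed.

Lemma at_ptB (k : fieldType) (m n : nat) (x : k) (A B : 'M[{poly k}]_(m, n)) :
  at_pt x (A - B) = at_pt x A - at_pt x B.
Proof. exact: map_mxB. Qed.

Lemma at_ptC (k : fieldType) (m n : nat) (x : k) (A : 'M[k]_(m, n)) :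
  at_pt x (map_mx polyC A) = A.
Proof. by apply/matrixP => i j; rewrite !mxE /horner_eval hornerC. Qed.

Lemma det_at_pt (k : fieldType) (n : nat) (x : k) (A : 'M[{poly k}]_n) :
  \det (at_pt x A) = (\det A).[x].
Proof. exact: det_map_mx. Qed.

Lemma at_pt_moment (k : fieldType) (e n : nat) (x : k)
    (c s t : 'I_n -> {poly k}) :
  at_pt x (moment e c s t) =
  moment e (fun j => (c j).[x]) (fun j => (s j).[x]) (fun j => (t j).[x]).
Proof.
by apply/matrixP => i j; rewrite !mxE /horner_eval !hornerM !horner_exp.
Qed.

(** Arbitrary data are joined linearly to good data, namely the identity matrix, weights 1 and
    points [1 : a_j] with distinct a_j; only finitely many x on this line give bad data. *)
Lemma curve_closed_moment (k : closedFieldType) (e n : nat)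
    (Z : 'M[k]_(e.+1, n) -> Prop) :
  curve_closed Z -> contains_good Z ->
  forall M c s t, Z (M *m moment e c s t).
Proof.
move=> Zc Zg M c s t; have [a ai] := closed_inj k n.
pose lin (u v : k) : {poly k} := u%:P + 'X * (v - u)%:P.
have lin0 u v : (lin u v).[0] = u by rewrite /lin hornerD hornerM hornerX !hornerC mul0r addr0.
have lin1 u v : (lin u v).[1] = v by rewrite /lin hornerD hornerM hornerX !hornerC mul1r addrC subrK.
pose Mp : 'M[{poly k}]_e.+1 := \matrix_(i, j) lin (M i j) (1%:M i j).
pose cp j := lin (c j) 1; pose sp j := lin (s j) 1; pose tp j := lin (t j) (a j).
(* Where [q] does not vanish the data can be normalised to good ones; [q] is not the zero polynomial
   because its value at 1 is nonzero. *)
pose q := \det Mp * (\prod_j cp j) * (\prod_j sp j) *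
  \prod_i \prod_(j | j != i) (sp i * tp j - sp j * tp i).
have M0 : at_pt 0 Mp = M.
  by apply/matrixP => i j; rewrite !mxE /horner_eval lin0.
have M1 : at_pt 1 Mp = 1%:M.
  by apply/matrixP => i j; rewrite !mxE /horner_eval lin1.
have -> : M *m moment e c s t = at_pt 0 (Mp *m moment e cp sp tp).
  rewrite at_ptM M0 at_pt_moment; congr (_ *m _).
  by apply/matrixP => i j; rewrite !mxE !lin0.
apply: (Zc _ q) => [|x].
  apply/negP => /eqP q0; have := congr1 (horner^~ 1) q0.
  rewrite horner0 /q !hornerM -det_at_pt M1 det1 mul1r.
  rewrite !horner_prod big1 => [|j _]; last exact: lin1.
  rewrite big1 => [|j _]; last exact: lin1.
  rewrite !mul1r => /eqP; rewrite prodf_seq_eq0 => /hasP[i _ /=].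
  rewrite horner_prod prodf_seq_eq0 => /hasP[j _ /= /andP[ji]].
  rewrite hornerD hornerN !hornerM !lin1 !mul1r subr_eq0 => /eqP/ai ij.
  by rewrite ij eqxx in ji.
rewrite /q !hornerM !mulf_eq0 !negb_or -!andbA -det_at_pt.
rewrite !horner_prod => /and4P[Mx /prodf_neq0 cx /prodf_neq0 sx /prodf_neq0 stx].
rewrite at_ptM at_pt_moment.
(* Dividing by s_j moves [s_j : t_j] into the chart s = 1. *)
pose c' j := (cp j).[x] * (sp j).[x] ^+ e; pose a' j := (tp j).[x] / (sp j).[x].
have -> : moment e (fun j => (cp j).[x]) (fun j => (sp j).[x])
    (fun j => (tp j).[x]) = moment e c' (fun=> 1) a'.
  apply/matrixP => i j; rewrite !mxE expr1n mulr1 /c' /a' expr_div_n.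
  have sn : (sp j).[x] ^+ i != 0 by rewrite expf_neq0 // sx.
  have -> : (sp j).[x] ^+ e = (sp j).[x] ^+ (e - i) * (sp j).[x] ^+ i.
    by rewrite -exprD subnK // leq_ord.
  rewrite -!mulrA; congr (_ * (_ * _)).
  by rewrite mulrCA divff // mulr1.
apply: Zg => [|j|i j].
- by rewrite unitmxE unitfE.
- by rewrite /c' mulf_neq0 ?expf_neq0 ?cx ?sx.
move=> /eqP; rewrite /a' eqr_div ?sx // => /eqP ij.
apply/eqP/negPn/negP => nij.
have := stx i isT; rewrite horner_prod => /prodf_neq0/(_ j).
rewrite eq_sym nij => /(_ isT).
by rewrite hornerD hornerN !hornerM mulrC -ij mulrC subrr eqxx.
Qed.

(** * Moment curves and their Gale duals *)

Lemma Vandermonde_unit (F : fieldType) (n : nat) (a : 'I_n -> F) :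
  injective a -> Vandermonde n (\row_j a j) \in unitmx.
Proof.
move=> ai; rewrite unitmxE det_Vandermonde unitfE.
apply/prodf_neq0 => i _; apply/prodf_neq0 => j ij.
rewrite !mxE subr_eq0; apply: contraTneq ij => /ai ->.
by rewrite ltnn.
Qed.

Lemma mul_Vandermonde (R : comNzRingType) (m n r : nat) (A : 'M[R]_(r, m))
    (a : 'I_n -> R) i j :
  (A *m Vandermonde m (\row_j a j)) i j = (rVpoly (row i A)).[a j].
Proof.
rewrite (horner_coef_wide _ (size_poly _ _)) !mxE.
by apply: eq_bigr => l _; rewrite !mxE coef_rVpoly_ord mxE.
Qed.

Lemma interpolation (F : fieldType) (n : nat) (a y : 'I_n -> F) :
  injective a -> exists2 p : {poly F}, (size p <= n)%N & forall j, p.[a j] = y j.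
Proof.
move=> ai; pose u := (\row_j y j) *m invmx (Vandermonde n (\row_j a j)).
exists (rVpoly u) => [|j]; first exact: size_poly.
have -> : u = row ord0 u by apply/rowP => l; rewrite !mxE.
by rewrite -mul_Vandermonde mulmxKV ?Vandermonde_unit // mxE.
Qed.

(* The weights of the divided difference of order m. *)
Lemma dual_weights (F : fieldType) (m : nat) (a : 'I_m.+1 -> F) :
  injective a -> exists2 w : 'I_m.+1 -> F, (forall j, w j != 0) &
    forall p : {poly F}, (size p <= m.+1)%N -> \sum_j w j * p.[a j] = p`_m.
Proof.
move=> ai; set V := Vandermonde m.+1 (\row_j a j).
pose w := invmx V *m delta_mx ord_max ord0 : 'cV_m.+1.
have wE (p : {poly F}) : (size p <= m.+1)%N -> \sum_j w j 0 * p.[a j] = p`_m.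
  move=> sp; rewrite (eq_bigr (fun j => (poly_rV p *m V) ord0 j * w j ord0)).
    rewrite -[LHS](_ : (poly_rV p *m V *m w) 0 0 = _); last by rewrite mxE.
    by rewrite /w mulmxA mulmxK ?Vandermonde_unit // -colE !mxE.
  move=> j _; rewrite mulrC mul_Vandermonde row_id poly_rV_K //.
exists (fun j => w j 0) => [j|p /wE//].
(* The monic polynomial vanishing at all nodes except a_j shows that w_j is nonzero. *)
pose s := [seq a l | l <- enum (predC1 j)].
pose p : {poly F} := \prod_(x <- s) ('X - x%:P).
have sp : size p = m.+1.
  rewrite /p size_prod_XsubC size_map -cardE; congr _.+1.
  by have := cardC1 j; rewrite card_ord.
have := wE p; rewrite sp => /(_ (leqnn _)).
have -> : p`_m = 1.
  by have /monicP := monic_prod_XsubC s xpredT id; rewrite lead_coefE -/p sp.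
rewrite (bigD1 j) //= big1 => [|l lj].
  rewrite addr0 => wp; apply/negP => /eqP w0.
  by move/eqP: wp; rewrite w0 mul0r eq_sym oner_eq0.
rewrite (_ : p.[a l] = 0) ?mulr0 //; apply/rootP.
by rewrite root_prod_XsubC map_f // mem_enum inE.
Qed.

Lemma row_free_moment (F : fieldType) (e n : nat) (c a : 'I_n -> F) :
  (e < n)%N -> (forall j, c j != 0) -> injective a ->
  row_free (moment e c (fun=> 1) a).
Proof.
move=> en c0 ai; apply/inj_row_free => v v0; apply/rowP => l; rewrite mxE.
have sv : (size (rVpoly v) <= e.+1)%N := size_poly _ _.
suff /(congr1 (fun p : {poly F} => p`_l)) : rVpoly v = 0.
  by rewrite coef_rVpoly_ord coef0.
apply: (@roots_geq_poly_eq0 _ _ [seq a j | j <- enum 'I_n]).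
- apply/allP => _ /mapP[j _ ->]; apply/rootP.
  have /eqP := congr1 (fun B : 'rV_n => B 0 j) v0.
  rewrite (horner_coef_wide _ sv) !mxE.
  rewrite (eq_bigr (fun i : 'I_e.+1 => c j * ((rVpoly v)`_i * a j ^+ i))).
    by rewrite -mulr_sumr mulf_eq0 (negPf (c0 j)) => /eqP.
  by move=> i _; rewrite mxE expr1n mulr1 coef_rVpoly_ord mulrCA.
- by rewrite map_inj_uniq // enum_uniq.
by rewrite size_map size_enum_ord (leq_trans sv).
Qed.

(** Divide each row of A by the weights w_j / c_j and interpolate: orthogonality to c_j a_j^i for i
    <= e forces the interpolating polynomial to have degree at most d. *)
Lemma dual_moment (F : fieldType) (d e n : nat) (a c : 'I_n -> F)
    (A : 'M[F]_(d.+1, n)) :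
  n = (d + e).+2 -> injective a -> (forall j, c j != 0) ->
  A *m (moment e c (fun=> 1) a)^T = 0 ->
  exists M c', A = M *m moment d c' (fun=> 1) a.
Proof.
move=> nE; subst n => ai c0 A0; have [w w0 wE] := dual_weights ai.
have /fin_all_exists2[p sp pE] (r : 'I_d.+1) := 
  interpolation (fun j => A r j * c j / w j) ai.
have sp' r : (size (p r) <= d.+1)%N.
  rewrite leqNgt; apply/negP => dp.
  pose s := (size (p r)).-1; have sE : size (p r) = s.+1 by rewrite prednK //; lia.
  have := sp r; rewrite sE in dp *; move=> sle.
  (* With this exponent p_r X^i has degree exactly d + e + 1, so the divided difference returns the
     leading coefficient of p_r. *)
  pose i := ((d + e).+1 - s)%N; have ie : (i < e.+1)%N by rewrite /i; lia.
  have si : (size (p r * 'X^i)%R <= (d + e).+2)%N.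
    by rewrite size_mulXn ?sE /i -?size_poly_gt0 ?sE //; lia.
  have := wE _ si; rewrite (eq_bigr (fun j => A r j * (c j * a j ^+ i))).
    have -> : \sum_j A r j * (c j * a j ^+ i) = 0.
      have := congr1 (fun B : 'M_(_, _) => B r (Ordinal ie)) A0.
      rewrite !mxE => E; rewrite -[RHS]E.
      by apply: eq_bigr => j _; rewrite !mxE expr1n mulr1.
    rewrite coefMXn /i ltnNge leq_subr /= => /esym/eqP.
    have -> : ((d + e).+1 - ((d + e).+1 - s) = s)%N by lia.
    have -> : (p r)`_s = lead_coef (p r) by rewrite lead_coefE sE.
    by rewrite lead_coef_eq0 -size_poly_eq0 sE.
  move=> j _; rewrite hornerM pE hornerXn.
  by rewrite -!mulrA [_^-1 * _]mulrC !mulrA; field.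
exists (\matrix_(r, i) (p r)`_i), (fun j => w j / c j).
apply/matrixP => r j; rewrite !mxE.
rewrite (eq_bigr (fun i : 'I_d.+1 => w j / c j * ((p r)`_i * a j ^+ i))).
  rewrite -mulr_sumr -(horner_coef_wide _ (sp' r)) pE.
  by field; rewrite c0 w0.
by move=> i _; rewrite !mxE expr1n mulr1; ring.
Qed.

(** * Transfer of a closed class to Gale duals *)

Section Dual.
Variables (k : closedFieldType) (d e n : nat).
Hypothesis nE : n = (d + e).+2.
Variable Z : 'M[k]_(d.+1, n) -> Prop.
Hypotheses (Zc : curve_closed Z) (Zg : contains_good Z).

Definition dual_class (B : 'M[k]_(e.+1, n)) : Prop :=
  row_free B -> forall A, A *m B^T = 0 -> Z A.

Lemma dual_class_good : contains_good dual_class.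
Proof.
move=> M c a Mu c0 ai _ A.
rewrite trmx_mul mulmxA => /(congr1 (mulmx^~ (invmx M^T))).
rewrite mulmxK ?unitmx_tr // mul0mx => /(dual_moment nE ai c0)[N [c' ->]].
exact: curve_closed_moment.
Qed.

(** A right inverse C of B(0) yields a polynomial deformation A' of A with A' B^T = 0; the factor
    det G, equal to 1 at 0, clears the denominator of (B C)^-1. *)
Lemma dual_class_closed : curve_closed dual_class.
Proof.
move=> B q q0 Bq /row_freeP[C BC] A AB.
pose G := B *m map_mx polyC C.
have Gx x : at_pt x G = at_pt x B *m C by rewrite at_ptM at_ptC.
have G0 : (\det G).[0] = 1 by rewrite -det_at_pt Gx BC det1.
pose A' := \det G *: map_mx polyC A -
  map_mx polyC A *m B^T *m \adj G^T *m (map_mx polyC C)^T.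
have A'B : A' *m B^T = 0.
  rewrite mulmxBl -!mulmxA -trmx_mul -/G mul_adj_mx det_tr.
  by rewrite -scalemxAl mulmxA mul_mx_scalar subrr.
have -> : A = at_pt 0 A'.
  rewrite at_ptB !at_ptM [at_pt 0 B^T](_ : _ = (at_pt 0 B)^T); last by rewrite /at_pt map_trmx.
  rewrite at_ptC AB !mul0mx subr0.
  apply/matrixP => i j; rewrite !mxE /horner_eval hornerM hornerC.
  by rewrite -[X in _ = X * _]/((\det G).[0]) G0 mul1r.
apply: (Zc (q := q * \det G)) => [|x].
  rewrite mulf_neq0 //; apply: contra_eq_neq G0 => ->.
  by rewrite horner0 eq_sym oner_eq0.
rewrite hornerM mulf_eq0 negb_or -det_at_pt Gx => /andP[qx Gu].
apply: (Bq x qx).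
  apply/row_freeP; exists (C *m invmx (at_pt x B *m C)).
  by rewrite mulmxA mulmxV // unitmxE unitfE.
rewrite [(at_pt x B)^T](_ : _ = at_pt x B^T); last by rewrite /at_pt map_trmx.
by rewrite -at_ptM A'B /at_pt raddf0.
Qed.

End Dual.

(** * Degenerations of rational normal curves *)

Section Limits.
Variables (k : closedFieldType) (e n : nat) (Z : 'M[k]_(e.+1, n) -> Prop).
Hypotheses (Zc : curve_closed Z) (Zm : forall M c s t, Z (M *m moment e c s t)).

Lemma on_curve (u : 'I_e.+1 -> 'cV[k]_e.+1) (B : 'M[k]_(e.+1, n)) :
  (forall j, exists c s t,
    col j B = \sum_(i < e.+1) (c * s ^+ (e - i) * t ^+ i) *: u i) -> Z B.
Proof.
move=> H; have /fin_all_exists[f fP] (j : 'I_n) : exists cst : k * k * k,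
    col j B = \sum_(i < e.+1)
      (cst.1.1 * cst.1.2 ^+ (e - i) * cst.2 ^+ i) *: u i.
  by have [c [s [t E]]] := H j; exists (c, s, t).
suff -> : B = (\matrix_(r, i) u i r 0) *m moment e (fun j => (f j).1.1)
    (fun j => (f j).1.2) (fun j => (f j).2) by [].
apply/matrixP => r j; have := congr1 (fun v : 'cV_ _ => v r 0) (fP j).
rewrite !mxE summxE => ->; apply: eq_bigr => i _.
by rewrite !mxE mulrC.
Qed.

(** The torus elements x^w degenerate the curve as x tends to 0; each point only has to be the value
    at 0 of a family of points on the moved curves. *)
Lemma toric_limit (w : 'I_e.+1 -> nat) (u : 'I_e.+1 -> 'cV[k]_e.+1)
    (B : 'M[k]_(e.+1, n)) :
  (forall j, exists2 p : 'I_e.+1 -> {poly k},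
     col j B = \sum_(i < e.+1) (p i).[0] *: u i &
     forall x, x != 0 -> exists c s t, forall i,
       (p i).[x] = c * s ^+ (e - i) * t ^+ i * x ^+ w i) -> Z B.
Proof.
move=> /fin_all_exists2[p p0 px].
pose Bp : 'M[{poly k}]_(e.+1, n) :=
  (\matrix_(r, i) (u i r 0)%:P) *m \matrix_(i, j) p j i.
have colB x j : col j (at_pt x Bp) = \sum_(i < e.+1) (p j i).[x] *: u i.
  apply/colP => r; rewrite !mxE summxE /horner_eval horner_sum.
  by apply: eq_bigr => i _; rewrite !mxE hornerM hornerC mulrC.
suff -> : B = at_pt 0 Bp.
  apply: (Zc (q := 'X)) => [|x]; first by rewrite polyX_eq0.
  rewrite hornerX => x0; apply: (@on_curve (fun i => x ^+ w i *: u i)) => j.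
  have [c [s [t E]]] := px j x x0; exists c, s, t.
  by rewrite colB; apply: eq_bigr => i _; rewrite E scalerA.
apply/matrixP => r j; have := congr1 (fun v : 'cV_ _ => v r 0) (colB 0 j).
by rewrite -p0 !mxE => <-.
Qed.

End Limits.

(** Points of the moved conics satisfy p0 p2 = x^2 p1^2, which tends to the pair of lines p0 p2 = 0
    with node u1. *)
Lemma two_lines_limit (k : closedFieldType) (n : nat)
    (Z : 'M[k]_(3, n) -> Prop) (u0 u1 u2 : 'cV[k]_3) (B : 'M[k]_(3, n)) :
  curve_closed Z -> (forall M c s t, Z (M *m moment 2 c s t)) ->
  (forall j, (exists s t, col j B = s *: u0 + t *: u1) \/
             (exists s t, col j B = s *: u1 + t *: u2)) -> Z B.
Proof.
move=> Zc Zm H.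
pose good v := exists p0 p1 p2 : {poly k},
    v = p0.[0] *: u0 + p1.[0] *: u1 + p2.[0] *: u2 /\
    forall x, x != 0 -> exists c s t,
      [/\ p0.[x] = c * s ^+ 2, p1.[x] = c * s * t & p2.[x] = c * t ^+ 2 * x ^+ 2].
apply: (toric_limit Zc Zm (w := tnth [tuple 0; 0; 2]%N)
  (u := tnth [tuple u0; u1; u2])) => j.
suff [p0 [p1 [p2 [E px]]]] : good (col j B).
  exists (tnth [tuple p0; p1; p2]) => [|x /px[c [s [t [E0 E1 E2]]]]].
    by rewrite E !big_ord_recl big_ord0 addr0 addrA.
  exists c, s, t => -[[|[|[|//]]] i] /=; rewrite /tnth /= ?E0 ?E1 ?E2 /=; ring.
(* The node is treated apart because the formulas for the two lines divide by s or t; it is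
   approached halfway between the slopes 0 and 2 of the weights. *)
have atu1 t : good (t *: u1).
  exists (t *: 'X), t%:P, (t *: 'X); split.
    by rewrite !(hornerZ, hornerX, hornerC) mulr0 !scale0r add0r addr0.
  move=> x x0; exists (t / x), x, 1.
  by rewrite !(hornerZ, hornerX, hornerC); split; field.
case: (H j) => -[s [t ->]].
  have [->|s0] := eqVneq s 0; first by rewrite scale0r add0r.
  exists s%:P, t%:P, ((t ^+ 2 / s) *: 'X^2); split.
    by rewrite !(hornerZ, hornerXn, hornerC) expr0n mulr0 scale0r addr0.
  move=> x x0; exists s^-1, s, t.
  by rewrite !(hornerZ, hornerXn, hornerC); split; field.
have [->|t0] := eqVneq t 0; first by rewrite scale0r addr0.
exists ((s ^+ 2 / t) *: 'X^2), s%:P, t%:P; split.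
  by rewrite !(hornerZ, hornerXn, hornerC) expr0n mulr0 scale0r add0r.
move=> x x0; exists (x ^- 2 / t), (x ^+ 2 * s), t.
by rewrite !(hornerZ, hornerXn, hornerC); split; field; rewrite x0 t0.
Qed.

(** The weights 0, 0, 2, 6 are convex with slopes 0, 2, 4, one for each line. A point of a line is
    reached with s scaled by x to that slope, a node with the slope halfway between, 1 or 3. *)
Lemma three_lines_limit (k : closedFieldType) (n : nat)
    (Z : 'M[k]_(4, n) -> Prop) (u0 u1 u2 u3 : 'cV[k]_4) (B : 'M[k]_(4, n)) :
  curve_closed Z -> (forall M c s t, Z (M *m moment 3 c s t)) ->
  (forall j, [\/ exists s t, col j B = s *: u0 + t *: u1,
                 exists s t, col j B = s *: u1 + t *: u2 |
                 exists s t, col j B = s *: u2 + t *: u3]) -> Z B.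
Proof.
move=> Zc Zm H.
pose good v := exists p0 p1 p2 p3 : {poly k},
    v = p0.[0] *: u0 + p1.[0] *: u1 + p2.[0] *: u2 + p3.[0] *: u3 /\
    forall x, x != 0 -> exists c s t,
      [/\ p0.[x] = c * s ^+ 3, p1.[x] = c * s ^+ 2 * t,
          p2.[x] = c * s * t ^+ 2 * x ^+ 2 & p3.[x] = c * t ^+ 3 * x ^+ 6].
apply: (toric_limit Zc Zm (w := tnth [tuple 0; 0; 2; 6]%N)
  (u := tnth [tuple u0; u1; u2; u3])) => j.
suff [p0 [p1 [p2 [p3 [E px]]]]] : good (col j B).
  exists (tnth [tuple p0; p1; p2; p3]) => [|x /px[c [s [t [E0 E1 E2 E3]]]]].
    by rewrite E !big_ord_recl big_ord0 addr0 !addrA.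
  exists c, s, t => -[[|[|[|[|//]]]] i] /=; rewrite /tnth /= ?E0 ?E1 ?E2 ?E3 /=; ring.
have atu1 t : good (t *: u1).
  exists (t *: 'X), t%:P, (t *: 'X), (t *: 'X^4); split.
    by rewrite !(hornerZ, hornerXn, hornerX, hornerC) expr0n !mulr0 !scale0r add0r !addr0.
  move=> x x0; exists (t / x ^+ 2), x, 1.
  by rewrite !(hornerZ, hornerXn, hornerX, hornerC); split; field.
have atu2 t : good (t *: u2).
  exists (t *: 'X^4), (t *: 'X), t%:P, (t *: 'X); split.
    by rewrite !(hornerZ, hornerXn, hornerX, hornerC) expr0n !mulr0 !scale0r !add0r !addr0.
  move=> x x0; exists (t / x ^+ 5), (x ^+ 3), 1.
  by rewrite !(hornerZ, hornerXn, hornerX, hornerC); split; field.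
case: (H j) => -[s [t ->]].
- have [->|s0] := eqVneq s 0; first by rewrite scale0r add0r.
  exists s%:P, t%:P, ((t ^+ 2 / s) *: 'X^2), ((t ^+ 3 / s ^+ 2) *: 'X^6); split.
    by rewrite !(hornerZ, hornerXn, hornerC) !expr0n !mulr0 !scale0r !addr0.
  move=> x x0; exists (s ^- 2), s, t.
  by rewrite !(hornerZ, hornerXn, hornerC); split; field.
- have [->|s0] := eqVneq s 0; first by rewrite scale0r add0r.
  have [->|t0] := eqVneq t 0; first by rewrite scale0r addr0.
  exists ((s ^+ 2 / t) *: 'X^2), s%:P, t%:P, ((t ^+ 2 / s) *: 'X^2); split.
    by rewrite !(hornerZ, hornerXn, hornerC) !expr0n !mulr0 !scale0r add0r !addr0.
  move=> x x0; exists (x ^- 4 / (s * t)), (x ^+ 2 * s), t.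
  by rewrite !(hornerZ, hornerXn, hornerC); split; field; rewrite x0 ?s0 ?t0.
have [->|t0] := eqVneq t 0; first by rewrite scale0r addr0.
exists ((s ^+ 3 / t ^+ 2) *: 'X^6), ((s ^+ 2 / t) *: 'X^2), s%:P, t%:P; split.
  by rewrite !(hornerZ, hornerXn, hornerC) !expr0n !mulr0 !scale0r !add0r.
move=> x x0; exists (x ^- 6 / t ^+ 2), (x ^+ 4 * s), t.
by rewrite !(hornerZ, hornerXn, hornerC); split; field; rewrite x0 ?t0.
Qed.

Lemma concurrent_lines_limit (k : closedFieldType) (n : nat)
    (Z : 'M[k]_(4, n) -> Prop) (e u0 u1 u2 : 'cV[k]_4) (B : 'M[k]_(4, n)) :
  curve_closed Z -> (forall M c s t, Z (M *m moment 3 c s t)) ->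
  (forall j, [\/ exists s t, col j B = s *: e + t *: u0,
                 exists s t, col j B = s *: e + t *: u1 |
                 exists s t, col j B = s *: e + t *: u2]) -> Z B.
Proof.
(* Limit of the chain of lines (u0 e), (e u1), (e + X u1, u2) as X -> 0. *)
move=> Zc Zm H.
pose good v := exists p : 'cV[{poly k}]_4, at_pt 0 p = v /\
  forall x, x != 0 -> [\/ exists s t, at_pt x p = s *: u0 + t *: e,
    exists s t, at_pt x p = s *: e + t *: (e + x *: u1) |
    exists s t, at_pt x p = s *: (e + x *: u1) + t *: u2].
have constp (v : 'cV[k]_4) x : at_pt x (map_mx polyC v) = v by exact: at_ptC.
have /fin_all_exists[p pP] (j : 'I_n) : good (col j B).
  case: (H j) => -[s [t ->]].
  - exists (map_mx polyC (s *: e + t *: u0)); rewrite constp; split=> // x _.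
    by constructor 1; exists t, s; rewrite constp addrC.
  - exists (map_mx polyC (s *: e + t *: u1)); rewrite constp; split=> // x x0.
    constructor 2; exists (s - t / x), (t / x); rewrite constp.
    by apply/colP => i; rewrite !mxE; field.
  exists (\col_i ((s * e i 0 + t * u2 i 0)%:P + (s * u1 i 0) *: 'X)); split.
    apply/colP => i; rewrite !mxE /horner_eval !(hornerD, hornerZ, hornerX, hornerC).
    by rewrite mulr0 addr0.
  move=> x _; constructor 3; exists s, t.
  apply/colP => i; rewrite !mxE /horner_eval !(hornerD, hornerZ, hornerX, hornerC).
  by ring.
pose Bp : 'M[{poly k}]_(4, n) := \matrix_(i, j) p j i 0.
have colB x j : col j (at_pt x Bp) = at_pt x (p j).
  by apply/colP => r; rewrite !mxE.
have -> : B = at_pt 0 Bp.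
  apply/matrixP => r j; have [/(congr1 (fun v : 'cV_ _ => v r 0)) E _] := pP j.
  by have := E; rewrite !mxE => ->.
apply: (Zc _ 'X) => [|x]; first by rewrite polyX_eq0.
rewrite hornerX => x0.
apply: (three_lines_limit (u0 := u0) (u1 := e) (u2 := e + x *: u1) (u3 := u2)) => // j.
rewrite colB.
by have [_ /(_ x x0)] := pP j.
Qed.

(** In the order u3, u0, u1, u2 the weights 2, 0, 0, 0 have slopes -2, 0, 0: the equal slopes keep a
    conic, the other one splits off the line through u0 and u3. *)
Lemma conic_line_limit (k : closedFieldType) (n : nat)
    (Z : 'M[k]_(4, n) -> Prop) (u0 u1 u2 u3 : 'cV[k]_4) (B : 'M[k]_(4, n)) :
  curve_closed Z -> (forall M c s t, Z (M *m moment 3 c s t)) ->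
  (forall j, (exists c s t,
      col j B = c *: (s ^+ 2 *: u0 + (s * t) *: u1 + t ^+ 2 *: u2)) \/
    (exists s t, col j B = s *: u0 + t *: u3)) -> Z B.
Proof.
move=> Zc Zm H.
pose good v := exists p0 p1 p2 p3 : {poly k},
    v = p0.[0] *: u3 + p1.[0] *: u0 + p2.[0] *: u1 + p3.[0] *: u2 /\
    forall x, x != 0 -> exists c s t,
      [/\ p0.[x] = c * s ^+ 3 * x ^+ 2, p1.[x] = c * s ^+ 2 * t,
          p2.[x] = c * s * t ^+ 2 & p3.[x] = c * t ^+ 3].
apply: (toric_limit Zc Zm (w := tnth [tuple 2; 0; 0; 0]%N)
  (u := tnth [tuple u3; u0; u1; u2])) => j.
suff [p0 [p1 [p2 [p3 [E px]]]]] : good (col j B).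
  exists (tnth [tuple p0; p1; p2; p3]) => [|x /px[c [s [t [E0 E1 E2 E3]]]]].
    by rewrite E !big_ord_recl big_ord0 addr0 !addrA.
  exists c, s, t => -[[|[|[|[|//]]]] i] /=; rewrite /tnth /= ?E0 ?E1 ?E2 ?E3 /=; ring.
have atu0 t : good (t *: u0).
  exists (t *: 'X), t%:P, (t *: 'X), (t *: 'X^2); split.
    by rewrite !(hornerZ, hornerXn, hornerX, hornerC) expr0n !mulr0 !scale0r add0r !addr0.
  move=> x x0; exists (t / x), 1, x.
  by rewrite !(hornerZ, hornerXn, hornerX, hornerC); split; field.
case: (H j) => [[c [s [t ->]]]|[s [t ->]]].
  have [->|t0] := eqVneq t 0.
    by rewrite mulr0 expr0n !scale0r !addr0 scalerA.
  exists ((c * s ^+ 3 / t) *: 'X^2), (c * s ^+ 2)%:P, (c * s * t)%:P, (c * t ^+ 2)%:P.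
  split.
    rewrite !(hornerZ, hornerXn, hornerC) expr0n mulr0 scale0r add0r.
    by rewrite !scalerDr !scalerA mulrA.
  move=> x x0; exists (c / t), s, t.
  by rewrite !(hornerZ, hornerXn, hornerC); split; field.
have [->|t0] := eqVneq t 0; first by rewrite scale0r addr0.
exists t%:P, s%:P, ((s ^+ 2 / t) *: 'X^2), ((s ^+ 3 / t ^+ 2) *: 'X^4); split.
  by rewrite !(hornerZ, hornerXn, hornerC) !expr0n !mulr0 !scale0r !addr0 addrC.
move=> x x0; exists (t / x ^+ 2), 1, (x ^+ 2 * s / t).
by rewrite !(hornerZ, hornerXn, hornerC); split; field; rewrite x0 ?t0.
Qed.

(** * Quadratic forms and conics in every characteristic *)

Definition qform (R : comNzRingType) (n : nat) (Q : 'M[R]_n) (v : 'cV[R]_n) : R :=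
  (v^T *m Q *m v) 0 0.

Definition polar (R : comNzRingType) (n : nat) (Q : 'M[R]_n) (u v : 'cV[R]_n) : R :=
  (u^T *m (Q + Q^T) *m v) 0 0.

Section QuadraticForms.
Variables (R : comNzRingType) (n : nat) (Q : 'M[R]_n).
Implicit Types u v w : 'cV[R]_n.

Lemma polarDl u v w : polar Q (u + v) w = polar Q u w + polar Q v w.
Proof. by rewrite /polar; move: (Q + _) => S; rewrite linearD /= !mulmxDl mxE. Qed.

Lemma polarDr u v w : polar Q w (u + v) = polar Q w u + polar Q w v.
Proof. by rewrite /polar; move: (Q + _) => S; rewrite mulmxDr mxE. Qed.

Lemma polarZl a u v : polar Q (a *: u) v = a * polar Q u v.
Proof. by rewrite /polar; move: (Q + _) => S; rewrite linearZ /= -!scalemxAl mxE. Qed.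

Lemma polarZr a u v : polar Q u (a *: v) = a * polar Q u v.
Proof. by rewrite /polar -!scalemxAr mxE. Qed.

Lemma polarC u v : polar Q u v = polar Q v u.
Proof.
rewrite /polar -[LHS](_ : (u^T *m (Q + Q^T) *m v)^T 0 0 = _); last by rewrite mxE.
by rewrite !trmx_mul trmxK [(Q + Q^T)^T]linearD /= trmxK mulmxA [Q^T + Q]addrC.
Qed.

Lemma qformD u v : qform Q (u + v) = qform Q u + qform Q v + polar Q u v.
Proof.
have D (A B : 'M[R]_1) : (A + B) 0 0 = A 0 0 + B 0 0 by rewrite mxE.
rewrite /qform /polar [(u + v)^T]linearD /= !mulmxDr !mulmxDl !D.
have -> : (v^T *m Q *m u) 0 0 = (u^T *m Q^T *m v) 0 0.
  rewrite -[LHS](_ : (v^T *m Q *m u)^T 0 0 = _); last by rewrite mxE.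
  by rewrite !trmx_mul trmxK mulmxA.
by ring.
Qed.

Lemma qformZ a v : qform Q (a *: v) = a ^+ 2 * qform Q v.
Proof.
by rewrite /qform [(a *: v)^T]linearZ /= -!scalemxAl -!scalemxAr scalerA mxE.
Qed.

Lemma polar_diag v : polar Q v v = qform Q v *+ 2.
Proof.
have := qformD v v; rewrite -mulr2n -scaler_nat qformZ => E.
by apply: (addrI (qform Q v *+ 2)); rewrite -E -mulr_natl; ring.
Qed.

Lemma qform_comb3 x y z u v w :
  qform Q (x *: u + y *: v + z *: w) =
  x ^+ 2 * qform Q u + y ^+ 2 * qform Q v + z ^+ 2 * qform Q w +
  x * y * polar Q u v + x * z * polar Q u w + y * z * polar Q v w.
Proof. by rewrite !qformD !polarDl !polarZl !polarZr !qformZ; ring. Qed.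

Lemma qformM m (Q' : 'M[R]_m) (H : 'M[R]_(m, n)) v :
  qform Q' (H *m v) = qform (H^T *m Q' *m H) v.
Proof. by rewrite /qform trmx_mul !mulmxA. Qed.

End QuadraticForms.

Lemma binary_quadratic_root (k : closedFieldType) (a b c : k) :
  exists x y : k, ((x, y) != (0, 0)) && (a * x ^+ 2 + b * x * y + c * y ^+ 2 == 0).
Proof.
have [->|a0] := eqVneq a 0.
  by exists 1, 0; rewrite xpair_eqE oner_eq0 expr0n !mulr0 mul0r !addr0 eqxx.
have /closed_rootP[x /rootP xr] : size (Poly [:: c; b; a]) != 1%N.
  by rewrite (PolyK (c := 0)).
exists x, 1; rewrite xpair_eqE oner_eq0 andbF /=; apply/eqP; rewrite -xr.
by rewrite horner_Poly /=; ring.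
Qed.

(* A conic with a rational point e is either parametrized by projecting from e
   (and then e is the point t = 0), or a union of two lines meeting outside e,
   or a union of two lines through e. *)
Lemma pointed_conic (k : closedFieldType) (n : nat) (Q : 'M[k]_n)
    (e g h : 'cV[k]_n) :
  qform Q e = 0 ->
  (exists x y z, qform Q (x *: e + y *: g + z *: h) != 0) ->
  exists u v a, a != 0 /\
    let on_conic P := forall x y z, qform Q (x *: e + y *: g + z *: h) = 0 ->
      P (x *: e + y *: g + z *: h) : Prop in
    [\/ on_conic (fun p => exists c s t,
          p = c *: (s ^+ 2 *: (a *: e) + (s * t) *: u + t ^+ 2 *: v)),
        on_conic (fun p => (exists s t, p = s *: e + t *: u) \/
                           (exists s t, p = s *: u + t *: v)) |
        on_conic (fun p => (exists s t, p = s *: e + t *: u) \/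
                           (exists s t, p = s *: e + t *: v))].
Proof.
move=> qe qn.
have vecP (p q : 'cV[k]_n) : (forall i, p i 0 = q i 0) -> p = q.
  by move=> E; apply/colP.
have [/andP[/eqP pg /eqP ph]|] := boolP ((polar Q e g == 0) && (polar Q e h == 0)).
  (* q = a binary form in y, z, i.e. two lines through e *)
  have [y0 [z0 /andP[yz0 /eqP qf]]] :=
    binary_quadratic_root (qform Q g) (polar Q g h) (qform Q h).
  set A := qform Q g in qf; set B := polar Q g h in qf; set C := qform Q h in qf.
  have qE x y z : qform Q (x *: e + y *: g + z *: h) = A * y ^+ 2 + B * y * z + C * z ^+ 2.
    by rewrite qform_comb3 qe pg ph /A /B /C; ring.
  exists (y0 *: g + z0 *: h).
  have [z00|z00] := eqVneq z0 0.
    have y00 : y0 != 0 by move: yz0; rewrite xpair_eqE z00 eqxx andbT.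
    have A0 : A = 0.
      move: qf; rewrite z00 expr0n !mulr0 !addr0 => /eqP.
      by rewrite mulf_eq0 expf_eq0 (negPf y00) orbF => /eqP.
    exists (C *: g - B *: h), 1; split; first exact: oner_neq0.
    constructor 3 => x y z; rewrite qE A0 mul0r add0r.
    move=> /eqP; rewrite expr2 mulrA -mulrDl mulf_eq0 orbC => /orP[/eqP->|/eqP E].
      left; exists x, (y / y0); apply: vecP => i; rewrite !mxE z00; field.
      by [].
    have [B0|B0] := eqVneq B 0.
      have C0 : C != 0.
        case: qn => [x' [y' [z']]]; rewrite qE A0 B0 !mul0r !add0r mulf_eq0 negb_or.
        by case/andP.
      have z0' : z = 0.
        by move/eqP: E; rewrite B0 mul0r add0r mulf_eq0 (negPf C0) => /eqP.
      left; exists x, (y / y0); apply: vecP => i; rewrite !mxE z00 z0'; field.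
      by [].
    right; exists x, (- z / B); apply: vecP => i; rewrite !mxE.
    have -> : y = - (C * z) / B.
      by apply: (mulfI B0); rewrite mulrCA divff // mulr1; apply/eqP; rewrite -addr_eq0 E.
    by field.
  pose b := (2%:R * A * y0 / z0 + B); pose c := A.
  (* in the basis y = y0 s + r, z = z0 s of the y, z-plane *)
  have qE' x r s : qform Q (x *: e + (y0 * s + r) *: g + (z0 * s) *: h) =
      r * (c * r + z0 * b * s).
    rewrite qE; transitivity ((A * y0 ^+ 2 + B * y0 * z0 + C * z0 ^+ 2) * s ^+ 2 +
      r * (c * r + z0 * b * s)); last by rewrite qf mul0r add0r.
    by rewrite /b /c; field.
  have decE y z : exists r s, y = y0 * s + r /\ z = z0 * s.
    by exists (y - y0 * (z / z0)), (z / z0); split; [ring|field].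
  have bc : b != 0 \/ c != 0.
    apply/orP; rewrite -negb_and; apply/negP => /andP[/eqP b0 /eqP c0].
    case: qn => [x [y [z]]].
    have [r [s [-> ->]]] := decE y z.
    by rewrite qE' b0 c0 !(mul0r, mulr0) addr0 mulr0 eqxx.
  exists (c *: (y0 *: g + z0 *: h) - (z0 * b) *: g), 1; split; first exact: oner_neq0.
  constructor 3 => x y z; have [r [s [-> ->]]] := decE y z.
  rewrite qE' => /eqP; rewrite mulf_eq0 => /orP[/eqP ->|/eqP E].
    by left; exists x, s; apply: vecP => i; rewrite !mxE; ring.
  have [b0|b0] := eqVneq b 0.
    have c0 : c != 0 by case: bc => //; rewrite b0 eqxx.
    have r0 : r = 0.
      by move/eqP: E; rewrite b0 !(mulr0, mul0r, addr0) mulf_eq0 (negPf c0) => /eqP.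
    by left; exists x, s; apply: vecP => i; rewrite !mxE r0; ring.
  right; exists x, (- r / (z0 * b)); apply: vecP => i; rewrite !mxE.
  have -> : s = - (c * r) / (z0 * b).
    have zb : z0 * b != 0 by rewrite mulf_neq0.
    apply: (mulfI zb); rewrite mulrCA divff // mulr1; apply/eqP.
    by rewrite -addr_eq0 addrC E.
  by field; rewrite z00 b0.
rewrite negb_and => pgh.
(* q = x z + a y^2 in the basis e, u, v *)
have [f [h' [efh [pf ph' spn]]]] : exists f h' : 'cV[k]_n,
    [/\ (exists y z, f = y *: g + z *: h) /\ (exists y z, h' = y *: g + z *: h),
      polar Q e f = 0, polar Q e h' = 1 &
      forall y z, exists r s, y *: g + z *: h = r *: f + s *: h'].
  have [pg0|pg0] := eqVneq (polar Q e g) 0.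
    have ph0 : polar Q e h != 0 by move: pgh; rewrite pg0 eqxx.
    exists g, ((polar Q e h)^-1 *: h); split=> //.
    - split; first by exists 1, 0; rewrite scale1r scale0r addr0.
      by exists 0, (polar Q e h)^-1; rewrite scale0r add0r.
    - by rewrite polarZr mulVf.
    move=> y z; exists y, (z * polar Q e h).
    by apply: vecP => i; rewrite !mxE; field.
  exists (h - (polar Q e h / polar Q e g) *: g), ((polar Q e g)^-1 *: g); split.
  - split; first by exists (- (polar Q e h / polar Q e g)), 1; rewrite scale1r addrC scaleNr.
    by exists (polar Q e g)^-1, 0; rewrite scale0r addr0.
  - by rewrite polarDr -scaleNr polarZr; field.
  - by rewrite polarZr mulVf.
  move=> y z; exists z, (y * polar Q e g + z * polar Q e h).
  by apply: vecP => i; rewrite !mxE; field.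
pose a := qform Q f.
(* Subtracting these multiples of e makes u and v orthogonal and v isotropic. *)
pose u := f - (polar Q f h') *: e; pose v := h' - qform Q h' *: e.
have qE x y z : qform Q (x *: e + y *: u + z *: v) = x * z + a * y ^+ 2.
  have -> : x *: e + y *: u + z *: v =
      (x - y * polar Q f h' - z * qform Q h') *: e + y *: f + z *: h'.
    by apply: vecP => i; rewrite !mxE; ring.
  by rewrite qform_comb3 qe pf ph' /a; ring.
have decE x y z : exists x' y' z',
    x *: e + y *: g + z *: h = x' *: e + y' *: u + z' *: v.
  have [r [s E]] := spn y z; exists (x + r * polar Q f h' + s * qform Q h'), r, s.
  by rewrite -addrA E; apply: vecP => i; rewrite !mxE; ring.
have [a0|a0] := eqVneq a 0; last first.
  exists u, v, (- a); split; first by rewrite oppr_eq0.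
  constructor 1 => x y z; have [x' [y' [z' ->]]] := decE x y z.
  rewrite qE => E.
  have [z0|z0] := eqVneq z' 0.
    have y0 : y' = 0.
      move/eqP: E; rewrite z0 mulr0 add0r mulf_eq0 (negPf a0) expf_eq0 /=.
      by move/eqP.
    exists (- x' / a), 1, 0; rewrite y0 z0; apply: vecP => i; rewrite !mxE.
    by field.
  exists z'^-1, y', z'; apply: vecP => i; rewrite !mxE.
  have -> : x' = - (a * y' ^+ 2) / z'.
    by apply: (mulIf z0); rewrite divfK //; apply/eqP; rewrite -addr_eq0 E.
  by field.
exists u, v, 1; split; first exact: oner_neq0.
constructor 2 => x y z; have [x' [y' [z' ->]]] := decE x y z.
rewrite qE a0 mul0r addr0 => /eqP; rewrite mulf_eq0 => /orP[/eqP->|/eqP->].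
  by right; exists y', z'; rewrite scale0r add0r.
by left; exists x', y'; rewrite scale0r addr0.
Qed.

(** A point e of the conic is found on the line through the first two basis vectors. [pointed_conic]
    then gives a parametrized conic or a pair of lines, with node u in its second case and e in its
    third. *)
Lemma conic_class (k : closedFieldType) (n : nat) (Z : 'M[k]_(3, n) -> Prop)
    (Q : 'M[k]_3) (B : 'M[k]_(3, n)) :
  curve_closed Z -> (forall M c s t, Z (M *m moment 2 c s t)) ->
  (exists v, qform Q v != 0) -> (forall j, qform Q (col j B) = 0) -> Z B.
Proof.
move=> Zc Zm [v0 qv0] qB.
pose b (i : 'I_3) : 'cV[k]_3 := delta_mx i 0.
have [e [g [h [qe spn]]]] : exists e g h : 'cV[k]_3, qform Q e = 0 /\
    forall v, exists x y z, v = x *: e + y *: g + z *: h.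
  have [x [y /andP[xy /eqP E]]] := binary_quadratic_root
    (qform Q (b 0)) (polar Q (b 0) (b 1)) (qform Q (b 1)).
  have qe : qform Q (x *: b 0 + y *: b 1) = 0.
    by rewrite qformD !qformZ polarZl polarZr -E; ring.
  have vE (v : 'cV[k]_3) : v = v 0 0 *: b 0 + v 1 0 *: b 1 + v (inord 2) 0 *: b (inord 2).
    rewrite [LHS]matrix_sum_delta !big_ord_recl !big_ord0 !addr0 addrA /b.
    have -> : lift ord0 ord0 = 1 :> 'I_3 by apply/val_inj.
    have -> // : lift ord0 (lift ord0 ord0) = inord 2 :> 'I_3.
    by apply/val_inj; rewrite /= inordK.
  have [x0|x0] := eqVneq x 0.
    have y0 : y != 0 by move: xy; rewrite x0 xpair_eqE eqxx.
    exists (x *: b 0 + y *: b 1), (b 0), (b (inord 2)); split=> // v.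
    exists (v 1 0 / y), (v 0 0), (v (inord 2) 0); rewrite {1}[v]vE.
    by apply/colP => i; rewrite ![in RHS]mxE ![in LHS]mxE x0; field.
  exists (x *: b 0 + y *: b 1), (b 1), (b (inord 2)); split=> // v.
  exists (v 0 0 / x), (v 1 0 - v 0 0 / x * y), (v (inord 2) 0); rewrite {1}[v]vE.
  by apply/colP => i; rewrite ![in RHS]mxE ![in LHS]mxE; field.
have qn : exists x y z, qform Q (x *: e + y *: g + z *: h) != 0.
  by have [x [y [z E]]] := spn v0; exists x, y, z; rewrite -E.
have [u [v [a [a0 /= C]]]] := pointed_conic qe qn.
case: C => C.
- apply: (on_curve Zm (u := tnth [tuple a *: e; u; v])) => j.
  have [x [y [z E]]] := spn (col j B); have := C x y z.
  rewrite -E => /(_ (qB j))[c [s [t ->]]]; exists c, s, t.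
  rewrite !big_ord_recl big_ord0 addr0 /tnth /= !scalerDr addrA !scalerA.
  by rewrite !expr0 !expr1 !mulr1 mulrA.
- apply: (two_lines_limit (u0 := e) (u1 := u) (u2 := v)) => // j.
  by have [x [y [z E]]] := spn (col j B); rewrite E; apply: C; rewrite -E.
apply: (two_lines_limit (u0 := u) (u1 := e) (u2 := v)) => // j.
have [x [y [z E]]] := spn (col j B); rewrite E.
case: (C x y z); rewrite -?E // => -[s [t ->]]; [left|right]; last by exists s, t.
by exists t, s; rewrite addrC.
Qed.

(** The three cases of [pointed_conic] lead to a conic with a line attached at e, a chain of three
    lines, and three concurrent lines. *)
Lemma conic_line_class (k : closedFieldType) (n : nat)
    (Z : 'M[k]_(4, n) -> Prop) (Q : 'M[k]_4) (e g h b : 'cV[k]_4)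
    (B : 'M[k]_(4, n)) :
  curve_closed Z -> (forall M c s t, Z (M *m moment 3 c s t)) ->
  qform Q e = 0 -> (exists x y z, qform Q (x *: e + y *: g + z *: h) != 0) ->
  (forall j, ((exists x y z, col j B = x *: e + y *: g + z *: h) /\
              qform Q (col j B) = 0) \/
             exists s t, col j B = s *: e + t *: b) -> Z B.
Proof.
move=> Zc Zm qe qn H; have [u [v [a [a0 /= C]]]] := pointed_conic qe qn.
case: C => C.
- apply: (conic_line_limit (u0 := a *: e) (u1 := u) (u2 := v) (u3 := b)) => // j.
  case: (H j) => [[[x [y [z ->]]] /C]|[s [t ->]]]; first by left.
  by right; exists (s / a), t; rewrite scalerA divfK.
- apply: (three_lines_limit (u0 := b) (u1 := e) (u2 := u) (u3 := v)) => // j.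
  case: (H j) => [[[x [y [z ->]]] /C []]|[s [t ->]]].
  + by constructor 2.
  + by constructor 3.
  by constructor 1; exists t, s; rewrite addrC.
apply: (concurrent_lines_limit (e := e) (u0 := u) (u1 := v) (u2 := b)) => // j.
case: (H j) => [[[x [y [z ->]]] /C []]|]; by [constructor 1|constructor 2|constructor 3].
Qed.

(** * Complementary minors and their signs *)

Lemma colsE (R : comNzRingType) (r n m : nat) (A : 'M[R]_(r, n))
    (K : {set 'I_n}) (x0 : 'I_n) i (l : 'I_m) :
  #|K| = m -> cols m A K i l = A i (nth x0 (enum K) l).
Proof. by move=> Km; rewrite mxE (nth_map x0) // -cardE Km. Qed.

Lemma mul_cols (R : comNzRingType) (r n m : nat) (A : 'M[R]_(r, n))
    (K : {set 'I_n}) :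
  #|K| = m -> A *m cols m 1%:M K = cols m A K.
Proof.
move=> Km; apply/matrixP => i l; case: (pickP 'I_n) => [x0 _|no].
  rewrite (colsE _ x0) // mxE (bigD1 (nth x0 (enum K) l)) //= big1 => [|j jl].
    by rewrite (colsE _ x0) // mxE eqxx mulr1 addr0.
  by rewrite (colsE _ x0) // mxE (negPf jl) mulr0.
have := ltn_ord l; rewrite -{2}Km eq_card0 // => j.
by have := no j.
Qed.

(** Lists the complement of J and then J; the list has length n, so the default l is never
    returned. *)
Definition shuffle (n : nat) (J : {set 'I_n}) (l : 'I_n) : 'I_n :=
  nth l (enum (~: J) ++ enum J) l.

Lemma size_shuffle (n : nat) (J : {set 'I_n}) :
  size (enum (~: J) ++ enum J) = n.
Proof. by rewrite size_cat -!cardE addnC cardsC card_ord. Qed.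

Lemma shuffle_inj (n : nat) (J : {set 'I_n}) : injective (shuffle J).
Proof.
move=> i j; rewrite /shuffle (set_nth_default i) ?size_shuffle // => /eqP.
rewrite nth_uniq ?size_shuffle // => [/eqP/val_inj//|].
rewrite cat_uniq !enum_uniq andbT /=; apply/hasPn => x.
by rewrite !mem_enum inE => ->.
Qed.

Definition shuffle_odd (n : nat) (J : {set 'I_n}) : bool :=
  odd_perm (perm (@shuffle_inj n J)).

(* The maximal minors of A and of its kernel B are complementary: compare the
   columns e_j (j not in J) and the columns of B^T before and after applying
   an invertible matrix with upper part A. *)
Lemma complementary_minors (F : fieldType) (d n : nat) (A : 'M[F]_(d, n))
    (B : 'M[F]_(3, n)) :
  n = (d + 3)%N -> row_free A -> A *m B^T = 0 ->
  exists N g : F, [/\ N != 0, row_free B -> g != 0 & forall J : {set 'I_n}, #|J| = 3%N ->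
    \det (cols d A (~: J)) * g = N * (-1) ^+ shuffle_odd J * \det (cols 3 B J)].
Proof.
move=> nE; subst n => Af AB.
(* The last three rows C of [row_ebase A] complete A to an invertible matrix. *)
pose R := row_ebase A; pose C := dsubmx R.
have RE : R = col_mx (usubmx R) C by rewrite vsubmxK.
have Au : A = col_ebase A *m usubmx R.
  rewrite -{1}(mulmx_ebase A) (eqP Af) -mulmxA; congr (_ *m _).
  rewrite -/R {1}RE (_ : pid_mx d = row_mx 1%:M 0).
    by rewrite mul_row_col mul1mx mul0mx addr0.
  by rewrite -[pid_mx d]hsubmxK; congr row_mx; apply/matrixP => i j;
    rewrite !mxE /= ?ltn_ord ?andbT // ltn_eqF // ltn_addr.
pose N := col_mx A C.
have NE : N = block_mx (col_ebase A) 0 0 1%:M *m R.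
  by rewrite [X in _ *m X]RE mul_block_col !mul0mx addr0 add0r mul1mx -Au.
have Nu : N \in unitmx.
  rewrite NE unitmx_mul row_ebase_unit andbT unitmxE det_ublock det1 mulr1 -unitmxE.
  exact: col_ebase_unit.
exists (\det N), (\det (C *m B^T)); split.
- by rewrite -unitfE -unitmxE.
- move=> Bf; rewrite -det_tr -unitfE -unitmxE -row_free_unit.
  apply/inj_row_free => v; rewrite trmx_mul trmxK mulmxA => vBC.
  have : v *m B *m N^T = 0.
    rewrite /N tr_col_mx mul_mx_row vBC -mulmxA -[B *m A^T]trmxK trmx_mul trmxK.
    by rewrite AB trmx0 mulmx0 row_mx0.
  move=> /(congr1 (mulmx^~ (invmx N^T))); rewrite mulmxK ?unitmx_tr // mul0mx.
  by move=> vB; apply: (row_free_inj Bf); rewrite vB mul0mx.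
move=> J J3; have Jc : #|~: J| = d.
  by apply: (@addnI #|J|); rewrite cardsC card_ord J3 addnC.
pose T := row_mx (cols d 1%:M (~: J)) B^T.
have NT : N *m T = block_mx (cols d A (~: J)) 0 (C *m cols d 1%:M (~: J)) (C *m B^T).
  by rewrite mul_col_row AB mul_cols.
have dT : \det T = (-1) ^+ shuffle_odd J * \det (cols 3 B J).
  pose s := perm (@shuffle_inj _ J).
  have -> : \det T = (-1) ^+ s * \det (row_perm s T).
    by rewrite row_permE det_mulmx det_perm mulrA -exprD -signr_odd oddD addbb mul1r.
  congr (_ * _).
  pose x0 : 'I_(d + 3) := rshift d ord0.
  have sl (i : 'I_d) : s (lshift 3 i) = nth x0 (enum (~: J)) i.
    rewrite permE /shuffle (set_nth_default x0) ?size_shuffle //.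
    by rewrite nth_cat -cardE Jc /= ltn_ord.
  have sr (i : 'I_3) : s (rshift d i) = nth x0 (enum J) i.
    rewrite permE /shuffle (set_nth_default x0) ?size_shuffle // nth_cat.
    by rewrite -cardE Jc /= ltnNge leq_addr /= addKn.
  have -> : row_perm s T = block_mx 1%:M (\matrix_(i, j) B j (s (lshift 3 i))) 0
      (cols 3 B J)^T.
    apply/matrixP => i j; case: (split_ordP i) => i' ->; case: (split_ordP j) => j' ->.
    - rewrite block_mxEul mxE row_mxEl (colsE _ x0) // sl !mxE nth_uniq ?enum_uniq //.
        by rewrite -cardE Jc.
      by rewrite -cardE Jc.
    - by rewrite block_mxEur mxE row_mxEr !mxE.
    - rewrite block_mxEdl mxE row_mxEl (colsE _ x0) // sr !mxE.
      case: eqP => // E; have := mem_nth x0 (_ : (j' < size (enum (~: J)))%N).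
      rewrite -cardE Jc ltn_ord -E mem_enum inE => /(_ isT).
      by rewrite -mem_enum mem_nth // -cardE J3.
    rewrite block_mxEdr mxE row_mxEr mxE [RHS]mxE (colsE _ x0) // sr.
    by [].
  by rewrite det_ublock det1 mul1r det_tr.
by rewrite -mulrA -dT -det_mulmx NT det_lblock.
Qed.

Lemma nth_enum_ltn (n : nat) (K : {set 'I_n}) (x0 : 'I_n) (i j : nat) :
  (i < j)%N -> (j < #|K|)%N -> (nth x0 (enum K) i < nth x0 (enum K) j)%N.
Proof.
move=> ij jK; have szK : size (enum K) = #|K| by rewrite -cardE.
have so : sorted ltn (map val (enum K)).
  apply: (@subseq_sorted _ ltn _ _ (map val (enum 'I_n))).
  - exact: ltn_trans.
  - by apply: map_subseq; rewrite [X in subseq _ X]enumT; apply: filter_subseq.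
  by rewrite val_enum_ord iota_ltn_sorted.
have := sorted_ltn_nth ltn_trans (val x0) so i j.
rewrite !inE !size_map szK !(nth_map x0) ?szK //; last by apply: ltn_trans jK.
by apply=> //; apply: ltn_trans jK.
Qed.

Lemma det_cols_moment (R : comNzRingType) (e n : nat) (c a : 'I_n -> R)
    (K : {set 'I_n}) (x0 : 'I_n) :
  #|K| = e.+1 -> \det (cols e.+1 (moment e c (fun=> 1) a) K) =
  (\prod_(j in K) c j) * \prod_(i < e.+1) \prod_(j < e.+1 | (i < j)%N)
    (a (nth x0 (enum K) j) - a (nth x0 (enum K) i)).
Proof.
move=> Ke; pose x := nth x0 (enum K).
have -> : cols e.+1 (moment e c (fun=> 1) a) K =
    Vandermonde e.+1 (\row_(l < e.+1) a (x l)) *m diag_mx (\row_(l < e.+1) c (x l)).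
  apply/matrixP => i l; rewrite (colsE _ x0) // mul_mx_diag !mxE.
  by rewrite expr1n mulr1 mulrC.
rewrite det_mulmx det_Vandermonde det_diag mulrC; congr (_ * _).
  rewrite -[RHS]big_enum (big_nth x0) -cardE Ke big_mkord.
  by apply: eq_bigr => l _; rewrite mxE.
by apply: eq_bigr => i _; apply: eq_bigr => j _; rewrite !mxE.
Qed.

(* The sign is read off one rational pair (A, B) with known minors: a moment
   curve and its dual. *)
Lemma shuffle_sign (d : nat) : exists (s : bool) (h : 'I_d.+4 -> bool),
  forall J : {set 'I_d.+4}, #|J| = 3%N ->
    shuffle_odd J = s (+) \big[addb/false]_(j in J) h j.
Proof.
pose a (j : 'I_d.+4) : rat := j%:R.
have ai : injective a by move=> i j /eqP; rewrite eqr_nat => /eqP/val_inj.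
have [w w0 wE] := dual_weights ai.
have one0 (j : 'I_d.+4) : 1 != 0 :> rat by [].
pose A := moment d (fun=> 1) (fun=> 1) a; pose B := moment 2 w (fun=> 1) a.
have nE : d.+4 = (d.+1 + 3)%N by lia.
have AB : A *m B^T = 0.
  apply/matrixP => i l; rewrite !mxE.
  have := ltn_ord i; have := ltn_ord l => lt_l lt_i.
  have := wE 'X^(i + l); rewrite size_polyXn coefXn => /(_ ltac:(lia)).
  rewrite (_ : (d.+3 == i + l)%N = false); last by apply/eqP; lia.
  move=> E; rewrite -[RHS]E; apply: eq_bigr => j _.
  by rewrite !mxE !expr1n !mulr1 mul1r hornerXn exprD mulrCA.
have [N [g [N0 /(_ (row_free_moment _ w0 ai)) g0 E]]] :=
  complementary_minors nE (row_free_moment (ltac:(lia) : (d < d.+4)%N) one0 ai) AB.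
have {}g0 : g != 0 by apply: g0.
(* The nodes 0, 1, 2, ... increase, so Vandermonde products are positive and only the weights w_j
   give signs depending on J. *)
have pos e (K : {set 'I_d.+4}) : 0 < \prod_(i < e.+1) \prod_(j < e.+1 | (i < j)%N)
    (a (nth ord0 (enum K) j) - a (nth ord0 (enum K) i)) \/ #|K| <> e.+1.
  have [Ke|] := eqVneq #|K| e.+1; [left|by right; apply/eqP].
  apply: prodr_gt0 => i _; apply: prodr_gt0 => j ij.
  by rewrite subr_gt0 ltr_nat nth_enum_ltn // Ke.
pose sg (x : rat) := x < 0.
exists (sg g (+) sg N), (fun j => sg (w j)) => J J3.
have Jc : #|~: J| = d.+1 by apply: (@addnI #|J|); rewrite cardsC card_ord J3.
have := E J J3; rewrite !(det_cols_moment _ _ ord0) // big1 // mul1r.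
case: (pos d (~: J)) => // pA; case: (pos 2 J) => // pB.
move=> /(congr1 Num.sg); rewrite !sgrM (gtr0_sg pA) (gtr0_sg pB) mul1r mulr1.
rewrite (big_morph _ (@sgrM rat) (sgr1 rat)) (eq_bigr (fun j => (-1) ^+ sg (w j))); last first.
  by move=> j _; rewrite -neqr0_sign.
rewrite -(big_morph (fun b : bool => (-1) ^+ b) (id2 := false) (signr_addb rat) (expr0 _)).
have sgs (b : bool) : Num.sg ((-1) ^+ b : rat) = (-1) ^+ b.
  by case: b; rewrite ?sgrN1 ?sgr1.
rewrite sgs -!neqr0_sign // -!signr_addb => /signr_inj.
rewrite -/(sg g) -/(sg N) => ->.
by move: (\big[_/_]_(_ in J) _) (sg N) (shuffle_odd J); do 3!case.
Qed.

Definition bracket (R : comNzRingType) (u v w : 'cV[R]_3) : R :=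
  u 0 0 * (v 1 0 * w ord_max 0 - w 1 0 * v ord_max 0)
  - v 0 0 * (u 1 0 * w ord_max 0 - w 1 0 * u ord_max 0)
  + w 0 0 * (u 1 0 * v ord_max 0 - v 1 0 * u ord_max 0).

(* Vanishes exactly when the six points lie on a conic. *)
Definition psi6 (R : comNzRingType) (v1 v2 v3 v4 v5 v6 : 'cV[R]_3) : R :=
  bracket v1 v2 v3 * bracket v1 v4 v5 * bracket v2 v4 v6 * bracket v3 v5 v6
  - bracket v1 v2 v4 * bracket v1 v3 v5 * bracket v2 v3 v6 * bracket v4 v5 v6.

Definition psi6_at (R : comNzRingType) (n : nat) (B : 'M[R]_(3, n.+1))
    (I : {set 'I_n.+1}) : R :=
  let v l := col (nth ord0 (enum I) l) B in psi6 (v 0) (v 1) (v 2) (v 3) (v 4) (v 5).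

Lemma enum_set3 (n : nat) (a b c : 'I_n) :
  (a < b)%N -> (b < c)%N -> enum [set a; b; c] = [:: a; b; c].
Proof.
move=> ab bc; pose r := relpre (@nat_of_ord n) ltn.
apply: (@irr_sorted_eq _ r).
- by move=> x y z; apply: ltn_trans.
- by move=> x; rewrite /r /= ltnn.
- rewrite -(@sorted_map _ _ (@nat_of_ord n) ltn).
  apply: (@subseq_sorted _ ltn _ _ (map val (enum 'I_n))).
  + exact: ltn_trans.
  + by apply: map_subseq; rewrite [X in subseq _ X]enumT; apply: filter_subseq.
  by rewrite val_enum_ord iota_ltn_sorted.
- by rewrite /r /= ab bc.
by move=> x; rewrite mem_enum !inE orbA.
Qed.

(** The negation comes from 0 + 1 + 2 being odd. *)
Lemma S_set3 (n : nat) (a b c : 'I_n) :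
  (a < b)%N -> (b < c)%N -> odd (S_ [set a; b; c]) = ~~ (odd a (+) odd b (+) odd c).
Proof.
move=> ab bc; have e3 := enum_set3 ab bc.
have c3 : #|[set a; b; c]| = 3%N by rewrite cardE e3.
rewrite /S_ e3 c3 !big_ord_recl big_ord0 /= subn0 addn0 !oddD !oddB /bump /=; lia.
Qed.

Lemma det_cols_set3 (R : comNzRingType) (n : nat) (B : 'M[R]_(3, n)) (a b c : 'I_n) :
  (a < b)%N -> (b < c)%N ->
  \det (cols 3 B [set a; b; c]) = bracket (col a B) (col b B) (col c B).
Proof.
move=> ab bc; have e3 := enum_set3 ab bc.
rewrite (expand_det_row _ ord0) !big_ord_recl big_ord0 /cofactor.
rewrite !(expand_det_row _ ord0) !big_ord_recl !big_ord0 /cofactor !det_mx11.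
rewrite !mxE e3 /= /bump /= /bracket !mxE.
have -> : lift ord0 ord0 = 1 :> 'I_3 by apply/val_inj.
have -> : lift ord0 (lift ord0 ord0) = ord_max :> 'I_3 by apply/val_inj.
by ring.
Qed.

(** Each three-column minor acquires a global sign and one sign for each of its indices. Every index
    occurs twice in either product of [psi6], so the signs cancel in squares and only N^4 and g^4
    remain. *)
Lemma psi_gale (F : fieldType) (d : nat) (A : 'M[F]_(d.+1, d.+4))
    (B : 'M[F]_(3, d.+4)) :
  row_free A -> A *m B^T = 0 ->
  exists N g : F, [/\ N != 0, row_free B -> g != 0 &
    forall I : {set 'I_d.+4}, #|I| = 6%N -> psi A I * g = N * psi6_at B I].
Proof.
move=> Af AB; have nE : d.+4 = (d.+1 + 3)%N by lia.
have [N [g [N0 g0 E]]] := complementary_minors nE Af AB.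
have [s [h sE]] := shuffle_sign d.
exists (N ^+ 4), (g ^+ 4); split => [||I I6].
- exact: expf_neq0.
- by move=> /g0; apply: expf_neq0.
pose i l := nth ord0 (enum I) l.
have ilt l m : (l < m)%N -> (m < 6)%N -> (i l < i m)%N.
  by move=> lm m6; apply: nth_enum_ltn; rewrite ?I6.
(* [th j] collects the signs attached to column j by S_J and by the shuffle. *)
pose th (j : 'I_d.+4) : F := (-1) ^+ (odd j (+) h j).
pose K : F := (-1) ^+ (~~ odd (d + 1) (+) s).
have K2 : K ^+ 2 = 1 by rewrite /K sqrr_sign.
have th2 j : th j ^+ 2 = 1 by rewrite sqrr_sign.
have mE a b c : (a < b)%N -> (b < c)%N -> (c < 6)%N ->
  mhat A [set i a; i b; i c] * g = N * (K * th (i a) * th (i b) * th (i c)) *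
    bracket (col (i a) B) (col (i b) B) (col (i c) B).
  move=> ab bc c6; have lab : (i a < i b)%N by apply: ilt => //; lia.
  have lbc : (i b < i c)%N by apply: ilt.
  have c3 : #|[set i a; i b; i c]| = 3%N by rewrite cardE enum_set3.
  rewrite /mhat /minor -[LHS]mulrA E // sE // -det_cols_set3 //.
  have -> : \big[addb/false]_(j in [set i a; i b; i c]) h j = h (i a) (+) h (i b) (+) h (i c).
    by rewrite -big_enum enum_set3 // !big_cons big_nil /= addbF addbA.
  have -> : (-1) ^+ (S_ [set i a; i b; i c] + d + 1) =
      (-1) ^+ (~~ odd (d + 1) (+) (odd (i a) (+) odd (i b) (+) odd (i c))) :> F.
    rewrite -addnA -signr_odd oddD S_set3 //.
    by rewrite addNb addbC addNb.
  by rewrite /K /th !signr_addb; ring.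
rewrite /psi /mhat_at /psi6_at /psi6 /= -/(i 0) -/(i 1) -/(i 2) -/(i 3) -/(i 4) -/(i 5).
rewrite mulrBl.
rewrite (_ : _ * _ * _ * _ * g ^+ 4 = (mhat A [set i 0; i 1; i 2] * g) *
  (mhat A [set i 0; i 3; i 4] * g) * (mhat A [set i 1; i 3; i 5] * g) *
  (mhat A [set i 2; i 4; i 5] * g)); last by ring.
rewrite [X in _ - X](_ : _ = (mhat A [set i 0; i 1; i 3] * g) *
  (mhat A [set i 0; i 2; i 4] * g) * (mhat A [set i 1; i 2; i 5] * g) *
  (mhat A [set i 3; i 4; i 5] * g)); last by ring.
rewrite !mE //.
set b1 := bracket _ _ _; set b2 := bracket _ _ _; set b3 := bracket _ _ _.
set b4 := bracket _ _ _; set b5 := bracket _ _ _; set b6 := bracket _ _ _.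
set b7 := bracket _ _ _; set b8 := bracket _ _ _.
transitivity (N ^+ 4 * (K ^+ 2 * K ^+ 2 * th (i 0) ^+ 2 * th (i 1) ^+ 2 *
  th (i 2) ^+ 2 * th (i 3) ^+ 2 * th (i 4) ^+ 2 * th (i 5) ^+ 2) *
  (b1 * b2 * b3 * b4 - b5 * b6 * b7 * b8)); first by ring.
by rewrite K2 !th2 !mulr1.
Qed.

(** * Six points on a conic *)

(** [bump] by structural recursion: with [laplace] it lets [cbn] expand a determinant of numeral
    size into an expression that [ring] can compare. *)
Fixpoint skip (j l : nat) : nat :=
  match j, l with
  | 0, _ => l.+1
  | _.+1, 0 => 0
  | j'.+1, l'.+1 => (skip j' l').+1
  end.

Lemma skipE j l : skip j l = bump j l.
Proof. by elim: j l => [|j IH] [|l] //=; rewrite IH bumpS. Qed.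

Fixpoint laplace (R : comNzRingType) (n : nat) (f : nat -> nat -> R) : R :=
  if n isn't n'.+1 then 1 else
  foldr (fun j acc =>
    (if odd j then - f 0%N j else f 0%N j) *
      laplace n' (fun i l => f i.+1 (skip j l)) + acc)
    0 (iota 0 n).

Lemma det_laplace (R : comNzRingType) (n : nat) (f : nat -> nat -> R) :
  \det (\matrix_(i < n, j < n) f i j) = laplace n f.
Proof.
elim: n f => [|n IH] f; first by rewrite det_mx00.
pose F (j : nat) := (if odd j then - f 0%N j else f 0%N j) *
  laplace n (fun i l => f i.+1 (skip j l)).
transitivity (\sum_(0 <= j < n.+1) F j); last first.
  by rewrite /index_iota subn0 unlock /=.
rewrite big_mkord (expand_det_row _ ord0); apply: eq_bigr => j _.
rewrite mxE /cofactor /F /= add0n -signr_odd -IH mulrA.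
congr (_ * _); first by case: (odd j); rewrite ?mulr1 // mulrN1.
congr (\det _); apply/matrixP => i l; by rewrite !mxE /= skipE.
Qed.

(* Coefficients of a ternary quadratic form in the order x^2 y^2 z^2 yz xz xy. *)
Definition monomials2 (R : comNzRingType) (v : 'cV[R]_3) (i : nat) : R :=
  nth 0 [:: v 0 0 ^+ 2; v 1 0 ^+ 2; v ord_max 0 ^+ 2; v 1 0 * v ord_max 0;
    v 0 0 * v ord_max 0; v 0 0 * v 1 0] i.

(** With the monomials in this order the determinant is [psi6] itself, sign included. *)
Lemma det_monomials2 (R : comNzRingType) (v : nat -> 'cV[R]_3) :
  \det (\matrix_(i < 6, j < 6) monomials2 (v j) i) =
  psi6 (v 0%N) (v 1%N) (v 2%N) (v 3%N) (v 4%N) (v 5%N).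
Proof.
rewrite (det_laplace 6 (fun i j => monomials2 (v j) i)) /monomials2 /psi6 /bracket.
cbn [laplace foldr iota odd negb skip nth].
ring.
Qed.

Lemma qform_sum (R : comNzRingType) (n : nat) (Q : 'M[R]_n) (v : 'cV[R]_n) :
  qform Q v = \sum_i \sum_j Q i j * (v i 0 * v j 0).
Proof.
rewrite /qform mxE exchange_big; apply: eq_bigr => j _ /=.
rewrite mxE mulr_suml; apply: eq_bigr => i _.
by rewrite mxE; ring.
Qed.

(** Triangularity excludes nonzero matrices with zero form, such as alternating ones; a nonzero
    entry is then detected by e_i or by e_i + e_j. *)
Lemma upper_triangular_qform (R : comNzRingType) (n : nat) (Q : 'M[R]_n) :
  (forall i j : 'I_n, (j < i)%N -> Q i j = 0) -> Q != 0 -> exists v, qform Q v != 0.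
Proof.
move=> Qu Qn; pose b (i : 'I_n) : 'cV[R]_n := delta_mx i 0.
have qb i j : (b i)^T *m Q *m b j = (Q i j)%:M.
  by rewrite trmx_delta -rowE -colE; apply/rowP => l; rewrite !mxE ord1 eqxx.
have qbE i : qform Q (b i) = Q i i by rewrite /qform qb mxE.
case: (pickP (fun i => Q i i != 0)) => [i Qi|Qd].
  by exists (b i); rewrite qbE.
case: (pickP (fun ij => Q ij.1 ij.2 != 0)) => [[i j] /= Qij|Q0]; last first.
  by case/eqP: Qn; apply/matrixP => i j; rewrite mxE; have /eqP := Q0 (i, j).
have ij : (i < j)%N.
  rewrite ltnNge leq_eqVlt; apply: contra Qij => /orP[/eqP/val_inj->|/Qu->//].
  exact: negbFE (Qd _).
exists (b i + b j); rewrite qformD !qbE (eqP (negbFE (Qd i))) (eqP (negbFE (Qd j))).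
rewrite !add0r /polar mulmxDr mulmxDl mxE qb -[Q^T]trmxK.
rewrite (_ : (b i)^T *m (Q^T)^T^T *m b j = ((b j)^T *m Q *m b i)^T); last first.
  by rewrite !trmx_mul !trmxK mulmxA.
by rewrite qb !mxE eqxx !mulr1n (Qu j i ij) addr0.
Qed.

(** If the quadratic monomials of the columns had rank 6, some six columns would have a nonzero
    determinant; so one linear relation, that is one conic, serves all columns. *)
Lemma conic_through (F : fieldType) (n : nat) (B : 'M[F]_(3, n.+1)) :
  (forall I : {set 'I_n.+1}, #|I| = 6%N -> psi6_at B I = 0) ->
  exists2 Q : 'M[F]_3, (exists v, qform Q v != 0) &
    forall j, qform Q (col j B) = 0.
Proof.
move=> psi0; pose V : 'M[F]_(6, n.+1) := \matrix_(i, j) monomials2 (col j B) i.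
have [u u0 uV] : exists2 u : 'rV_6, u != 0 & u *m V = 0.
  suff : kermx V != 0.
    by case/rowV0Pn => u /sub_kermxP uV u0; exists u.
  apply/eqP => /eqP; rewrite kermx_eq0 /row_free -mxrank_tr => Vf.
  (* [f] lists six independent columns in no particular order; they are matched below with the
     increasing list [enum I]. *)
  pose f := fullrankfun Vf; pose I := f @: [set: 'I_6].
  have fi : injective f := @fullrankfun_inj _ _ _ _ Vf.
  have I6 : #|I| = 6%N by rewrite card_imset // cardsT card_ord.
  pose M : 'M[F]_6 := \matrix_(i < 6, l < 6) monomials2 (col (nth ord0 (enum I) l) B) i.
  have /det0P[u u0 uM] : \det M == 0.
    by rewrite /M (det_monomials2 (fun l => col (nth ord0 (enum I) l) B)) -(psi0 I I6).
  case/negP: u0; apply/eqP.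
  have : u *m (rowsub f V^T)^T = 0.
    apply/rowP => l; have : f l \in enum I by rewrite mem_enum imset_f ?inE.
    move=> /(nthP ord0)[m]; rewrite -cardE I6 => m6 E.
    have := congr1 (fun w : 'rV_6 => w 0 (Ordinal m6)) uM; rewrite !mxE => uM0.
    rewrite -[RHS]uM0; apply: eq_bigr => i _; rewrite !mxE /= E.
    by [].
  have fu : (rowsub f V^T)^T \in unitmx by rewrite unitmx_tr fullrowsub_unit.
  by move=> /(congr1 (mulmx^~ (invmx (rowsub f V^T)^T))); rewrite mulmxK // mul0mx.
pose c (i : nat) := u 0 (inord i).
pose Q : 'M[F]_3 := \matrix_(i, j) nth 0 (nth [::]
  [:: [:: c 0%N; c 5; c 4]; [:: 0; c 1%N; c 3]; [:: 0; 0; c 2]] i) j.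
have QE v : qform Q v = \sum_(i < 6) c i * monomials2 v i.
  rewrite qform_sum !big_ord_recl !big_ord0 !mxE /= /monomials2 /bump /=.
  have -> : lift ord0 ord0 = 1 :> 'I_3 by apply/val_inj.
  have -> : lift ord0 (lift ord0 ord0) = ord_max :> 'I_3 by apply/val_inj.
  by ring.
exists Q => [|j].
  apply: upper_triangular_qform.
    by move=> [[|[|[|//]]] i3] [[|[|[|//]]] j3] //= _; rewrite mxE.
  apply: contraNneq u0 => Q0; apply/eqP/rowP => i; rewrite mxE.
  have cz (i3 j3 : nat) (hi : (i3 < 3)%N) (hj : (j3 < 3)%N) : nth 0 (nth [::]
     [:: [:: c 0%N; c 5; c 4]; [:: 0; c 1%N; c 3]; [:: 0; 0; c 2]] i3) j3 = 0.
    by have := congr1 (fun X : 'M_3 => X (Ordinal hi) (Ordinal hj)) Q0; rewrite !mxE.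
  suff : c i = 0 by rewrite /c inord_val.
  case: i => [[|[|[|[|[|[|//]]]]]] i6] /=.
  - exact: (cz 0%N 0%N).
  - exact: (cz 1%N 1%N).
  - exact: (cz 2%N 2%N).
  - exact: (cz 1%N 2%N).
  - exact: (cz 0%N 2%N).
  exact: (cz 0%N 1%N).
rewrite QE; have := congr1 (fun w : 'rV_n.+1 => w 0 j) uV; rewrite !mxE => E.
by rewrite -[RHS]E; apply: eq_bigr => i _; rewrite !mxE /c inord_val.
Qed.

Lemma kernel_rows (F : fieldType) (m n r : nat) (A : 'M[F]_(m, n)) :
  (r + \rank A <= n)%N -> exists2 B : 'M[F]_(r, n), row_free B & A *m B^T = 0.
Proof.
move=> rn; pose K := kermx A^T.
have rK : (r <= \rank K)%N by rewrite mxrank_ker mxrank_tr; lia.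
exists ((pid_mx r : 'M_(r, \rank K)) *m row_base K).
  by rewrite /row_free mxrankMfree ?row_base_free // rank_pid_mx // ?minnn.
have /sub_kermxP E : (row_base K <= K)%MS by rewrite eq_row_base.
apply: trmx_inj; rewrite trmx_mul trmxK -mulmxA trmx0.
by rewrite E mulmx0.
Qed.

Lemma complete_basis (F : fieldType) (n : nat) (u : 'cV[F]_n.+1) :
  u != 0 -> exists2 g : 'M[F]_n.+1, g \in unitmx & col 0 g = u.
Proof.
move=> u0; have r1 : \rank u = 1%N.
  apply/eqP; rewrite eqn_leq (leq_trans (rank_leq_col _)) //.
  by rewrite lt0n mxrank_eq0.
pose c := row_ebase u 0 0.
have c0 : c != 0.
  have := row_ebase_unit u; rewrite unitmxE unitfE.
  by rewrite [row_ebase u]mx11_scalar det_scalar expr1.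
exists (c *: col_ebase u).
  by rewrite unitmxZ ?col_ebase_unit // unitfE.
rewrite -[RHS](mulmx_ebase u) r1 [row_ebase u]mx11_scalar -/c mul_mx_scalar.
apply/colP => i; rewrite !mxE (bigD1 ord0) //= big1 => [|j j0].
  by rewrite !mxE eqxx /= mulr1 addr0.
rewrite !mxE; case: (nat_of_ord j =P 0%N :> nat) => [/(@val_inj _ _ _ j ord0) E|_]; last by rewrite mulr0.
by rewrite E eqxx in j0.
Qed.

(** H is the projection from the point u, K a section of it, and f the coordinate along u. *)
Lemma split_vector (F : fieldType) (n : nat) (u : 'cV[F]_n.+1) :
  u != 0 -> exists (f : 'rV[F]_n.+1) (H : 'M[F]_(n, n.+1)) (K : 'M[F]_(n.+1, n)),
    [/\ f *m u = 1%:M, f *m K = 0, H *m u = 0, H *m K = 1%:M &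
        u *m f + K *m H = 1%:M].
Proof.
move=> u0; have [g gu g0] := complete_basis u0.
pose K : 'M[F]_(n.+1, n) := rsubmx (g : 'M_(n.+1, 1 + n)).
pose f : 'rV[F]_n.+1 := usubmx (invmx g : 'M_(1 + n, n.+1)).
pose H : 'M[F]_(n, n.+1) := dsubmx (invmx g : 'M_(1 + n, n.+1)).
have uE : lsubmx (g : 'M_(n.+1, 1 + n)) = u.
  by rewrite -g0; apply/colP => l; rewrite !mxE; congr (g _ _); apply/val_inj.
have gE : g = row_mx u K by rewrite -uE (@hsubmxK _ n.+1 1 n).
have giE : invmx g = col_mx f H by rewrite (@vsubmxK _ 1 n n.+1).
exists f, H, K; have := mulmxV gu; have := mulVmx gu.
rewrite giE gE (@mul_col_row _ 1 n n.+1 1 n) (scalar_mx_block 1 n).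
move=> /(@eq_block_mx _ 1 n 1 n)[fu fK Hu HK].
by rewrite (@mul_row_col _ n.+1 1 n n.+1) => ->.
Qed.

(** * A cone in the pencil of quadrics through eight points *)

Section ConeInPencil.
Variable k : closedFieldType.

(** A radical vector u with q(u) nonzero forces characteristic 2. There the polar form is
    alternating on a space of even dimension, so the radical contains a second vector, and q has a
    zero on the plane of the two. *)
Lemma degenerate_polar_vertex (Q : 'M[k]_4) (u : 'cV[k]_4) :
  u != 0 -> (forall v, polar Q u v = 0) ->
  exists w, [/\ w != 0, qform Q w = 0 & forall v, polar Q w v = 0].
Proof.
move=> u0 Pu; have [qu|qu] := eqVneq (qform Q u) 0; first by exists u.
have two0 : 2%:R = 0 :> k.
  by apply: (mulIf qu); rewrite mul0r mulr_natl -polar_diag Pu.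
have alt v : polar Q v v = 0 by rewrite polar_diag -mulr_natl two0 mul0r.
have [g gu g0] := complete_basis u0.
pose e (i : 'I_3) := col (lift 0 i) g.
pose E1 := e 0; pose E2 := e 1; pose E3 := e ord_max.
have i1 : lift ord0 ord0 = 1 :> 'I_3 by apply/val_inj.
have i2 : lift ord0 (lift ord0 ord0) = ord_max :> 'I_3 by apply/val_inj.
have gE (c : 'cV_4) : g *m c = c 0 0 *: u + c (lift 0 0) 0 *: E1 +
    c (lift 0 1) 0 *: E2 + c (lift 0 ord_max) 0 *: E3.
  rewrite -g0; apply/colP => i; rewrite !mxE !big_ord_recl big_ord0 addr0 !addrA i1 i2.
  by rewrite ![g i _ * _]mulrC.
have spn v : exists x y z t, v = x *: u + y *: E1 + z *: E2 + t *: E3.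
  pose c := invmx g *m v; exists (c 0 0), (c (lift 0 0) 0), (c (lift 0 1) 0), (c (lift 0 ord_max) 0).
  by rewrite -gE mulKVmx.
have free x y z t : x *: u + y *: E1 + z *: E2 + t *: E3 = 0 -> [/\ x = 0, y = 0, z = 0 & t = 0].
  move=> E; pose c : 'cV[k]_4 := \col_i nth 0 [:: x; y; z; t] i.
  have : g *m c = 0 by rewrite gE -E !mxE.
  move=> /(congr1 (mulmx (invmx g))); rewrite mulKmx // mulmx0 => /colP c0.
  have := c0 0; have := c0 (lift 0 0); have := c0 (lift 0 1); have := c0 (lift 0 ord_max).
  by rewrite !mxE.
(* In characteristic 2 the polar form is alternating, and an alternating form
   on a 3-dimensional complement of u is degenerate. *)
have [w [wn Pw]] : exists w, (forall x y, x *: u + y *: w = 0 -> x = 0 /\ y = 0) /\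
    forall v, polar Q w v = 0.
  pose b12 := polar Q E1 E2; pose b13 := polar Q E1 E3; pose b23 := polar Q E2 E3.
  have tw (x : k) : x + x = 0 by rewrite -mulr2n -mulr_natl two0 mul0r.
  have mono y z t : polar Q (y *: E1 + z *: E2 + t *: E3) u = 0.
    by rewrite polarC Pu.
  have [/andP[/andP[/eqP z12 /eqP z13] /eqP z23]|nz] :=
      boolP ((b12 == 0) && (b13 == 0) && (b23 == 0)).
    exists E1; split=> [x y E|v].
      have := free x y 0 0; rewrite !scale0r !addr0 => /(_ E)[-> -> _ _].
      by [].
    have [x [y [z [t ->]]]] := spn v.
    by rewrite !polarDr !polarZr alt [polar Q E1 u]polarC Pu -/b12 -/b13 z12 z13; ring.
  (* The kernel vector of an alternating 3 by 3 matrix, whose signs disappear in characteristic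
     2. *)
  exists (b23 *: E1 + b13 *: E2 + b12 *: E3); split=> [x y E|v].
    have := free x (y * b23) (y * b13) (y * b12); case.
      by rewrite -E !scalerDr !scalerA !addrA.
    move=> -> /eqP + /eqP + /eqP; rewrite !mulf_eq0.
    by have [->//|] := eqVneq y 0; move: nz => /= + _; case: (b12 == 0) => //=;
      case: (b13 == 0) => //=; case: (b23 == 0).
  have [x [y [z [t ->]]]] := spn v.
  rewrite !polarDr !polarZr mono !polarDl !polarZl !alt.
  rewrite [polar Q E3 E1]polarC [polar Q E3 E2]polarC [polar Q E2 E1]polarC.
  rewrite -/b12 -/b13 -/b23.
  rewrite !mulr0 !add0r !addr0 [b12 * b13]mulrC [b12 * b23]mulrC [b13 * b23]mulrC.
  by rewrite !tw !mulr0 !addr0.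
have [x [y /andP[xy /eqP E]]] := binary_quadratic_root (qform Q u) 0 (qform Q w).
exists (x *: u + y *: w); split=> [||v].
- by apply: contraNneq xy => /wn[-> ->].
- by rewrite qformD !qformZ polarZl polarZr Pu -[RHS]E; ring.
by rewrite polarDl !polarZl Pu Pw !mulr0 addr0.
Qed.

Lemma pencil_degenerate (n : nat) (P0 P1 : 'M[k]_n.+1) :
  exists s t (v : 'rV_n.+1), [/\ (s, t) != (0, 0), v != 0 & v *m (s *: P0 + t *: P1) = 0].
Proof.
have [P0u|] := boolP (P0 \in unitmx); last first.
  rewrite unitmxE unitfE negbK => /det0P[v v0 vP]; exists 1, 0, v; split=> //.
    by rewrite xpair_eqE oner_eq0.
  by rewrite scale1r scale0r addr0.
have /closed_rootP[a] : size (char_poly (- P1 *m invmx P0)) != 1%N.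
  by rewrite size_char_poly.
rewrite -eigenvalue_root_char => /eigenvalueP[v vP v0].
exists a, 1, v; split=> //; first by rewrite xpair_eqE oner_eq0 andbF.
have := congr1 (mulmx^~ P0) vP; rewrite mulmxA mulmxKV // -scalemxAl scale1r.
by rewrite mulmxDr -scalemxAr => <-; rewrite mulmxN addNr.
Qed.

(* Position of the coefficient (i, j), i <= j, among the 10 of a quaternary form. *)
Definition quaternary_index (i j : nat) : nat :=
  nth 0%N (nth [::] [:: [:: 0; 1; 2; 3]; [:: 0; 4; 5; 6]; [:: 0; 0; 7; 8]; [:: 0; 0; 0; 9]]%N i) j.

Definition quaternary (r : 'rV[k]_10) : 'M[k]_4 :=
  \matrix_(i, j) if (i <= j)%N then r 0 (inord (quaternary_index i j)) else 0.

Lemma quaternaryD r r' : quaternary (r + r') = quaternary r + quaternary r'.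
Proof. by apply/matrixP => i j; rewrite !mxE; case: leqP; rewrite ?addr0. Qed.

Lemma quaternaryZ a r : quaternary (a *: r) = a *: quaternary r.
Proof. by apply/matrixP => i j; rewrite !mxE; case: leqP; rewrite ?mulr0. Qed.

Lemma quaternary_neq0 r : r != 0 -> exists v, qform (quaternary r) v != 0.
Proof.
move=> r0; apply: upper_triangular_qform => [i j ij|]; first by rewrite mxE leqNgt ij.
apply: contraNneq r0 => Q0; apply/eqP/rowP => l; rewrite mxE.
have cz (i j : nat) (hi : (i < 4)%N) (hj : (j < 4)%N) : (i <= j)%N ->
    r 0 (inord (quaternary_index i j)) = 0.
  move=> ij; have := congr1 (fun X : 'M_4 => X (Ordinal hi) (Ordinal hj)) Q0.
  by rewrite !mxE /= ij.
suff : r 0 (inord l) = 0 by rewrite inord_val.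
case: l => [[|[|[|[|[|[|[|[|[|[|//]]]]]]]]]] l10] /=.
- exact: (cz 0%N 0%N).
- exact: (cz 0%N 1%N).
- exact: (cz 0%N 2%N).
- exact: (cz 0%N 3%N).
- exact: (cz 1%N 1%N).
- exact: (cz 1%N 2%N).
- exact: (cz 1%N 3%N).
- exact: (cz 2%N 2%N).
- exact: (cz 2%N 3%N).
exact: (cz 3%N 3%N).
Qed.

Lemma cone_through (n : nat) (B : 'M[k]_(4, n)) :
  (n <= 8)%N -> exists (Q : 'M[k]_4) (u : 'cV[k]_4),
    [/\ u != 0, exists v, qform Q v != 0, forall j, qform Q (col j B) = 0 &
        forall v c, qform Q (v + c *: u) = qform Q v].
Proof.
move=> n8.
pose X : 'M[k]_(n, 10) := \matrix_(j, l) qform (quaternary (delta_mx 0 l)) (col j B).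
(* Ten coefficients and at most eight conditions leave two independent forms. *)
have [R Rf XR] : exists2 R : 'M[k]_(2, 10), row_free R & X *m R^T = 0.
  by apply: kernel_rows; have := rank_leq_row X; lia.
have qB l j : qform (quaternary (row l R)) (col j B) = 0.
  have := congr1 (fun M : 'M_(n, 2) => M j l) XR; rewrite !mxE => E; rewrite -[RHS]E.
  have -> : row l R = \sum_m R l m *: delta_mx 0 m.
    by rewrite [LHS]row_sum_delta; apply: eq_bigr => m _; rewrite mxE.
  have qs (Q Q' : 'M[k]_4) v : qform (Q + Q') v = qform Q v + qform Q' v.
    by rewrite /qform mulmxDr mulmxDl mxE.
  have qz a (Q : 'M[k]_4) v : qform (a *: Q) v = a * qform Q v.
    by rewrite /qform -scalemxAr -scalemxAl mxE.
  elim/big_rec2: _ => [|m x y _ IH].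
    rewrite (_ : quaternary 0 = 0) ?/qform ?mulmx0 ?mul0mx ?mxE //.
    by apply/matrixP => i i'; rewrite !mxE; case: leqP.
  by rewrite quaternaryD qs IH quaternaryZ qz !mxE mulrC.
pose Q0 := quaternary (row 0 R); pose Q1 := quaternary (row 1 R).
have [s [t [v [st v0 vP]]]] := pencil_degenerate (Q0 + Q0^T) (Q1 + Q1^T).
pose r := s *: row 0 R + t *: row 1 R.
have QE : quaternary r = s *: Q0 + t *: Q1 by rewrite quaternaryD !quaternaryZ.
have r0 : r != 0.
  apply: contraNneq st => r0.
  have RE : R = col_mx (row 0 R) (row 1 R) :> 'M_(1 + 1, 10).
    rewrite -[LHS](@vsubmxK _ 1 1); congr col_mx; apply/rowP => i; rewrite !mxE.
      by congr (R _ _); apply/val_inj.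
    by congr (R _ _); apply/val_inj.
  have /eq_row_mx[/(congr1 (fun M : 'M_1 => M 0 0)) + /(congr1 (fun M : 'M_1 => M 0 0))] :
      row_mx s%:M t%:M = row_mx 0 0 :> 'rV_(1 + 1).
    rewrite row_mx0; apply: (row_free_inj Rf).
    transitivity r; last by rewrite r0 mul0mx.
    rewrite [X in _ *m X]RE (@mul_row_col _ 1 1 1 10).
    by rewrite !mul_scalar_mx.
  by rewrite !mxE eqxx !mulr1n => -> ->.
have u0 : v^T != 0 by rewrite -trmx0 (inj_eq trmx_inj).
have [w [w0 qw Pw]] : exists w, [/\ w != 0, qform (quaternary r) w = 0 &
    forall v, polar (quaternary r) w v = 0].
  apply: (degenerate_polar_vertex u0) => v'.
  have PE : quaternary r + (quaternary r)^T = s *: (Q0 + Q0^T) + t *: (Q1 + Q1^T).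
    rewrite QE; clear; move: Q0 Q1 => M0 M1.
    by apply/matrixP => i j; rewrite !mxE; ring.
  by rewrite /polar trmxK PE vP mul0mx mxE.
exists (quaternary r), w; split=> //; first exact: quaternary_neq0.
  move=> j; rewrite QE /qform mulmxDr mulmxDl -!scalemxAr -!scalemxAl.
  rewrite -[LHS](_ : s * qform Q0 (col j B) + t * qform Q1 (col j B) = _).
    by rewrite !qB !mulr0 addr0.
  have zE a (M : 'M[k]_1) : (a *: M) 0 0 = a * M 0 0 by rewrite mxE.
  by rewrite [RHS]mxE !zE.
by move=> v' c; rewrite qformD qformZ qw polarC polarZl Pw !mulr0 !addr0.
Qed.

End ConeInPencil.

(** * Configurations of d + 4 points *)

Lemma conic_dual_class (k : closedFieldType) (d : nat)
    (Z : 'M[k]_(d.+1, d.+4) -> Prop) (Q : 'M[k]_3) (A : 'M[k]_(d.+1, d.+4))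
    (B : 'M[k]_(3, d.+4)) :
  curve_closed Z -> contains_good Z ->
  (exists v, qform Q v != 0) -> (forall j, qform Q (col j B) = 0) ->
  row_free B -> A *m B^T = 0 -> Z A.
Proof.
move=> Zc Zg Qn QB Bf AB; have nE : d.+4 = (d + 2).+2 by rewrite addn2.
have Dc : curve_closed (dual_class (e := 2) Z) by apply: dual_class_closed.
have Dm := curve_closed_moment Dc (dual_class_good nE Zc Zg).
exact: (conic_class Dc Dm Qn QB).
Qed.

Lemma curve_class_full (k : closedFieldType) (d : nat)
    (Z : 'M[k]_(d.+1, d.+4) -> Prop) (A : 'M[k]_(d.+1, d.+4)) :
  curve_closed Z -> contains_good Z -> row_free A ->
  (forall I : {set 'I_d.+4}, #|I| = 6%N -> psi A I = 0) -> Z A.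
Proof.
move=> Zc Zg Af psiA.
have [B Bf AB] : exists2 B : 'M_(3, d.+4), row_free B & A *m B^T = 0.
  by apply: kernel_rows; rewrite (eqP Af); lia.
have [N [g [N0 _ E]]] := psi_gale Af AB.
have [I I6|Q Qn QB] := @conic_through _ _ B.
  by apply: (mulfI N0); rewrite -E // psiA // mul0r mulr0.
exact: (conic_dual_class Zc Zg Qn QB).
Qed.

Lemma curve_class_degenerate (k : closedFieldType) (d : nat)
    (Z : 'M[k]_(d.+1, d.+4) -> Prop) (A : 'M[k]_(d.+1, d.+4)) :
  curve_closed Z -> contains_good Z -> (d <= 4)%N -> ~~ row_free A -> Z A.
Proof.
move=> Zc Zg d4 Af.
have [B Bf AB] : exists2 B : 'M_(4, d.+4), row_free B & A *m B^T = 0.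
  apply: kernel_rows; have := rank_leq_row A; rewrite leq_eqVlt.
  by rewrite /row_free in Af; rewrite (negPf Af) /=; lia.
have [Q [u [u0 [v qv] qB Qu]]] := cone_through B (d4 : (d.+4 <= 8)%N).
have [f [H [G [_ _ Hu HG fH]]]] := split_vector u0.
have decomp (w : 'cV[k]_4) : exists c, w = G *m (H *m w) + c *: u.
  exists ((f *m w) 0 0); rewrite -{1}[w]mul1mx -fH mulmxDl -!mulmxA addrC.
  by rewrite {1}[f *m w]mx11_scalar mul_mx_scalar.
have QG w : qform Q w = qform (G^T *m Q *m G) (H *m w).
  by have [c {1}->] := decomp w; rewrite Qu qformM.
(* H has a right inverse, so [H *m B] still has independent rows; Q descends along H because it is
   constant in the direction u. *)
apply: (conic_dual_class Zc Zg (Q := G^T *m Q *m G) (B := H *m B)).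
- by exists (H *m v); rewrite -QG.
- move=> j; have -> : col j (H *m B) = H *m col j B by rewrite !colE mulmxA.
  by rewrite -QG.
- rewrite /row_free mxrankMfree //; by apply/row_freeP; exists G.
by rewrite trmx_mul mulmxA AB mul0mx.
Qed.

(** * From coordinate matrices to configurations *)

Definition meval_curve (k : fieldType) (r n : nat) (f : {mpoly k[r * n]})
    (B : 'M[{poly k}]_(r, n)) : {poly k} :=
  mmap polyC (fun v => mxvec B ord0 v) f.

Lemma horner_meval_curve (k : fieldType) (r n : nat) (f : {mpoly k[r * n]})
    (B : 'M[{poly k}]_(r, n)) x :
  (meval_curve f B).[x] = f.@[fun v => mxvec (at_pt x B) ord0 v].
Proof.
rewrite /meval_curve /mmap horner_sum mevalE; apply: eq_bigr => m _.
rewrite hornerM hornerC /mmap1 horner_prod; congr (_ * _).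
apply: eq_bigr => i _; rewrite horner_exp /at_pt; congr (_ ^+ _).
by case/mxvec_indexP: i => i j; rewrite !mxvecE mxE.
Qed.

Definition vanishes_on (k : fieldType) (d n : nat) (f : mhpoly k d n)
    (A : 'M[k]_(d.+1, n)) : Prop := f.@[fun v => mxvec A ord0 v] = 0.

Lemma poly_vanish (k : closedFieldType) (p : {poly k}) :
  (forall x, p.[x] = 0) -> p = 0.
Proof.
move=> p0; apply/eqP/negPn/negP => /closed_nonrootP[x].
by rewrite rootE p0 eqxx.
Qed.

Lemma vanishes_on_closed (k : closedFieldType) (d n : nat) (f : mhpoly k d n) :
  curve_closed (vanishes_on f).
Proof.
move=> B q q0 Bq; rewrite /vanishes_on -horner_meval_curve.
suff -> : meval_curve f B = 0 by rewrite horner0.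
apply: (mulIf q0); rewrite mul0r; apply: poly_vanish => x.
rewrite hornerM; have [->|qx] := eqVneq q.[x] 0; first by rewrite mulr0.
by rewrite horner_meval_curve (Bq x qx) mul0r.
Qed.

Lemma vline_scale (F : fieldType) (V : vectType F) (c : F) (v : V) :
  c != 0 -> <[c *: v]>%VS = <[v]>%VS.
Proof.
move=> c0; apply/eqP; rewrite eqEsubv -!memvE memvZ ?memv_line //=.
by rewrite -[v in v \in _](scalerK c0) memvZ ?memv_line.
Qed.

(** Before M is applied the first two coordinates are 1 and a_j, up to the weight; they exist
    because 0 < d, and they separate the points. *)
Lemma moment_U (k : closedFieldType) (d n : nat) (M : 'M[k]_d.+1)
    (c a : 'I_n -> k) :
  (0 < d)%N -> M \in unitmx -> (forall j, c j != 0) -> injective a ->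
  exists2 q : conf k d n, U_locus q & hcoords q (M *m moment d c (fun=> 1) a).
Proof.
move=> d0 Mu c0 ai; pose A := M *m moment d c (fun=> 1) a.
pose w j : 'cV[k]_2 := \col_i (if i == 0 then 1 else a j).
have colA j : col j A = c j *: (M *m veronese d (w j)).
  rewrite scalemxAr /A colE -mulmxA -colE; congr (M *m _).
  by apply/colP => i; rewrite !mxE expr1n mulrA.
have Mv (v : 'cV[k]_d.+1) : M *m v = 0 -> v = 0.
  by move=> /(congr1 (mulmx (invmx M))); rewrite mulKmx // mulmx0.
have ver0 j : veronese d (w j) ord0 0 = 1 by rewrite !mxE /= expr1n mul1r.
have d1 : (1 < d.+1)%N by [].
have ver1 j : veronese d (w j) (Ordinal d1) 0 = a j by rewrite !mxE /= expr1n mul1r.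
have vn j : M *m veronese d (w j) != 0.
  apply/eqP => /Mv /(congr1 (fun v : 'cV_ _ => v ord0 0)).
  by rewrite ver0 mxE => /eqP; rewrite oner_eq0.
have colA0 j : \dim <[col j A]>%VS == 1%N.
  by rewrite dim_vline colA scaler_eq0 negb_or c0 vn.
pose q : conf k d n := fun j =>
  exist (fun L : {vspace _} => \dim L == 1%N) _ (colA0 j).
exists q; last by move=> j.
split.
  move=> i j /(congr1 val) /=; rewrite !colA !vline_scale // => E.
  have : M *m veronese d (w i) \in <[M *m veronese d (w j)]>%VS.
    by rewrite -E memv_line.
  case/vlineP => l; rewrite scalemxAr => /eqP; rewrite -subr_eq0 -mulmxBr.
  move=> /eqP/Mv E'.
  have l1 : l = 1.
    have := congr1 (fun v : 'cV_ _ => v ord0 0) E'; rewrite mxE ver0 mxE mxE ver0 mxE.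
    by rewrite mulr1 => /eqP; rewrite subr_eq0 => /eqP.
  apply: ai; have := congr1 (fun v : 'cV_ _ => v (Ordinal d1) 0) E'.
  rewrite mxE ver1 mxE mxE ver1 mxE l1 mul1r => /eqP.
  by rewrite subr_eq0 => /eqP.
exists (fun x => exists2 v : 'cV[k]_2, v != 0 & val x = <[M *m veronese d v]>%VS).
  by exists M.
move=> j /=; exists (w j); last by rewrite colA vline_scale.
by apply/eqP => /(congr1 (fun v : 'cV_2 => v 0 0)); rewrite !mxE => /eqP; rewrite oner_eq0.
Qed.

Lemma vanishes_on_good (k : closedFieldType) (d n : nat) (f : mhpoly k d n) :
  (0 < d)%N -> (forall q, U_locus q -> vanishes_at f q) ->
  contains_good (vanishes_on f).
Proof.
move=> d0 fU M c a Mu c0 ai; have [q qU qA] := moment_U d0 Mu c0 ai.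
exact: fU qA.
Qed.

Section Morphism.
Variables (R S : comNzRingType) (f : {rmorphism R -> S}).

Lemma map_cols (r n m : nat) (A : 'M[R]_(r, n)) (J : {set 'I_n}) :
  map_mx f (cols m A J) = cols m (map_mx f A) J.
Proof.
apply/matrixP => i l; rewrite !mxE.
have -> : [seq map_mx f A i j | j <- enum J] = map f [seq A i j | j <- enum J].
  by rewrite -map_comp; apply: eq_map => j; rewrite /= mxE.
have [lt_l|ge_l] := ltnP l (size [seq A i j | j <- enum J]).
  by rewrite (nth_map 0).
by rewrite !nth_default ?rmorph0 // size_map.
Qed.

Lemma map_psi (d : nat) (A : 'M[R]_(d.+1, d.+4)) (I : {set 'I_d.+4}) :
  f (psi A I) = psi (map_mx f A) I.
Proof.
have mh a b c : f (mhat_at A I a b c) = mhat_at (map_mx f A) I a b c.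
  rewrite /mhat_at /mhat /minor rmorphM /= rmorphXn /= rmorphN1 -det_map_mx.
  by rewrite map_cols.
rewrite /psi -!mh; move: (mhat_at A I) => g.
by rewrite rmorphB !rmorphM.
Qed.

End Morphism.

Lemma eval_psi_poly (k : fieldType) (d n : nat) (I : {set 'I_d.+4})
    (J : {set 'I_n}) (A : 'M[k]_(d.+1, n)) :
  (psi_poly k I J).@[fun v => mxvec A ord0 v] = psi (cols d.+4 A J) I.
Proof.
rewrite /psi_poly (map_psi (meval (fun v => mxvec A ord0 v))) map_cols.
rewrite [map_mx _ _](_ : _ = A) //; apply/matrixP => i j.
by rewrite !mxE; apply: etrans (mevalXU _ _) (mxvecE _ _ _).
Qed.

(** The dual is a moment curve of degree 2 with weights w_j / c_j, and on the conic (1, a, a^2)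
    [psi6] vanishes identically. *)
Lemma psi_moment (k : fieldType) (d : nat) (M : 'M[k]_d.+1)
    (c a : 'I_d.+4 -> k) (I : {set 'I_d.+4}) :
  M \in unitmx -> (forall j, c j != 0) -> injective a -> #|I| = 6%N ->
  psi (M *m moment d c (fun=> 1) a) I = 0.
Proof.
move=> Mu c0 ai I6; have [w w0 wE] := dual_weights ai.
pose A := M *m moment d c (fun=> 1) a.
pose B := moment 2 (fun j => w j / c j) (fun=> 1) a.
have b0 j : w j / c j != 0 by rewrite mulf_neq0 ?invr_eq0.
have Af : row_free A.
  by rewrite /row_free mxrankMfree ?row_free_moment ?mxrank_unit //; lia.
have AB : A *m B^T = 0.
  rewrite -mulmxA (_ : _ *m B^T = 0) ?mulmx0 //.
  apply/matrixP => i l; rewrite !mxE.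
  have := ltn_ord i; have := ltn_ord l => lt_l lt_i.
  have := wE 'X^(i + l); rewrite size_polyXn coefXn => /(_ ltac:(lia)).
  rewrite (_ : (d.+3 == i + l)%N = false); last by apply/eqP; lia.
  move=> E; rewrite -[RHS]E; apply: eq_bigr => j _.
  by rewrite !mxE !expr1n !mulr1 hornerXn exprD; field.
have [N [g [_ g0 E]]] := psi_gale Af AB.
have /g0 {}g0 : row_free B by rewrite row_free_moment.
apply: (mulIf g0); rewrite E // mul0r.
rewrite /psi6_at /psi6 /bracket !mxE /= !expr1n; ring.
Qed.

Lemma cols_moment (R : comNzRingType) (d n m : nat) (M : 'M[R]_d.+1)
    (c a : 'I_n -> R) (J : {set 'I_n}) (x0 : 'I_n) :
  #|J| = m -> let x l := nth x0 (enum J) l in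
  cols m (M *m moment d c (fun=> 1) a) J =
  M *m moment d (fun l : 'I_m => c (x l)) (fun=> 1) (fun l : 'I_m => a (x l)).
Proof.
move=> Jm x; apply/matrixP => i l; rewrite (colsE _ x0) // !mxE.
by apply: eq_bigr => j _; rewrite !mxE.
Qed.

(** A point of the curve may have s = 0, so the vanishing on good configurations is extended by
    [curve_closed_moment]. *)
Lemma psi_poly_U (k : closedFieldType) (d n : nat) (I : {set 'I_d.+4})
    (J : {set 'I_n}) (q : conf k d n) :
  #|I| = 6%N -> #|J| = d.+4 -> U_locus q -> vanishes_at (psi_poly k I J) q.
Proof.
move=> I6 Jd [_ [C [g _ Cg] Cq]] A qA.
have good : contains_good (vanishes_on (psi_poly k I J)).
  move=> M c a Mu c0 ai; rewrite /vanishes_on eval_psi_poly.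
  have [x0 _] : {x0 : 'I_n | true}.
    case: (pickP 'I_n) => [x0 _|no]; first by exists x0.
    by exfalso; move: Jd; rewrite eq_card0 // => j; have := no j.
  rewrite (cols_moment _ _ _ x0) //; apply: psi_moment => // i j /ai/eqP.
  by rewrite nth_uniq ?enum_uniq -?cardE ?Jd // => /eqP/val_inj.
have /fin_all_exists[f fP] (j : 'I_n) : exists cv : k * 'cV[k]_2,
    col j A = cv.1 *: (g *m veronese d cv.2).
  have [v _ qv] := (Cg (q j)).1 (Cq j).
  have : col j A \in <[g *m veronese d v]>%VS by rewrite -qv qA memv_line.
  by case/vlineP => c ->; exists (c, v).
have AE : A = g *m moment d (fun j => (f j).1) (fun j => (f j).2 0 0)
    (fun j => (f j).2 1 0).
  apply/matrixP => i j; have := congr1 (fun v : 'cV_ _ => v i 0) (fP j).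
  rewrite !mxE => ->; rewrite mulr_sumr; apply: eq_bigr => l _.
  by rewrite !mxE; ring.
rewrite {}AE; exact: (curve_closed_moment (@vanishes_on_closed _ _ _ _) good).
Qed.

(** * Multihomogeneity of the equations *)

Definition mhomog (k : fieldType) (d n : nat) (deg : 'I_n -> nat)
    (f : mhpoly k d n) : Prop :=
  forall m : 'X_{1..(d.+1 * n)}, m \in msupp f ->
    forall j, (\sum_(i < d.+1) m (mxvec_index i j))%N = deg j.

Lemma mxvec_index_inj (m n : nat) (i i' : 'I_m) (j j' : 'I_n) :
  mxvec_index i j = mxvec_index i' j' -> i = i' /\ j = j'.
Proof. by move=> /cast_ord_inj/enum_rank_inj[]. Qed.

Section Multihomogeneous.
Variables (k : fieldType) (d n : nat).
Implicit Types (f g : mhpoly k d n) (a b : 'I_n -> nat).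

Lemma mhomog_ext a b f : a =1 b -> mhomog a f -> mhomog b f.
Proof. by move=> ab fa m mf j; rewrite fa // ab. Qed.

Lemma mhomog0 a : mhomog a (0 : mhpoly k d n).
Proof. by move=> m; rewrite msupp0. Qed.

Lemma mhomog1 : mhomog (fun=> 0%N) (1 : mhpoly k d n).
Proof.
move=> m; rewrite msupp1 inE => /eqP -> j.
by rewrite big1 // => i _; rewrite mnm0E.
Qed.

Lemma mhomogD a f g : mhomog a f -> mhomog a g -> mhomog a (f + g).
Proof.
by move=> fa ga m /msuppD_le; rewrite mem_cat => /orP[/fa|/ga].
Qed.

Lemma mhomogN a f : mhomog a f -> mhomog a (- f).
Proof. by move=> fa m; rewrite (perm_mem (msuppN f)) => /fa. Qed.

Lemma mhomogM a b f g :
  mhomog a f -> mhomog b g -> mhomog (fun j => a j + b j)%N (f * g).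
Proof.
move=> fa gb m /msuppM_le/allpairsP[[m1 m2] [/= m1f m2g ->]] j.
rewrite -(fa m1 m1f) -(gb m2 m2g) -big_split /=.
by apply: eq_bigr => i _; rewrite mnmDE.
Qed.

Lemma mhomog_sign a f (s : nat) : mhomog a f -> mhomog a ((-1) ^+ s * f).
Proof.
by move=> fa; rewrite -signr_odd mulr_sign; case: odd => //; apply: mhomogN.
Qed.

Lemma mhomog_prod (I : finType) (a : I -> 'I_n -> nat) (F : I -> mhpoly k d n) :
  (forall i, mhomog (a i) (F i)) ->
  mhomog (fun j => \sum_i a i j)%N (\prod_i F i).
Proof.
move=> Fa; have : mhomog (fun j => \sum_(i <- index_enum I) a i j)%N
    (\prod_(i <- index_enum I) F i); last by [].
elim: (index_enum I) => [|i r IH].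
  by rewrite big_nil; apply: mhomog_ext mhomog1 => j; rewrite big_nil.
rewrite big_cons; apply: mhomog_ext (mhomogM (Fa i) IH) => j.
by rewrite big_cons.
Qed.

Lemma mhomogX i j :
  mhomog (fun j' => (j == j') : nat) ('X_(mxvec_index i j) : mhpoly k d n).
Proof.
move=> m; rewrite msuppX inE => /eqP -> j'.
rewrite (bigD1 i) //= big1 => [|i' i'i].
  rewrite addn0 mnm1E; congr nat_of_bool; apply/eqP/eqP => [|->//].
  by case/mxvec_index_inj.
rewrite mnm1E; case: eqP => // /mxvec_index_inj[E _].
by rewrite E eqxx in i'i.
Qed.

Lemma mhomog_det (x : 'I_d.+1 -> 'I_n) (A : 'M[mhpoly k d n]_d.+1) :
  (forall i l, A i l = 'X_(mxvec_index i (x l))) ->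
  mhomog (fun j => \sum_l (x l == j))%N (\det A).
Proof.
move=> AE; rewrite /determinant.
elim/big_rec: _ => [|s f _ IH]; first exact: mhomog0.
apply: mhomogD IH; apply: mhomog_sign.
apply: (mhomog_ext (a := fun j => \sum_i (x (s i) == j))%N) => [j|].
  by rewrite [RHS](reindex_inj (@perm_inj _ s)).
by apply: mhomog_prod => i; rewrite AE; apply: mhomogX.
Qed.

(** A minor that omits three columns has degree S minus their contributions D; this is written
    additively below to avoid truncated subtraction. Either product omits each index of I twice, so
    both have the same multidegree. *)
Lemma psi_poly_multihomogeneous (I : {set 'I_d.+4}) (J : {set 'I_n}) :
  #|I| = 6%N -> #|J| = d.+4 -> multihomogeneous (psi_poly k I J).
Proof.
move=> I6 Jd; case: (pickP 'I_n) => [x0 _|no]; last first.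
  by exfalso; move: Jd; rewrite eq_card0 // => j; have := no j.
pose y l := nth x0 (enum J) l; pose i l := nth ord0 (enum I) l.
pose D (j : 'I_n) (c : 'I_d.+4) : nat := y c == j.
pose S j := (\sum_c D j c)%N.
have szI : size (enum I) = 6%N by rewrite -cardE.
have mh (a b c : nat) : uniq [:: a; b; c] -> all (fun l => (0 < l < 7)%N) [:: a; b; c] ->
    exists2 deg, mhomog deg (mhat_at (cols d.+4 (generic_coords k d n) J) I a b c) &
      forall j, (D j (i a.-1) + D j (i b.-1) + D j (i c.-1) + deg j = S j)%N.
  move=> u h; pose T := [set i a.-1; i b.-1; i c.-1].
  have uT : uniq [:: i a.-1; i b.-1; i c.-1].
    rewrite -[X in uniq X]/[seq i l | l <- [:: a.-1; b.-1; c.-1]] map_inj_in_uniq.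
      by move: u h => /=; rewrite !inE; lia.
    move=> l m lin min /eqP; rewrite nth_uniq ?szI ?enum_uniq //; first by move/eqP.
      by move: lin h; rewrite !inE /=; lia.
    by move: min h; rewrite !inE /=; lia.
  have TE : T =i [:: i a.-1; i b.-1; i c.-1] by move=> x; rewrite !inE orbA.
  have T3 : #|T| = 3%N by rewrite (eq_card TE) (card_uniqP uT).
  have Tc : #|~: T| = d.+1 by apply: (@addnI #|T|); rewrite cardsC card_ord T3.
  have ST j : S j = (D j (i a.-1) + D j (i b.-1) + D j (i c.-1) +
      \sum_(l in ~: T) D j l)%N.
    rewrite /S (bigID (mem T)) /=; congr (_ + _)%N; last first.
      by apply: eq_bigl => l; rewrite !inE.
    rewrite (eq_bigl _ _ TE) -big_uniq //= !big_cons big_nil; lia.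
  exists (fun j => \sum_(l in ~: T) D j l)%N => //; apply: mhomog_sign.
  apply: (mhomog_ext (a := fun j =>
      \sum_(l < d.+1) (y (nth ord0 (enum (~: T)) l) == j))%N) => [j|].
    by rewrite -[RHS]big_enum [RHS](big_nth ord0) -cardE Tc big_mkord.
  apply: mhomog_det => r l.
  by rewrite (colsE _ ord0) // (colsE _ x0) // mxE.
have [d1 h1 e1] := mh 1 2 3 isT isT; have [d2 h2 e2] := mh 1 4 5 isT isT.
have [d3 h3 e3] := mh 2 4 6 isT isT; have [d4 h4 e4] := mh 3 5 6 isT isT.
have [d5 h5 e5] := mh 1 2 4 isT isT; have [d6 h6 e6] := mh 1 3 5 isT isT.
have [d7 h7 e7] := mh 2 3 6 isT isT; have [d8 h8 e8] := mh 4 5 6 isT isT.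
exists (fun j => d1 j + d2 j + d3 j + d4 j)%N; apply: mhomogD.
  exact: mhomogM (mhomogM (mhomogM h1 h2) h3) h4.
apply: mhomogN; apply: mhomog_ext (mhomogM (mhomogM (mhomogM h5 h6) h7) h8) => j.
move: (e1 j) (e2 j) (e3 j) (e4 j) (e5 j) (e6 j) (e7 j) (e8 j) => /=.
move: (S j) (D j (i 0)) (D j (i 1)) (D j (i 2)) (D j (i 3)) (D j (i 4)) (D j (i 5)).
move: (d1 j) (d2 j) (d3 j) (d4 j) (d5 j) (d6 j) (d7 j) (d8 j).
by clear; lia.
Qed.

End Multihomogeneous.

(** * Eight points in a plane *)

Lemma meval_curve_mod (k : fieldType) (r n : nat) (f : {mpoly k[r * n]})
    (h : {poly k}) (B C : 'M[{poly k}]_(r, n)) :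
  (forall i j, h %| B i j - C i j) -> h %| meval_curve f B - meval_curve f C.
Proof.
move=> BC; pose eqm (p q : {poly k}) := h %| p - q.
have eqmM p q p' q' : eqm p p' -> eqm q q' -> eqm (p * q) (p' * q').
  move=> pp qq; rewrite /eqm (_ : _ - _ = (p - p') * q + p' * (q - q')); last by ring.
  by apply: dvdp_add; [apply: dvdp_mulr | apply: dvdp_mull].
have eqmD p q p' q' : eqm p p' -> eqm q q' -> eqm (p + q) (p' + q').
  by move=> pp qq; rewrite /eqm opprD addrACA; apply: dvdp_add.
have eqmr p : eqm p p by rewrite /eqm subrr dvdp0.
suff : eqm (meval_curve f B) (meval_curve f C) by [].
rewrite /meval_curve /mmap; elim/big_rec2: _ => // m p q _ pq.
apply: (eqmD) => //; apply: (eqmM) => //; rewrite /mmap1.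
elim/big_rec2: _ => // v p' q' _ pq'; apply: (eqmM) => //.
have vBC : eqm (mxvec B ord0 v) (mxvec C ord0 v).
  by case/mxvec_indexP: v => i j; rewrite !mxvecE; apply: BC.
by elim: (m v) => // e IH; rewrite !exprS; apply: (eqmM).
Qed.

(* Yn = Y + X^N G with G(0) = y: a perturbation of Y of order N with leading
   coefficient y. *)
Definition perturb (k : fieldType) (N : nat) (Y Yn : {poly k}) (y : k) : Prop :=
  exists2 G : {poly k}, Yn = Y + 'X^N * G & G.[0] = y.

Section Perturb.
Variables (k : fieldType) (N : nat).
Hypothesis N0 : (0 < N)%N.

Lemma perturbC Y y : perturb N Y (Y + 'X^N * y%:P) (y : k).
Proof. by exists y%:P; rewrite ?hornerC. Qed.

Lemma perturb0 Y : perturb N Y Y (0 : k).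
Proof. by exists 0; rewrite ?mulr0 ?addr0 ?horner0. Qed.

Lemma perturbM Y Yn y Z Zn z : perturb N Y Yn y -> perturb N Z Zn z ->
  perturb N (Y * Z) (Yn * Zn) (y * Z.[0] + Y.[0] * z : k).
Proof.
move=> [G -> Gy] [H -> Hz]; exists (G * Z + Y * H + 'X^N * (G * H)); first by ring.
by rewrite !(hornerD, hornerM, hornerXn) expr0n eqn0Ngt N0 Gy Hz mul0r addr0.
Qed.

Lemma perturb_sum (I : finType) (Y Yn : I -> {poly k}) (y : I -> k) :
  (forall i, perturb N (Y i) (Yn i) (y i)) ->
  perturb N (\sum_i Y i) (\sum_i Yn i) (\sum_i y i).
Proof.
move=> /fin_all_exists2[G YG Gy]; exists (\sum_i G i).
  by rewrite mulr_sumr -big_split; apply: eq_bigr => i _.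
by rewrite horner_sum; apply: eq_bigr.
Qed.

Lemma perturbX Y Yn y i : perturb N Y Yn y ->
  perturb N (Y ^+ i) (Yn ^+ i) (y * ('X^i)^`().[Y.[0]] : k).
Proof.
move=> Yy; elim: i => [|i IH].
  by rewrite !expr0 -polyC1 derivC horner0 mulr0; apply: perturb0.
rewrite !exprS; have := perturbM Yy IH; congr perturb.
by rewrite derivM derivX !(hornerD, hornerM, hornerXn, hornerX, hornerC, horner_exp); ring.
Qed.

End Perturb.

(* The nodal cubic t |-> (t, t^2, 1 + t^3); its tangent at t is the kernel of
   (t^4 - 2t, 1 - 2t^3, t^2).  The cubic multiples of these three quartics span
   all forms of degree 7, so the tangent map of (M, c, a) |-> M nu(a) c is
   onto for 8 distinct nonzero parameters, in every characteristic. *)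
Definition nodal (k : fieldType) : 'M[k]_(3, 4) :=
  \matrix_(i, j) nth 0 (nth [::] [:: [:: 0; 1; 0; 0]; [:: 0; 0; 1; 0]; [:: 1; 0; 0; 1]] i) j.

Lemma nodal_tangent_onto (k : fieldType) (a : 'I_8 -> k) (E : 'M[k]_(3, 8)) :
  injective a -> (forall j, a j != 0) ->
  exists (M : 'M[k]_(3, 4)) (c b : 'I_8 -> k), forall r j,
    E r j = \sum_(i < 4) (M r i * a j ^+ i +
      nodal k r i * (c j * a j ^+ i + b j * ('X^i)^`().[a j])).
Proof.
move=> ai a0.
(* Pairing with the tangent covector at a_j removes the contributions of c and b and leaves one
   scalar condition on M for each parameter. *)
pose y j := (a j ^+ 4 - 2%:R * a j) * E 0 j + (1 - 2%:R * a j ^+ 3) * E 1 j +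
  a j ^+ 2 * E ord_max j.
have [p sp py] := interpolation y ai.
(* The coefficients of p are placed so that M nu(t), paired with the covector at t, gives p(t); the
   multiples of 2 in the last row cancel the unwanted terms of degrees 3 and 4. *)
pose M : 'M[k]_(3, 4) := \matrix_(i, j) nth 0 (nth [::]
  [:: [:: 0; 0; p`_6; p`_7]; [:: p`_0; p`_1; 0; 0];
      [:: p`_2; p`_3 + 2%:R * p`_6 + 2%:R * p`_0; p`_4 + 2%:R * p`_7 + 2%:R * p`_1; p`_5]] i) j.
pose w r j := E r j - \sum_(i < 4) M r i * a j ^+ i.
(* These c and b solve the first two coordinates; the third follows from the pairing, since a_j is
   nonzero. *)
exists M, (fun j => (2%:R * a j * w 0 j - w 1 j) / a j ^+ 2),
  (fun j => (w 1 j - a j * w 0 j) / a j).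
have w0 j : w 0 j = E 0 j - (p`_6 * a j ^+ 2 + p`_7 * a j ^+ 3).
  by rewrite /w !big_ord_recl big_ord0 !mxE /= /bump /=; ring.
have w1 j : w 1 j = E 1 j - (p`_0 + p`_1 * a j).
  by rewrite /w !big_ord_recl big_ord0 !mxE /= /bump /=; ring.
have w2 j : w ord_max j = E ord_max j - (p`_2 + (p`_3 + 2%:R * p`_6 + 2%:R * p`_0) * a j +
    (p`_4 + 2%:R * p`_7 + 2%:R * p`_1) * a j ^+ 2 + p`_5 * a j ^+ 3).
  by rewrite /w !big_ord_recl big_ord0 !mxE /= /bump /=; ring.
have wt j : a j ^+ 2 * w ord_max j =
    - ((a j ^+ 4 - 2%:R * a j) * w 0 j + (1 - 2%:R * a j ^+ 3) * w 1 j).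
  apply/eqP; rewrite -addr_eq0; apply/eqP.
  transitivity (y j - p.[a j]); last by rewrite py subrr.
  rewrite (horner_coef_wide _ sp) !big_ord_recl big_ord0 /= /bump /= w0 w1 w2 /y.
  by ring.
move=> r j; have wE : E r j = w r j + \sum_(i < 4) M r i * a j ^+ i by rewrite subrK.
rewrite {}wE big_split /= addrC; congr (_ + _).
rewrite !big_ord_recl big_ord0 !mxE /= /bump /= !derivXn !(hornerMn, hornerXn, hornerC).
case: r => [[|[|[|//]]] r3] /=.
- have -> : Ordinal r3 = 0 by apply/val_inj.
  by field.
- have -> : Ordinal r3 = 1 by apply/val_inj.
  by field.
have -> : Ordinal r3 = ord_max by apply/val_inj.
have -> : w ord_max j = - ((a j ^+ 4 - 2%:R * a j) * w 0 j +
    (1 - 2%:R * a j ^+ 3) * w 1 j) / a j ^+ 2.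
  by rewrite -wt mulrAC divff ?mul1r // expf_neq0.
by field.
Qed.

Lemma dvdX (k : fieldType) (p : {poly k}) : p.[0] = 0 -> 'X %| p.
Proof.
by move=> p0; rewrite -['X]subr0 -(polyC0 k) dvdp_XsubCl; apply/rootP.
Qed.

Lemma dvdp_factor (k : fieldType) (h p : {poly k}) :
  h %| p -> exists q, p = h * q.
Proof. by move=> /divpK <-; exists (p %/ h); rewrite mulrC. Qed.

(** Newton iteration: an error divisible by X^(N+1) is improved by a correction of that order
    solving the linear problem of [nodal_tangent_onto]. Only the tangent map at X = 0 is ever
    inverted. *)
Lemma nodal_lift (k : fieldType) (a0 : 'I_8 -> k) (Y : 'M[{poly k}]_(3, 8)) :
  injective a0 -> (forall j, a0 j != 0) ->
  at_pt 0 Y = nodal k *m moment 3 (fun=> 1) (fun=> 1) a0 ->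
  forall N, exists (M : 'M[{poly k}]_(3, 4)) (c a : 'I_8 -> {poly k}),
    [/\ at_pt 0 M = nodal k, forall j, (c j).[0] = 1, forall j, (a j).[0] = a0 j &
      forall r j, 'X^(N.+1) %| Y r j - (M *m moment 3 c (fun=> 1) a) r j].
Proof.
move=> ai an Y0; elim=> [|N [M [c [a [M0 c0 aE YM]]]]].
  exists (map_mx polyC (nodal k)), (fun=> 1), (fun j => (a0 j)%:P); split=> [|j|j|r j].
  - by rewrite at_ptC.
  - by rewrite hornerC.
  - by rewrite hornerC.
  apply: dvdX; rewrite hornerD hornerN.
  have atE (X : 'M[{poly k}]_(3, 8)) p q : (X p q).[0] = at_pt 0 X p q by rewrite mxE.
  rewrite !atE.
  rewrite Y0 at_ptM at_ptC at_pt_moment.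
  rewrite (_ : moment 3 _ _ _ = moment 3 (fun=> 1) (fun=> 1) a0) ?subrr //.
  by apply/matrixP => i l; rewrite !mxE !hornerC.
have /fin_all_exists[G GE] (r : 'I_3) : exists G : 'I_8 -> {poly k}, forall j,
    Y r j - (M *m moment 3 c (fun=> 1) a) r j = 'X^(N.+1) * G j.
  by have /fin_all_exists[G GE] j := dvdp_factor (YM r j); exists G.
have [M' [c' [b EE]]] := nodal_tangent_onto (\matrix_(r, j) (G r j).[0]) ai an.
exists (\matrix_(r, i) (M r i + 'X^(N.+1) * (M' r i)%:P)),
  (fun j => c j + 'X^(N.+1) * (c' j)%:P), (fun j => a j + 'X^(N.+1) * (b j)%:P).
have at0 (p q : {poly k}) : (p + 'X^(N.+1) * q).[0] = p.[0].
  by rewrite hornerD hornerM hornerXn expr0n mul0r addr0.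
split=> [|j|j|r j]; rewrite ?at0 //.
  by rewrite -M0; apply/matrixP => r i; rewrite !mxE /horner_eval at0.
set M2 := \matrix_(_, _) _.
have [H HE H0] : perturb N.+1 ((M *m moment 3 c (fun=> 1) a) r j)
    ((M2 *m moment 3 (fun j => c j + 'X^(N.+1) * (c' j)%:P) (fun=> 1)
        (fun j => a j + 'X^(N.+1) * (b j)%:P)) r j) (G r j).[0].
  have := EE r j; rewrite mxE => ->; rewrite !mxE; apply: perturb_sum => i.
  have Pn : (0 < N.+1)%N by [].
  rewrite !mxE; have := perturbM Pn (perturbC N.+1 (M r i) (M' r i))
    (perturbM Pn (perturbM Pn (perturbC N.+1 (c j) (c' j)) (perturb0 N.+1 (1 ^+ (3 - i))))
      (perturbX Pn i (perturbC N.+1 (a j) (b j)))).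
  congr perturb; have -> : (M r i).[0] = nodal k r i by rewrite -M0 mxE.
  by rewrite !expr1n !hornerM !horner_exp c0 aE -polyC1 !hornerC [nodal k r i]mxE; ring.
rewrite HE opprD addrA GE -mulrBr [X in X %| _]exprSr dvdp_mul //.
by apply: dvdX; rewrite hornerD hornerN H0 subrr.
Qed.

(** A factors as L Y1 through a plane. Along the line Y from a nodal configuration Y0 to Y1, the
    polynomial f(L Y) agrees to every order at 0 with values of f on projected twisted cubics, which
    are 0; hence it is zero, also at Y(1) = Y1. *)
Lemma planar_class (k : closedFieldType) (f : mhpoly k 3 8) (A : 'M[k]_(4, 8)) :
  (forall M c s t, vanishes_on f (M *m moment 3 c s t)) ->
  ~~ row_free A -> vanishes_on f A.
Proof.
move=> fC Af; have rA : (\rank A <= 3)%N.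
  by have := rank_leq_row A; rewrite leq_eqVlt -/(row_free A) (negPf Af).
have [L [Y1 ->]] : exists (L : 'M[k]_(4, 3)) (Y1 : 'M_(3, 8)), A = L *m Y1.
  exists (col_ebase A *m pid_mx 3), (pid_mx (\rank A) *m row_ebase A).
  rewrite -{1}(mulmx_ebase A) -!mulmxA; congr (_ *m _); rewrite mulmxA; congr (_ *m _).
  by rewrite mul_pid_mx; congr pid_mx; rewrite (minn_idPr rA); apply/esym/minn_idPr.
(* Nine distinct elements give eight distinct nonzero differences. *)
have [b bi] := closed_inj k 9.
pose a0 (i : 'I_8) := b (lift ord0 i) - b ord0.
have ai : injective a0 by move=> i j /addIr/bi/lift_inj.
have an j : a0 j != 0 by rewrite subr_eq0 (inj_eq bi) eq_sym neq_lift.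
pose Y0 := nodal k *m moment 3 (fun=> 1) (fun=> 1) a0.
pose Y : 'M[{poly k}]_(3, 8) := \matrix_(i, j) ((Y0 i j)%:P + 'X * (Y1 i j - Y0 i j)%:P).
have Yx x : at_pt x Y = Y0 + x *: (Y1 - Y0).
  apply/matrixP => i j; rewrite !mxE /horner_eval.
  by rewrite hornerD hornerM hornerX !hornerC.
pose Lp := map_mx polyC L; pose F := meval_curve f (Lp *m Y).
have FX N : 'X^(N.+1) %| F.
  have Y00 : at_pt 0 Y = Y0 by rewrite Yx scale0r addr0.
  have [M [c [a [_ _ _ YM]]]] := nodal_lift ai an Y00 N.
  pose P := M *m moment 3 c (fun=> 1) a.
  have F0 : meval_curve f (Lp *m P) = 0.
    apply: poly_vanish => x; rewrite horner_meval_curve !at_ptM at_ptC mulmxA.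
    rewrite at_pt_moment; exact: fC.
  rewrite -[F]subr0 -F0; apply: meval_curve_mod => i j.
  have -> : (Lp *m Y) i j - (Lp *m P) i j = \sum_l Lp i l * (Y l j - P l j).
    have mulE (X : 'M[{poly k}]_(3, 8)) : (Lp *m X) i j = \sum_l Lp i l * X l j.
      by rewrite mxE.
    rewrite !mulE -sumrB; apply: eq_bigr => l _.
    by rewrite mulrBr.
  by elim/big_rec: _ => [|l x _ IH]; rewrite ?dvdp0 //; apply: dvdp_add => //; apply: dvdp_mull.
have F0 : F = 0.
  apply/eqP/negPn/negP => Fn; have := dvdp_leq Fn (FX (size F)).
  by rewrite size_polyXn => /(leq_trans (leqnSn _)); rewrite ltnn.
have := congr1 (horner^~ 1) F0; rewrite horner0 horner_meval_curve at_ptM at_ptC Yx.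
by rewrite scale1r addrC subrK.
Qed.

(** * Cones with vertices at the dual points *)

Definition cone_at (R : comNzRingType) (m n : nat) (B : 'M[R]_(m, n))
    (v : 'cV[R]_m) (Q : 'M[R]_m) : Prop :=
  [/\ exists w, qform Q w != 0, forall j, qform Q (col j B) = 0,
      qform Q v = 0 & forall w, polar Q v w = 0].

Lemma mul_cols_tr (R : comNzRingType) (m p n q : nat) (A : 'M[R]_(m, n))
    (X : 'M[R]_(p, n)) (J : {set 'I_n}) :
  #|J| = q -> (forall j, j \notin J -> col j X = 0) ->
  cols q A J *m (cols q X J)^T = A *m X^T.
Proof.
move=> Jq X0; apply/matrixP => i l; case: (pickP 'I_n) => [x0 _|no]; last first.
  rewrite !mxE !big1 //; first by move=> j; have := no j.
  by move=> j; have := ltn_ord j; rewrite -{2}Jq eq_card0 // => u; have := no u.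
rewrite !mxE [RHS](bigID (mem J)) /= [X in _ = _ + X]big1 ?addr0 => [|j /X0].
  rewrite -[RHS]big_enum (big_nth x0) -cardE Jq big_mkord.
  by apply: eq_bigr => j _; rewrite (colsE _ x0) // mxE (colsE _ x0) // mxE.
by move=> /(congr1 (fun v : 'cV_ _ => v l 0)); rewrite !mxE => ->; rewrite mulr0.
Qed.

(* Projecting B from its i-th column gives the dual of A without column i. *)
Lemma dual_cone (k : closedFieldType) (A B : 'M[k]_(4, 8)) (i : 'I_8) :
  row_free A -> A *m B^T = 0 -> col i B != 0 ->
  (forall I : {set 'I_7}, #|I| = 6%N -> psi (cols 7 A [set~ i]) I = 0) ->
  exists Q, cone_at B (col i B) Q.
Proof.
move=> Af AB bi psiA.
have [_ [H [G [_ _ Hb HG _]]]] := split_vector bi.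
have J7 : #|[set~ i]| = 7%N by rewrite cardsC1 card_ord.
pose B' := cols 7 (H *m B) [set~ i].
have HBi j : j \notin [set~ i] -> col j (H *m B) = 0.
  by rewrite !inE negbK => /eqP ->; rewrite colE -mulmxA -colE.
have AB' : cols 7 A [set~ i] *m B'^T = 0.
  by rewrite mul_cols_tr // trmx_mul mulmxA AB mul0mx.
have colJ (R : comNzRingType) (m : nat) (X : 'M[R]_(m, 8)) j : j != i ->
    exists l, col j X = col l (cols 7 X [set~ i]).
  move=> ji; have : j \in enum [set~ i] by rewrite mem_enum !inE.
  move=> /(nthP i)[l]; rewrite -cardE J7 => l7 jE; exists (Ordinal l7).
  by apply/colP => r; rewrite [RHS]mxE (colsE _ i) // mxE /= jE.
(* Dropping column i keeps the rank: a nonzero v A supported at i alone would force b_i = 0 by A B^T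
   = 0. *)
have AJf : row_free (cols 7 A [set~ i]).
  apply/inj_row_free => v vA; apply: (row_free_inj Af); rewrite mul0mx.
  have vAj j : j != i -> (v *m A) 0 j = 0.
    move=> /(colJ _ _ A)[l Al].
    have := congr1 (fun w : 'rV_7 => w 0 l) vA; rewrite mxE [RHS]mxE => E.
    rewrite -[RHS]E mxE; apply: eq_bigr => r _.
    by have := congr1 (fun w : 'cV_4 => w r 0) Al; rewrite !mxE => ->.
  have vAi : (v *m A) 0 i = 0.
    have : (v *m A) *m B^T = 0 by rewrite -mulmxA AB mulmx0.
    move=> vAB; apply/eqP/negPn/negP => vi; case/negP: bi; apply/eqP/colP => r.
    have := congr1 (fun w : 'rV_4 => w 0 r) vAB; rewrite mxE (bigD1 i) //= big1.
      rewrite addr0 [RHS]mxE [B^T i r]mxE => /eqP.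
      by rewrite mulf_eq0 (negPf vi) => /eqP; rewrite !mxE.
    by move=> j ji; rewrite vAj // mul0r.
  by apply/rowP => j; rewrite [RHS]mxE; have [->|/vAj] := eqVneq j i.
have [N [g' [N0 _ E]]] := psi_gale AJf AB'.
have [I I6|Q' [w Qw] QB] := @conic_through _ _ B'.
  by apply: (mulfI N0); rewrite -E // psiA // mul0r mulr0.
have qE v : qform (H^T *m Q' *m H) v = qform Q' (H *m v) by rewrite qformM.
have q0 : qform Q' 0 = 0 by rewrite /qform mulmx0 mxE.
exists (H^T *m Q' *m H); split.
- by exists (G *m w); rewrite qE mulmxA HG mul1mx.
- move=> j; rewrite qE; have [->|/(colJ _ _ (H *m B))[l E']] := eqVneq j i.
    by rewrite Hb q0.
  by rewrite (_ : H *m col j B = col l B') ?QB // -E' !colE mulmxA.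
- by rewrite qE Hb q0.
move=> v; have := qformD (H^T *m Q' *m H) (col i B) v.
rewrite !qE mulmxDr Hb add0r q0 add0r => E'.
by apply: (addrI (qform Q' (H *m v))); rewrite -E' addr0.
Qed.

Definition ev (R : comNzRingType) (n : nat) (f : 'rV[R]_n) (v : 'cV[R]_n) : R :=
  (f *m v) 0 0.

Section Functionals.
Variables (R : comNzRingType) (n : nat).
Implicit Types (f g : 'rV[R]_n) (u v : 'cV[R]_n).

Lemma ev0 f : ev f 0 = 0.
Proof. by rewrite /ev mulmx0 mxE. Qed.

Lemma evD f u v : ev f (u + v) = ev f u + ev f v.
Proof. by rewrite /ev mulmxDr mxE. Qed.

Lemma evZ f a v : ev f (a *: v) = a * ev f v.
Proof. by rewrite /ev -scalemxAr mxE. Qed.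

Lemma evN f v : ev f (- v) = - ev f v.
Proof. by rewrite /ev mulmxN mxE. Qed.

Lemma ev_row m (M : 'M[R]_(m, n)) i v : ev (row i M) v = (M *m v) i 0.
Proof. by rewrite /ev -row_mul mxE. Qed.

End Functionals.

(** * Plane sections of the cones *)

Section TwoConics.
Variables (k : closedFieldType).
Implicit Types (f : 'rV[k]_4) (Q : 'M[k]_4) (x y z p : 'cV[k]_4).

(** A cone with vertex x that contains the line yz contains the plane xyz, so its equation is r
    times a linear form; that second factor cuts the plane f = 0, which avoids x, in a line. *)
Lemma cone_plane_split f Q x y z r w :
  ev f x != 0 -> (exists v, qform Q v != 0) ->
  qform Q x = 0 -> qform Q y = 0 -> qform Q z = 0 -> (forall v, polar Q x v = 0) ->
  (forall v, exists c d e, v = c *: x + d *: y + e *: z + ev r v *: w) ->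
  polar Q y z = 0 ->
  exists u v, forall p, ev f p = 0 -> qform Q p = 0 ->
    ev r p = 0 \/ exists s t, p = s *: u + t *: v.
Proof.
move=> fx [v0 qv0] qx qy qz Px spn yz.
pose al := polar Q y w; pose be := polar Q z w; pose ga := qform Q w.
have qE c d e t : qform Q (c *: x + d *: y + e *: z + t *: w) = t * (d * al + e * be + t * ga).
  rewrite qformD qform_comb3 qx qy qz yz !Px qformZ !polarDl !polarZl !polarZr Px.
  by rewrite /al /be /ga; ring.
(* Projection from the vertex x onto the plane f = 0. *)
pose pr v := v - (ev f v / ev f x) *: x.
have prE c d e t : ev f (c *: x + d *: y + e *: z + t *: w) = 0 ->
    c *: x + d *: y + e *: z + t *: w = d *: pr y + e *: pr z + t *: pr w.
  rewrite !evD !evZ => E.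
  have -> : c = - (d * ev f y + e * ev f z + t * ev f w) / ev f x.
    apply: (mulIf fx); rewrite divfK //; apply/eqP; rewrite -addr_eq0.
    by rewrite !addrA E.
  by rewrite /pr; apply/colP => i; rewrite !mxE; field.
suff [u [v H]] : exists u v, forall d e t, t != 0 -> d * al + e * be + t * ga = 0 ->
    exists s s', d *: pr y + e *: pr z + t *: pr w = s *: u + s' *: v.
  exists u, v => p fp qp; have [c [d [e E]]] := spn p.
  have [|t0] := eqVneq (ev r p) 0; [by left|right].
  move: fp qp; rewrite E; set t := ev r p in t0 * => fp.
  rewrite qE (prE _ _ _ _ fp) => /eqP; rewrite mulf_eq0 (negPf t0) => /eqP.
  exact: H.
have [al0|al0] := eqVneq al 0; last first.
  exists (pr z - (be / al) *: pr y), (pr w - (ga / al) *: pr y) => d e t _ E.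
  exists e, t.
  have -> : d = - (e * be + t * ga) / al.
    by apply: (mulIf al0); rewrite divfK //; apply/eqP; rewrite -addr_eq0 addrA E eqxx.
  move: (pr y) (pr z) (pr w) => Y1 Z1 W1.
  by apply/colP => i; rewrite !mxE; field.
have [be0|be0] := eqVneq be 0; last first.
  exists (pr y), (pr w - (ga / be) *: pr z) => d e t _; rewrite al0 mulr0 add0r => E.
  exists d, t.
  have -> : e = - (t * ga) / be.
    by apply: (mulIf be0); rewrite divfK //; apply/eqP; rewrite -addr_eq0 E eqxx.
  move: (pr y) (pr z) (pr w) => Y1 Z1 W1.
  by apply/colP => i; rewrite !mxE; field.
(* Here the second factor is a multiple of r, nonzero because Q is, so no zero of Q remains off r =
   0. *)
exists 0, 0 => d e t t0; rewrite al0 be0 !mulr0 !add0r => /eqP.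
rewrite mulf_eq0 (negPf t0) /= => /eqP ga0; exfalso; move/eqP: qv0; apply.
have [c' [d' [e' ->]]] := spn v0.
by rewrite qE al0 be0 ga0; ring.
Qed.

(* Three conics through four points impose too many conditions, unless the
   four points are collinear. *)
Lemma three_conics f Qx Qy Qz x y z p1 p2 p3 p4 :
  f != 0 -> ev f x != 0 -> ev f y != 0 -> ev f z != 0 ->
  [/\ qform Qx x = 0, qform Qx y = 0, qform Qx z = 0 & forall v, polar Qx x v = 0] ->
  [/\ qform Qy x = 0, qform Qy y = 0, qform Qy z = 0 & forall v, polar Qy y v = 0] ->
  [/\ qform Qz x = 0, qform Qz y = 0, qform Qz z = 0 & forall v, polar Qz z v = 0] ->
  polar Qx y z != 0 -> polar Qy x z != 0 -> polar Qz x y != 0 ->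
  (forall v, ev f v = 0 -> exists a b c, v = a *: p1 + b *: p2 + c *: p3) ->
  (forall Q p, Q \in [:: Qx; Qy; Qz] -> p \in [:: p1; p2; p3; p4] -> qform Q p = 0) ->
  ev f p4 = 0 ->
  exists a, [\/ p4 = a *: p1, p4 = a *: p2 | p4 = a *: p3].
Proof.
move=> f0 fx fy fz [xx xy xz Px] [yx yy yz Py] [zx zy zz Pz] nx ny nz spn Qp fp4.
have [a [b [c E4]]] := spn p4 fp4.
have Qc Q u v w : Q \in [:: Qx; Qy; Qz] ->
    qform Q (u *: p1 + v *: p2 + w *: p3) =
    u * v * polar Q p1 p2 + u * w * polar Q p1 p3 + v * w * polar Q p2 p3.
  move=> QQ; rewrite qform_comb3 (Qp Q p1) ?(Qp Q p2) ?(Qp Q p3) //; first by ring.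
  - by rewrite !inE eqxx !orbT.
  - by rewrite !inE eqxx !orbT.
  by rewrite !inE eqxx.
pose Qi (i : 'I_3) := nth Qx [:: Qx; Qy; Qz] i.
have Qim i : Qi i \in [:: Qx; Qy; Qz] by apply: mem_nth.
(* Each conic passes through the basis p1, p2, p3 of the plane, so three polar values determine it;
   [C *m w = 0] says that all three conics pass through p4. *)
pose C : 'M[k]_3 := \matrix_(i, j) nth 0
  [:: polar (Qi i) p1 p2; polar (Qi i) p1 p3; polar (Qi i) p2 p3] j.
pose w : 'cV[k]_3 := \col_j nth 0 [:: a * b; a * c; b * c] j.
have Cw : C *m w = 0.
  apply/colP => i; rewrite !mxE !big_ord_recl big_ord0 !mxE /=.
  have := Qp (Qi i) p4 (Qim i); rewrite !inE eqxx !orbT => /(_ isT).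
  by rewrite E4 Qc // => E; rewrite -[RHS]E; ring.
have [w0|wn] := eqVneq w 0.
  have ab : a * b = 0 by have := congr1 (fun v : 'cV_3 => v 0 0) w0; rewrite !mxE.
  have ac : a * c = 0 by have := congr1 (fun v : 'cV_3 => v 1 0) w0; rewrite !mxE.
  have bc : b * c = 0 by have := congr1 (fun v : 'cV_3 => v ord_max 0) w0; rewrite !mxE.
  have [a0|an] := eqVneq a 0.
    have [b0|bn] := eqVneq b 0.
      by exists c; constructor 3; rewrite E4 a0 b0 !scale0r !add0r.
    move/eqP: bc; rewrite mulf_eq0 (negPf bn) => /eqP c0.
    by exists b; constructor 2; rewrite E4 a0 c0 !scale0r add0r addr0.
  move/eqP: ab; rewrite mulf_eq0 (negPf an) => /eqP b0.
  move/eqP: ac; rewrite mulf_eq0 (negPf an) => /eqP c0.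
  by exists a; constructor 1; rewrite E4 b0 c0 !scale0r !addr0.
(* Otherwise C is singular, so a nontrivial combination of the three forms vanishes on the plane f =
   0. *)
have /det0P[l ln lC] : \det C == 0.
  apply/negPn/negP => dC; case/negP: wn.
  by rewrite -(mulKmx (_ : C \in unitmx) w) ?unitmxE ?unitfE // Cw mulmx0.
have lQ v : ev f v = 0 -> l 0 0 * qform Qx v + l 0 1 * qform Qy v + l 0 ord_max * qform Qz v = 0.
  move=> /spn[u [v' [w' ->]]]; rewrite !Qc ?inE ?eqxx ?orbT //.
  have i1 : lift ord0 ord0 = 1 :> 'I_3 by apply/val_inj.
  have i2 : lift ord0 (lift ord0 ord0) = ord_max :> 'I_3 by apply/val_inj.
  have := congr1 (fun v : 'rV_3 => v 0 0) lC; have := congr1 (fun v : 'rV_3 => v 0 1) lC.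
  have := congr1 (fun v : 'rV_3 => v 0 ord_max) lC.
  rewrite !mxE !big_ord_recl !big_ord0 !mxE i1 i2 /Qi /= => e1 e2 e3.
  have lin (t1 t2 t3 s1 s2 s3 : k) :
      t1 = 0 -> t2 = 0 -> t3 = 0 -> s1 * t1 + s2 * t2 + s3 * t3 = 0.
    by move=> -> -> ->; ring.
  by rewrite -[RHS](lin _ _ _ (v' * w') (u * w') (u * v') e1 e2 e3); ring.
case/negP: ln; apply/eqP/rowP => i; rewrite mxE.
(* Where the line through two vertices meets the plane, only the cone with the third vertex is
   nonzero; this kills the coefficients of l one by one. *)
have pz : ev f (ev f x *: y - ev f y *: x) = 0 by rewrite evD evN !evZ mulrC subrr.
have py : ev f (ev f x *: z - ev f z *: x) = 0 by rewrite evD evN !evZ mulrC subrr.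
have px : ev f (ev f y *: z - ev f z *: y) = 0 by rewrite evD evN !evZ mulrC subrr.
have Qd Q s u t v : qform Q (s *: u - t *: v) =
    s ^+ 2 * qform Q u + t ^+ 2 * qform Q v - s * t * polar Q u v.
  by rewrite -scaleNr qformD !qformZ polarZl polarZr; ring.
have := lQ _ pz; have := lQ _ py; have := lQ _ px; rewrite !Qd.
rewrite xx xy xz yx yy yz zx zy zz.
rewrite ![polar _ z x]polarC ![polar _ z y]polarC ![polar _ y x]polarC.
rewrite !Px !Py ![polar Qz _ z]polarC !Pz [polar Qy x y]polarC Py.
rewrite !(oppr0, mulr0, addr0, add0r, subr0, sub0r) => /eqP + /eqP + /eqP.
rewrite !(mulf_eq0, oppr_eq0).
rewrite (negPf nx) (negPf ny) (negPf nz) (negPf fx) (negPf fy) (negPf fz) !orbF.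
move=> /eqP l0 /eqP l1 /eqP l2.
case: i => [[|[|[|//]]] hi].
- by rewrite (_ : Ordinal hi = 0) //; apply/val_inj.
- by rewrite (_ : Ordinal hi = 1) //; apply/val_inj.
by rewrite (_ : Ordinal hi = ord_max) //; apply/val_inj.
Qed.

End TwoConics.

Lemma kernel_coords (F : fieldType) (n : nat) (f : 'rV[F]_n.+1) :
  f != 0 -> exists K : 'M[F]_(n.+1, n),
    [/\ forall c, ev f (K *m c) = 0, forall c : 'cV_n, K *m c = 0 -> c = 0 &
        forall v, ev f v = 0 -> exists c, v = K *m c].
Proof.
move=> f0; have fT0 : f^T != 0 by rewrite -trmx0 (inj_eq trmx_inj).
have [g [H [K [_ _ Hf HK E]]]] := split_vector fT0.
have HTf : f *m H^T = 0 by rewrite -[f]trmxK -trmx_mul Hf trmx0.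
have KH : K^T *m H^T = 1%:M by rewrite -trmx_mul HK trmx1.
exists H^T; split=> [c|c Hc|v fv].
- by rewrite /ev mulmxA HTf mul0mx mxE.
- by rewrite -[c]mul1mx -KH -mulmxA Hc mulmx0.
exists (K^T *m v); rewrite -{1}[v]mul1mx -trmx1 -E linearD /= !trmx_mul trmxK.
rewrite mulmxDl -!mulmxA (_ : f *m v = 0) ?mulmx0 ?add0r //.
by rewrite [LHS]mx11_scalar -/(ev f v) fv raddf0.
Qed.

Lemma kernel_basis (F : fieldType) (f : 'rV[F]_4) (e : 'cV[F]_4) :
  f != 0 -> e != 0 -> ev f e = 0 -> exists g h,
    [/\ ev f g = 0, ev f h = 0 &
      forall v, ev f v = 0 -> exists x y z, v = x *: e + y *: g + z *: h].
Proof.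
move=> f0 e0 fe; have [K [fK Ki Ks]] := kernel_coords f0.
have [c eE] := Ks e fe.
have c0 : c != 0 by apply: contraNneq e0 => c0; rewrite eE c0 mulmx0.
have [M Mu M0] := complete_basis c0.
exists (K *m col 1 M), (K *m col ord_max M); split=> // v /Ks[w ->].
pose w' := invmx M *m w; exists (w' 0 0), (w' 1 0), (w' ord_max 0).
rewrite eE -M0 !scalemxAr -!mulmxDr; congr (K *m _).
rewrite -[LHS](mulKVmx Mu) -/w'; clearbody w'; apply/colP => i.
rewrite !mxE !big_ord_recl big_ord0 addr0 addrA.
have -> : lift ord0 ord0 = 1 :> 'I_3 by apply/val_inj.
have -> : lift ord0 (lift ord0 ord0) = ord_max :> 'I_3 by apply/val_inj.
by rewrite ![M i _ * _]mulrC.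
Qed.

Section Classes.
Variables (k : closedFieldType) (n : nat) (Z : 'M[k]_(4, n) -> Prop).
Hypotheses (Zc : curve_closed Z) (Zm : forall M c s t, Z (M *m moment 3 c s t)).
Variable B : 'M[k]_(4, n).
Hypothesis cones : forall i, col i B != 0 -> exists Q, cone_at B (col i B) Q.

Lemma cone_line_class (f : 'rV[k]_4) (Q : 'M[k]_4) (b e : 'cV[k]_4) :
  f != 0 -> ev f b != 0 -> cone_at B b Q -> e != 0 -> ev f e = 0 -> qform Q e = 0 ->
  (forall j, ev f (col j B) = 0 \/ exists s t, col j B = s *: e + t *: b) -> Z B.
Proof.
move=> f0 fb [[w Qw] QB Qb Pb] e0 fe Qe H.
have [g [h [_ _ spn]]] := kernel_basis f0 e0 fe.
apply: (conic_line_class Zc Zm (e := e) (g := g) (h := h) (b := b) Qe) => [|j].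
  (* Projecting from the vertex b does not change Q, so Q is nonzero on the plane. *)
  pose w' := w - (ev f w / ev f b) *: b.
  have fw : ev f w' = 0 by rewrite evD evN evZ divfK // subrr.
  have [x [y [z E]]] := spn w' fw; exists x, y, z; rewrite -E.
  suff -> : qform Q w' = qform Q w by [].
  by rewrite /w' -scaleNr qformD qformZ Qb polarZr polarC Pb !mulr0 !addr0.
by case: (H j) => [fj|]; [left; split=> //; apply: spn | right].
Qed.

(** Let b be a point off the plane. If another point y lies off it, the line is by, and it meets the
    plane in a point e of the cone over b, since Q vanishes on that line; if b is the only one, any
    point of the conic serves as e. *)
Lemma split_class (f : 'rV[k]_4) (u v : 'cV[k]_4) :
  row_free B -> f != 0 ->
  (forall j, ev f (col j B) = 0 \/ exists s t, col j B = s *: u + t *: v) -> Z B.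
Proof.
move=> Bf f0 H.
have [x fx] : exists x, ev f (col x B) != 0.
  case: (pickP (fun x => ev f (col x B) != 0)) => [x|f0']; first by exists x.
  exfalso; move/eqP: f0; apply; apply: (row_free_inj Bf); rewrite mul0mx.
  apply/rowP => j; rewrite [RHS]mxE; have /eqP := f0' j.
  by rewrite /ev colE mulmxA -colE mxE.
have bx0 : col x B != 0 by apply: contraNneq fx => ->; rewrite ev0.
have [Q Qc] := cones bx0.
set b := col x B in fx bx0 Qc *.
have [y /andP[fy ny]|par] := pickP (fun y => (ev f (col y B) != 0) &&
    (ev f (col y B) *: b - ev f b *: col y B != 0)).
  pose e := ev f (col y B) *: b - ev f b *: col y B.
  have fe : ev f e = 0 by rewrite evD evN !evZ mulrC subrr.
  have Qe : qform Q e = 0.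
    case: Qc => _ QB Qb Pb.
    by rewrite /e -scaleNr qformD !qformZ polarZl Pb Qb QB; ring.
  apply: (cone_line_class (e := e) f0 fx Qc ny fe Qe) => j.
  case: (H j) => [|Hj]; [by left | right].
  have [//|[b1 [b2 bE]]] := H x; first by move=> E; rewrite E eqxx in fx.
  have [//|[y1 [y2 yE]]] := H y; first by move=> E; rewrite E eqxx in fy.
  rewrite -/b in bE.
  pose e1 := ev f (col y B) * b1 - ev f b * y1.
  pose e2 := ev f (col y B) * b2 - ev f b * y2.
  have eE : e = e1 *: u + e2 *: v.
    suff eL p q : p *: b - q *: col y B = (p * b1 - q * y1) *: u + (p * b2 - q * y2) *: v.
      exact: eL.
    by rewrite bE yE; apply/colP => i; rewrite !mxE; ring.
  (* e and b are independent, as f vanishes at e and not at b, so they span the line of u and v. *)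
  have dn : e1 * b2 - e2 * b1 != 0.
    apply/negP => /eqP d0.
    have : b1 *: e - e1 *: b = 0.
      rewrite eE {1}bE; apply/colP => i; rewrite !mxE.
      by transitivity (- (e1 * b2 - e2 * b1) * v i 0); [ring | rewrite d0; ring].
    move=> /(congr1 (ev f)); rewrite evD evN !evZ fe mulr0 add0r ev0.
    move/eqP; rewrite oppr_eq0 mulf_eq0 (negPf fx) orbF => /eqP e10.
    have : b2 *: e - e2 *: b = 0.
      rewrite eE {1}bE; apply/colP => i; rewrite !mxE.
      by transitivity ((e1 * b2 - e2 * b1) * u i 0); [ring | rewrite d0; ring].
    move=> /(congr1 (ev f)); rewrite evD evN !evZ fe mulr0 add0r ev0.
    move/eqP; rewrite oppr_eq0 mulf_eq0 (negPf fx) orbF => /eqP e20.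
    by case/negP: ny; apply/eqP; rewrite -/e eE e10 e20 !scale0r addr0.
  case: Hj => s [t ->].
  exists ((s * b2 - t * b1) / (e1 * b2 - e2 * b1)), ((e1 * t - e2 * s) / (e1 * b2 - e2 * b1)).
  rewrite eE bE; clearbody e1 e2.
  by apply/colP => i; rewrite !mxE; field.
(* Every point off the plane is b; e is taken as a zero of Q on some line of the plane. *)
have [K [fK Ki _]] := kernel_coords f0.
pose k0 : 'cV_4 := K *m delta_mx 0 0; pose k1 : 'cV_4 := K *m delta_mx 1 0.
have [c [d /andP[cd /eqP E]]] :=
  binary_quadratic_root (qform Q k0) (polar Q k0 k1) (qform Q k1).
have eE : c *: k0 + d *: k1 = K *m (c *: delta_mx 0 0 + d *: delta_mx 1 0).
  by rewrite mulmxDr -!scalemxAr.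
apply: (cone_line_class f0 fx Qc (e := c *: k0 + d *: k1)).
- rewrite eE; apply: contraNneq cd => /Ki /colP z.
  by have := z 0; have := z 1; rewrite !mxE /= !mulr1 !mulr0 addr0 add0r => -> ->.
- by rewrite eE.
- by rewrite qformD !qformZ polarZl polarZr -[RHS]E; ring.
move=> j; have [|fj] := eqVneq (ev f (col j B)) 0; [by left | right].
have := par j; rewrite fj /= => /negbT; rewrite negbK subr_eq0 => /eqP bj.
exists 0, (ev f (col j B) / ev f b); rewrite scale0r add0r.
rewrite mulrC -scalerA bj scalerA mulVf ?scale1r //.
Qed.

End Classes.

(** * Twisted cubics through six points in general position *)

(** If no coordinate is 0, a relation divided by the x's says that three points (b_i, b_i / x_i) are
    collinear; so b_i / x_i = s b_i - t for common s and t. If some coordinate is 0, all products of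
    two vanish, and x is a multiple of a coordinate vector, reached at s = 1, t = b_i. *)
Lemma twisted_cubic_param (F : fieldType) (b0 b1 b2 b3 x0 x1 x2 x3 : F) :
  let rel bp bq br xp xq xr := (br - bq) * bp * (xq * xr) + (bp - br) * bq * (xp * xr) +
    (bq - bp) * br * (xp * xq) in
  uniq [:: 0; b0; b1; b2; b3] ->
  rel b0 b1 b2 x0 x1 x2 = 0 -> rel b0 b1 b3 x0 x1 x3 = 0 ->
  rel b0 b2 b3 x0 x2 x3 = 0 -> rel b1 b2 b3 x1 x2 x3 = 0 ->
  exists c s t,
    [/\ x0 = c * (b0 * ((s * b1 - t) * (s * b2 - t) * (s * b3 - t))),
        x1 = c * (b1 * ((s * b0 - t) * (s * b2 - t) * (s * b3 - t))),
        x2 = c * (b2 * ((s * b0 - t) * (s * b1 - t) * (s * b3 - t))) &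
        x3 = c * (b3 * ((s * b0 - t) * (s * b1 - t) * (s * b2 - t)))].
Proof.
move=> rel; rewrite /= !inE !negb_or -!andbA ![0 == _]eq_sym => /and5P[n0 n1 n2 n3].
case/and5P=> n01 n02 n03 n12 /and3P[n13 n23 _].
have sb (p q : F) : p != q -> (p - q != 0) * (q - p != 0).
  by move=> pq; rewrite !subr_eq0 [q == p]eq_sym pq.
have [d01 d01'] := sb _ _ n01; have [d02 d02'] := sb _ _ n02.
have [d03 d03'] := sb _ _ n03; have [d12 d12'] := sb _ _ n12.
have [d13 d13'] := sb _ _ n13; have [d23 d23'] := sb _ _ n23.
rewrite /rel => r012 r013 r023 r123.
have [/and4P[y0 y1 y2 y3]|z] := boolP [&& x0 != 0, x1 != 0, x2 != 0 & x3 != 0].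
  pose t := (x0^-1 - x1^-1) / (b1^-1 - b0^-1); pose s := x0^-1 + t / b0.
  have tE : t = (x1 - x0) * b0 * b1 / ((b0 - b1) * x0 * x1).
    rewrite /t; field; rewrite y0 y1 n0 n1 d01 /=.
    by [].
  have e0 : s * b0 - t = b0 / x0 by rewrite /s; field; rewrite n0 y0.
  have e1 : s * b1 - t = b1 / x1.
    by rewrite /s tE; field; rewrite y0 y1 n0 d01.
  have e (b x : F) : b != 0 -> x != 0 ->
     (b - b1) * b0 * (x1 * x) + (b0 - b) * b1 * (x0 * x) + (b1 - b0) * b * (x0 * x1) = 0 ->
     s * b - t = b / x.
    move=> bn xn r; rewrite /s tE.
    have -> : b * x^-1 = ((b - b1) * b0 * (x1 * x) + (b0 - b) * b1 * (x0 * x)) /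
       ((b0 - b1) * x0 * x1 * x).
      have -> : (b - b1) * b0 * (x1 * x) + (b0 - b) * b1 * (x0 * x) =
          (b0 - b1) * b * (x0 * x1).
        by apply/eqP; rewrite -subr_eq0; apply/eqP; rewrite -[RHS]r; ring.
      by field; rewrite xn y0 y1 d01.
    by field; rewrite xn y0 y1 n0 d01.
  have e2 := e b2 x2 n2 y2 r012; have e3 := e b3 x3 n3 y3 r013.
  exists ((s * b0 - t) * (s * b1 - t) * (s * b2 - t) * (s * b3 - t))^-1, s, t.
  by rewrite e0 e1 e2 e3; split; field; rewrite ?n0 ?n1 ?n2 ?n3 ?y0 ?y1 ?y2 ?y3.
have prods : [/\ x0 * x1 = 0, x0 * x2 = 0, x0 * x3 = 0 & [/\ x1 * x2 = 0, x1 * x3 = 0 & x2 * x3 = 0]].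
  have canc (a b y : F) : a != 0 -> b != 0 -> a * b * y = 0 -> y = 0.
    by move=> an bn /eqP; rewrite !mulf_eq0 (negPf an) (negPf bn) => /eqP.
  move: z; rewrite !negb_and !negbK => /or4P[] /eqP z; move: r012 r013 r023 r123;
    rewrite z !(mulr0, mul0r, add0r, addr0).
  - by do 3![move=> /(canc _ _ _ _ _) -> //].
  - by move=> /(canc _ _ _ _ _) -> // /(canc _ _ _ _ _) -> // _ /(canc _ _ _ _ _) -> //.
  - by move=> /(canc _ _ _ _ _) -> // _ /(canc _ _ _ _ _) -> // /(canc _ _ _ _ _) -> //.
  by move=> _ /(canc _ _ _ _ _) -> // /(canc _ _ _ _ _) -> // /(canc _ _ _ _ _) -> //.
case: prods => /eqP + /eqP + /eqP + [/eqP + /eqP + /eqP]; rewrite !mulf_eq0.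
have [z0|y0] := eqVneq x0 0; last first.
  move=> /= /eqP-> /eqP-> /eqP-> _ _ _.
  exists (x0 / (b0 * ((b1 - b0) * (b2 - b0) * (b3 - b0)))), 1, b0.
  by split; field; rewrite ?n0 ?d01' ?d02' ?d03'.
move=> _ _ _; have [z1|y1] := eqVneq x1 0; last first.
  move=> /= /eqP-> /eqP-> _; rewrite z0.
  exists (x1 / (b1 * ((b0 - b1) * (b2 - b1) * (b3 - b1)))), 1, b1.
  by split; field; rewrite ?n1 ?d01 ?d12' ?d13'.
move=> _ _; rewrite z0 z1; have [z2|y2] := eqVneq x2 0; last first.
  move=> /= /eqP->.
  exists (x2 / (b2 * ((b0 - b2) * (b1 - b2) * (b3 - b2)))), 1, b2.
  by split; field; rewrite ?n2 ?d02 ?d12 ?d23'.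
move=> _; rewrite z2.
exists (x3 / (b3 * ((b0 - b3) * (b1 - b3) * (b2 - b3)))), 1, b3.
by split; field; rewrite ?n3 ?d03 ?d13 ?d23.
Qed.

(** A cone with vertex em through the other coordinate points has only the coefficients P, R, S. The
    unit point and b impose two linear conditions that fix them up to a scalar t, and the relation
    is the resulting equation at x. *)
Lemma cone_relation (F : fieldType) (Q : 'M[F]_4) (em ep eq er : 'cV[F]_4)
    (bm bp bq br xm xp xq xr : F) :
  (exists v, qform Q v != 0) ->
  (forall v, exists m p q r, v = m *: em + p *: ep + q *: eq + r *: er) ->
  qform Q em = 0 -> (forall v, polar Q em v = 0) ->
  qform Q ep = 0 -> qform Q eq = 0 -> qform Q er = 0 ->
  uniq [:: 0; bp; bq; br] ->
  qform Q (em + ep + eq + er) = 0 ->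
  qform Q (bm *: em + bp *: ep + bq *: eq + br *: er) = 0 ->
  qform Q (xm *: em + xp *: ep + xq *: eq + xr *: er) = 0 ->
  (br - bq) * bp * (xq * xr) + (bp - br) * bq * (xp * xr) +
    (bq - bp) * br * (xp * xq) = 0.
Proof.
move=> [v qv] spn qm Pm qp qq qr u.
pose P := polar Q ep eq; pose R := polar Q ep er; pose S := polar Q eq er.
have qE m p q r : qform Q (m *: em + p *: ep + q *: eq + r *: er) =
    p * q * P + p * r * R + q * r * S.
  rewrite qformD qform_comb3 !polarDl !polarZl !polarZr qformZ qm qp qq qr !Pm.
  by rewrite /P /R /S; ring.
have := qE 1 1 1 1; rewrite !scale1r => ->; rewrite !qE !mul1r => E1 Eb Ex.
move: u; rewrite /= !inE !negb_or -!andbA ![0 == _]eq_sym.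
case/and5P=> p0 q0 r0 npq /and3P[npr nqr _].
have dpr : bp - br != 0 by rewrite subr_eq0.
pose t := R / ((bp - br) * bq).
have SE : S = - P - R by apply/eqP; rewrite -subr_eq0; apply/eqP; rewrite -[RHS]E1; ring.
have RE : R = t * ((bp - br) * bq) by rewrite /t divfK // mulf_neq0.
have PE : P = t * ((bq - bp) * br).
  have dq : bq * (bp - br) != 0 by rewrite mulf_neq0.
  apply: (mulfI dq); apply/eqP; rewrite -subr_eq0; apply/eqP.
  by rewrite -[RHS]Eb SE RE; ring.
have SE' : S = t * ((br - bq) * bp) by rewrite SE PE RE; ring.
have t0 : t != 0.
  apply: contraNneq qv => t0; have [m [p [q [r ->]]]] := spn v.
  by rewrite qE SE' PE RE t0; apply/eqP; ring.
apply: (mulfI t0); rewrite mulr0 -[RHS]Ex SE' PE RE; ring.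
Qed.

Section TwistedCubic.
Variables (k : closedFieldType) (n : nat) (Z : 'M[k]_(4, n) -> Prop).
Hypothesis Zm : forall M c s t, Z (M *m moment 3 c s t).
Variable B : 'M[k]_(4, n).
Hypothesis cones : forall i, col i B != 0 -> exists Q, cone_at B (col i B) Q.

(** Four of the points become the coordinate points, the fifth the unit point, and the sixth has
    coordinates b. The cones at the coordinate points give, for every column, the four relations of
    [twisted_cubic_param]. *)
Lemma general_position_class (i : nat -> 'I_n) :
  (forall f : 'rV[k]_4, forall a b c d : nat, uniq [:: a; b; c; d] ->
     all (gtn 6) [:: a; b; c; d] ->
     all (fun l => ev f (col (i l) B) == 0) [:: a; b; c; d] -> f = 0) -> Z B.
Proof.
move=> gp; pose G : 'M[k]_4 := \matrix_(r, l) B r (i l).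
have colG (l : 'I_4) : col l G = col (i l) B by apply/colP => r; rewrite !mxE.
have Gu : G \in unitmx.
  rewrite -row_free_unit; apply/inj_row_free => f fG.
  apply: (gp f 0 1 2 3) => //; apply/allP => l; rewrite !inE => ll.
  have l4 : (l < 4)%N by move: ll; lia.
  rewrite -(colG (Ordinal l4)) /ev colE mulmxA fG mul0mx mxE //.
pose ph l := row l (invmx G).
have phE (l m : 'I_4) : ev (ph l) (col (i m) B) = (l == m)%:R.
  by rewrite -colG ev_row colE mulmxA mulVmx // mul1mx mxE eqxx andbT.
have ph0 l : ph l != 0.
  apply: contra_eq_neq (phE l l) => ->.
  by rewrite /ev mul0mx mxE eqxx eq_sym oner_eq0.
pose al l := ev (ph l) (col (i 4) B).
have gp3 (l : 'I_4) m (f : 'rV[k]_4) : m \in [:: 4; 5]%N ->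
    (forall q : 'I_4, q != l -> ev f (col (i q) B) = 0) ->
    ev f (col (i m) B) = 0 -> f = 0.
  move=> m45 fq fm; have {}fq q : (q < 4)%N -> (q != l)%N -> ev f (col (i q) B) == 0.
    by move=> q4 ql; apply/eqP; apply: (fq (Ordinal q4)).
  move: fm; have /orP[/eqP->|/eqP->] : (m == 4) || (m == 5) by move: m45; rewrite !inE.
    move=> /eqP fm; case: l fq => [[|[|[|[|//]]]] l4] fq /=.
    - by apply: (gp f 1 2 3 4); rewrite //= (fq 1) // (fq 2) // (fq 3) // fm.
    - by apply: (gp f 0 2 3 4); rewrite //= (fq 0) // (fq 2) // (fq 3) // fm.
    - by apply: (gp f 0 1 3 4); rewrite //= (fq 0) // (fq 1) // (fq 3) // fm.
    by apply: (gp f 0 1 2 4); rewrite //= (fq 0) // (fq 1) // (fq 2) // fm.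
  move=> /eqP fm; case: l fq => [[|[|[|[|//]]]] l4] fq /=.
  - by apply: (gp f 1 2 3 5); rewrite //= (fq 1) // (fq 2) // (fq 3) // fm.
  - by apply: (gp f 0 2 3 5); rewrite //= (fq 0) // (fq 2) // (fq 3) // fm.
  - by apply: (gp f 0 1 3 5); rewrite //= (fq 0) // (fq 1) // (fq 3) // fm.
  by apply: (gp f 0 1 2 5); rewrite //= (fq 0) // (fq 1) // (fq 2) // fm.
have al0 l : al l != 0.
  apply: contraNneq (ph0 l) => al0; apply/eqP; apply: (gp3 l 4) => // q ql.
  by rewrite phE eq_sym (negPf ql).
pose psi l := (al l)^-1 *: ph l; pose e l := al l *: col (i l) B.
have evZl a (f : 'rV[k]_4) v : ev (a *: f) v = a * ev f v.
  by rewrite /ev -scalemxAl mxE.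
have evBl (f g : 'rV[k]_4) v : ev (f - g) v = ev f v - ev g v.
  by rewrite /ev mulmxBl !mxE.
have spn v : v = ev (psi 0) v *: e 0 + ev (psi 1) v *: e 1 +
    ev (psi (inord 2)) v *: e (inord 2) + ev (psi (inord 3)) v *: e (inord 3).
  have sE l : ev (psi l) v *: e l = (invmx G *m v) l 0 *: col l G.
    rewrite evZl scalerA mulrC mulrA divff ?mul1r ?al0 //.
    by rewrite ev_row colG.
  rewrite !sE; move: (mulKVmx Gu v) => {1}<-; move: (invmx G *m v) => w.
  apply/colP => r; rewrite !mxE !big_ord_recl big_ord0 addr0 !addrA.
  rewrite ![_ * w _ _]mulrC.
  have -> : lift ord0 ord0 = 1 :> 'I_4 by apply/val_inj.
  have -> : lift ord0 (lift ord0 ord0) = inord 2 :> 'I_4 by apply/val_inj; rewrite /= inordK.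
  have -> : lift ord0 (lift ord0 (lift ord0 ord0)) = inord 3 :> 'I_4.
    by apply/val_inj; rewrite /= inordK.
  by rewrite !mxE.
have psE (l m : 'I_4) : l != m -> ev (psi l) (col (i m) B) = 0.
  by move=> lm; rewrite evZl phE (negPf lm) mulr0.
have psl l : ev (psi l) (col (i l) B) = (al l)^-1 by rewrite evZl phE eqxx mulr1.
have ps4 l : ev (psi l) (col (i 4) B) = 1 by rewrite evZl mulVf.
pose be l := ev (psi l) (col (i 5) B).
have be0 l : be l != 0.
  apply: contraNneq (ph0 l) => E; have al1 : (al l)^-1 != 0 by rewrite invr_eq0.
  apply/eqP; apply: (gp3 l 5) => // [q ql|]; first by rewrite phE eq_sym (negPf ql).
  by move/eqP: E; rewrite /be evZl mulf_eq0 (negPf al1) => /eqP.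
(* Equal coordinates l and m would put the other two coordinate points and the last two points on a
   plane. *)
have bei l m : l != m -> be l != be m.
  move=> lm; apply/eqP => E.
  have ps0 : psi l - psi m = 0.
    have d4 : ev (psi l - psi m) (col (i 4) B) == 0 by rewrite evBl !ps4 subrr.
    have d5 : ev (psi l - psi m) (col (i 5) B) == 0 by rewrite evBl -/(be l) -/(be m) E subrr.
    have dq q (q4 : (q < 4)%N) : (q != l)%N -> (q != m)%N ->
        ev (psi l - psi m) (col (i q) B) == 0.
      move=> ql qm; rewrite evBl (psE l (Ordinal q4)) ?(psE m (Ordinal q4)) ?subrr //.
        by rewrite eq_sym.
      by rewrite eq_sym.
    move: dq; move: (psi l - psi m) d4 d5 => f d4 d5.
    case: l m lm {E} => [[|[|[|[|//]]]] l4] [[|[|[|[|//]]]] m4] // _ dq;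
      [ apply: (gp f 2 3 4 5) | apply: (gp f 1 3 4 5) | apply: (gp f 1 2 4 5)
      | apply: (gp f 2 3 4 5) | apply: (gp f 0 3 4 5) | apply: (gp f 0 2 4 5)
      | apply: (gp f 1 3 4 5) | apply: (gp f 0 3 4 5) | apply: (gp f 0 1 4 5)
      | apply: (gp f 1 2 4 5) | apply: (gp f 0 2 4 5) | apply: (gp f 0 1 4 5)];
      rewrite //= d4 d5 !andbT ?(dq 0%N) ?(dq 1%N) ?(dq 2%N) ?(dq 3%N) //.
  have := congr1 (fun f : 'rV_4 => ev f (col (i l) B)) ps0.
  rewrite evBl psl (psE m l) 1?eq_sym // subr0 /ev mul0mx mxE => /eqP.
  by rewrite invr_eq0 (negPf (al0 l)).
pose b0 := be 0; pose b1 := be 1; pose b2 := be (inord 2); pose b3 := be (inord 3).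
pose o2 : 'I_4 := inord 2; pose o3 : 'I_4 := inord 3.
have ub : uniq [:: 0; b0; b1; b2; b3].
  rewrite /= !inE !negb_or ![0 == _]eq_sym !be0 /= !bei //;
    by rewrite -val_eqE /= ?inordK.
have e0n l : e l != 0.
  rewrite /e scaler_eq0 negb_or al0; apply: contraNneq (ph0 l) => E.
  have := phE l l; rewrite E /ev mulmx0 mxE eqxx => /eqP.
  by rewrite eq_sym oner_eq0.
have cone l : exists Q, [/\ exists v, qform Q v != 0, forall j, qform Q (col j B) = 0,
    qform Q (e l) = 0, forall v, polar Q (e l) v = 0 & forall m, qform Q (e m) = 0].
  have cl : col (i l) B != 0 by move: (e0n l); rewrite /e scaler_eq0 negb_or al0.
  have [Q [Qn QB Ql Pl]] := cones cl; exists Q; split=> //.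
  - by rewrite /e qformZ Ql mulr0.
  - by move=> v; rewrite /e polarZl Pl mulr0.
  by move=> m; rewrite /e qformZ QB mulr0.
have E4 : col (i 4) B = e 0 + e 1 + e o2 + e o3.
  by rewrite {1}[col _ _]spn !ps4 !scale1r.
have E5 : col (i 5) B = b0 *: e 0 + b1 *: e 1 + b2 *: e o2 + b3 *: e o3 by apply: spn.
(* The coefficients of s^3, s^2 t, s t^2, t^3 in the vector whose coordinate l is b_l times the
   product of s b_m - t over m different from l. *)
pose us : 4.-tuple 'cV[k]_4 := [tuple
  (b0 * (b1 * b2 * b3)) *: e 0 + (b1 * (b0 * b2 * b3)) *: e 1 +
    (b2 * (b0 * b1 * b3)) *: e o2 + (b3 * (b0 * b1 * b2)) *: e o3;
  - ((b0 * (b1 * b2 + b1 * b3 + b2 * b3)) *: e 0 + (b1 * (b0 * b2 + b0 * b3 + b2 * b3)) *: e 1 +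
    (b2 * (b0 * b1 + b0 * b3 + b1 * b3)) *: e o2 + (b3 * (b0 * b1 + b0 * b2 + b1 * b2)) *: e o3);
  (b0 * (b1 + b2 + b3)) *: e 0 + (b1 * (b0 + b2 + b3)) *: e 1 +
    (b2 * (b0 + b1 + b3)) *: e o2 + (b3 * (b0 + b1 + b2)) *: e o3;
  - (b0 *: e 0 + b1 *: e 1 + b2 *: e o2 + b3 *: e o3)].
apply: (on_curve Zm (u := tnth us)) => j.
pose x l := ev (psi l) (col j B).
have Ex : col j B = x 0 *: e 0 + x 1 *: e 1 + x o2 *: e o2 + x o3 *: e o3 by apply: spn.
have rel (m p q r : 'I_4) :
    (forall F : 'I_4 -> 'cV[k]_4, F 0 + F 1 + F o2 + F o3 = F m + F p + F q + F r) ->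
    uniq [:: 0; be p; be q; be r] ->
    (be r - be q) * be p * (x q * x r) + (be p - be r) * be q * (x p * x r) +
    (be q - be p) * be r * (x p * x q) = 0.
  move=> S u; have [Q [Qn QB Qm Pm Qe]] := cone m.
  apply: (cone_relation (em := e m) (bm := be m) (xm := x m) Qn _ Qm Pm
    (Qe p) (Qe q) (Qe r)) => //.
  - move=> v; exists (ev (psi m) v), (ev (psi p) v), (ev (psi q) v), (ev (psi r) v).
    by rewrite {1}[v]spn; apply: (S (fun l => ev (psi l) v *: e l)).
  - by rewrite -S -E4.
  - by rewrite -(S (fun l => be l *: e l)) -E5.
  by rewrite -(S (fun l => x l *: e l)) -Ex.
have sym (F : 'I_4 -> 'cV[k]_4) : [/\ F 0 + F 1 + F o2 + F o3 = F o3 + F 0 + F 1 + F o2,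
    F 0 + F 1 + F o2 + F o3 = F o2 + F 0 + F 1 + F o3 &
    F 0 + F 1 + F o2 + F o3 = F 1 + F 0 + F o2 + F o3].
  by split; apply/colP => r; rewrite !mxE; ring.
have r012 := rel o3 0 1 o2 (fun F => let: And3 h _ _ := sym F in h)
  (mask_uniq ub [:: true; true; true; true; false]).
have r013 := rel o2 0 1 o3 (fun F => let: And3 _ h _ := sym F in h)
  (mask_uniq ub [:: true; true; true; false; true]).
have r023 := rel 1 0 o2 o3 (fun F => let: And3 _ _ h := sym F in h)
  (mask_uniq ub [:: true; true; false; true; true]).
have r123 := rel 0 1 o2 o3 (fun F => erefl)
  (mask_uniq ub [:: true; false; true; true; true]).
have [c [s [t [x0E x1E x2E x3E]]]] := twisted_cubic_param ub r012 r013 r023 r123.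
exists c, s, t; rewrite Ex x0E x1E x2E x3E !big_ord_recl big_ord0 addr0 /us /tnth /=.
clearbody e b0 b1 b2 b3; apply/colP => r; rewrite !mxE /bump /=; ring.
Qed.

End TwistedCubic.

(** * Collinear and coplanar sets of points *)

Definition span2 (F : fieldType) (n : nat) (u v w : 'cV[F]_n) : bool :=
  (w^T <= col_mx u^T v^T)%MS.

Lemma span2P (F : fieldType) (n : nat) (u v w : 'cV[F]_n) :
  reflect (exists s t, w = s *: u + t *: v) (span2 u v w).
Proof.
apply: (iffP submxP) => [[D wE]|[s [t ->]]].
  exists (lsubmx D 0 0), (rsubmx D 0 0); apply: trmx_inj.
  rewrite wE -{1}[D]hsubmxK mul_row_col linearD /= !linearZ /=.
  by rewrite [lsubmx D]mx11_scalar [rsubmx D]mx11_scalar !mul_scalar_mx !mxE eqxx !mulr1n.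
exists (row_mx s%:M t%:M).
by rewrite mul_row_col !mul_scalar_mx linearD /= !linearZ.
Qed.

Lemma span2_exchange (F : fieldType) (n : nat) (u v p q r : 'cV[F]_n) :
  p != 0 -> (forall c, q <> c *: p) ->
  span2 u v p -> span2 u v q -> span2 u v r -> span2 p q r.
Proof.
move=> p0 pq /span2P[p1 [p2 pE]] /span2P[q1 [q2 qE]] /span2P[r1 [r2 rE]].
have dn : p1 * q2 - p2 * q1 != 0.
  apply/negP => /eqP d0; have [p20|p2n] := eqVneq p2 0.
    have p1n : p1 != 0 by apply: contraNneq p0 => p10; rewrite pE p10 p20 !scale0r addr0.
    have q20 : q2 = 0.
      by move: d0; rewrite p20 mul0r subr0 => /eqP; rewrite mulf_eq0 (negPf p1n) => /eqP.
    apply: (pq (q1 / p1)); rewrite pE qE p20 q20 !scale0r !addr0 scalerA divfK //.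
  apply: (pq (q2 / p2)); rewrite pE qE; apply/colP => i; rewrite !mxE.
  have -> : q1 = p1 * q2 / p2.
    by apply: (mulIf p2n); rewrite divfK // mulrC; apply/esym/eqP; rewrite -subr_eq0 d0.
  by field.
apply/span2P; exists ((r1 * q2 - r2 * q1) / (p1 * q2 - p2 * q1)),
  ((p1 * r2 - p2 * r1) / (p1 * q2 - p2 * q1)).
by rewrite pE qE rE; apply/colP => i; rewrite !mxE; field.
Qed.

Definition free3 (F : fieldType) (n : nat) (x y z : 'cV[F]_n) : Prop :=
  forall a b c, a *: x + b *: y + c *: z = 0 -> [/\ a = 0, b = 0 & c = 0].

Lemma free3_of_span2 (F : fieldType) (n : nat) (x y z : 'cV[F]_n) :
  x != 0 -> (forall c, y <> c *: x) -> ~~ span2 x y z -> free3 x y z.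
Proof.
move=> x0 xy xyz a b c E.
have c0 : c = 0.
  apply/eqP; apply: contraNT xyz => c0; apply/span2P; exists (- a / c), (- b / c).
  apply: (scalerI c0); apply/eqP; rewrite -subr_eq0; apply/eqP.
  rewrite -[RHS]E; apply/colP => i; rewrite !mxE; field.
  by [].
move: E; rewrite c0 scale0r addr0 => E.
have b0 : b = 0.
  apply/eqP/negPn/negP => bn; apply: (xy (- a / b)); apply: (scalerI bn).
  rewrite scalerA mulrCA divff // mulr1 scaleNr; apply/eqP.
  by rewrite -addr_eq0 addrC E.
move: E; rewrite b0 scale0r addr0 => /eqP.
by rewrite scaler_eq0 (negPf x0) orbF => /eqP ->.
Qed.

Lemma kill3 (F : fieldType) (u v w : 'cV[F]_4) :
  exists2 f, f != 0 & [/\ ev f u = 0, ev f v = 0 & ev f w = 0].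
Proof.
pose M : 'M[F]_(4, 3) := \matrix_(r, l) nth 0 [:: u r 0; v r 0; w r 0] l.
have : kermx M != 0.
  rewrite kermx_eq0 /row_free; have := rank_leq_col M.
  by case: eqP => // ->.
case/rowV0Pn => f /sub_kermxP fM f0; exists f => //.
have fl (l : 'I_3) x : col l M = x -> ev f x = 0.
  by move=> <-; rewrite /ev colE mulmxA fM mul0mx mxE.
by split; [apply: (fl 0) | apply: (fl 1) | apply: (fl ord_max)];
  apply/colP => r; rewrite !mxE.
Qed.

Lemma free3_coords (F : fieldType) (x y z : 'cV[F]_4) :
  free3 x y z -> exists f w, [/\ f != 0, [/\ ev f x = 0, ev f y = 0 & ev f z = 0] &
    forall v, exists c d e, v = c *: x + d *: y + e *: z + ev f v *: w].
Proof.
move=> xyz; have [f f0 [fx fy fz]] := kill3 x y z.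
have [K [fK Ki Ks]] := kernel_coords f0.
have [x' xE] := Ks x fx; have [y' yE] := Ks y fy; have [z' zE] := Ks z fz.
pose M : 'M[F]_3 := \matrix_(r, l) nth 0 [:: x' r 0; y' r 0; z' r 0] l.
have ME (c : 'cV_3) : K *m (M *m c) = c 0 0 *: x + c 1 0 *: y + c ord_max 0 *: z.
  rewrite xE yE zE !scalemxAr -!mulmxDr; congr (K *m _).
  apply/colP => r; rewrite !mxE !big_ord_recl big_ord0 !mxE /= addr0 addrA.
  have -> : lift ord0 ord0 = 1 :> 'I_3 by apply/val_inj.
  have -> : lift ord0 (lift ord0 ord0) = ord_max :> 'I_3 by apply/val_inj.
  by rewrite ![_ * c _ _]mulrC.
have Mu : M \in unitmx.
  rewrite -unitmx_tr -row_free_unit; apply/inj_row_free => v /(congr1 trmx).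
  rewrite trmx_mul trmxK trmx0 => Mv.
  have := ME v^T; rewrite Mv mulmx0 => /esym/xyz; rewrite !mxE => -[e0 e1 e2].
  apply/rowP => l; rewrite mxE; case: l => [[|[|[|//]]] l3].
  - by rewrite -[RHS]e0; congr (v _ _); apply/val_inj.
  - by rewrite -[RHS]e1; congr (v _ _); apply/val_inj.
  by rewrite -[RHS]e2; congr (v _ _); apply/val_inj.
have [i fi] : exists i, f 0 i != 0 by apply/rV0Pn.
pose w : 'cV[F]_4 := (f 0 i)^-1 *: delta_mx i 0.
have fw : ev f w = 1 by rewrite evZ /ev -colE mxE mulVf.
exists f, w; split=> // v.
have [c cE] : exists c, v - ev f v *: w = K *m c.
  by apply: Ks; rewrite evD evN evZ fw mulr1 subrr.
pose c' := invmx M *m c; exists (c' 0 0), (c' 1 0), (c' ord_max 0).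
by rewrite -ME mulKVmx // -cE subrK.
Qed.

Section Configuration.
Variables (k : closedFieldType) (n : nat) (B : 'M[k]_(4, n)).
Let b j := col j B.

(** Zeroing the columns outside S makes coplanarity a rank condition on a matrix of fixed size,
    hence a boolean. *)
Definition coplanar (S : {set 'I_n}) : bool :=
  ~~ row_free (\matrix_(r < 4, j < n) if j \in S then B r j else 0).

Lemma coplanarP (S : {set 'I_n}) :
  reflect (exists2 f : 'rV[k]_4, f != 0 & forall j, j \in S -> ev f (b j) = 0)
    (coplanar S).
Proof.
rewrite /coplanar; set M := \matrix_(r, j) _.
have fM (f : 'rV_4) j : (f *m M) 0 j = if j \in S then ev f (b j) else 0.
  rewrite mxE; case: ifP => jS; last by rewrite big1 // => l _; rewrite mxE jS mulr0.
  by rewrite /ev mxE; apply: eq_bigr => l _; rewrite !mxE jS.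
rewrite -kermx_eq0; apply: (iffP rowV0Pn) => -[f].
  move=> /sub_kermxP fM0 f0; exists f => // j jS.
  by have := fM f j; rewrite fM0 jS mxE.
move=> f0 fS; exists f => //; apply/sub_kermxP/rowP => j.
by rewrite fM mxE; case: ifP => // /fS.
Qed.

(* One index for each point of the configuration. *)
Definition points : {set 'I_n} :=
  [set i | (b i != 0) && [forall j : 'I_n, (j < i)%N ==> (b j != 0) ==>
    ~~ ((b i)^T <= (b j)^T)%MS]].

Lemma points_neq0 i : i \in points -> b i != 0.
Proof. by rewrite inE => /andP[]. Qed.

Lemma sub_colP (u v : 'cV[k]_4) :
  reflect (exists c, u = c *: v) (u^T <= v^T)%MS.
Proof.
apply: (iffP sub_rVP) => -[c E]; exists c.
  by apply: trmx_inj; rewrite E linearZ.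
by rewrite E linearZ.
Qed.

Lemma points_repr j : b j != 0 -> exists2 i, i \in points & exists c, b j = c *: b i.
Proof.
move=> bj; pose P i := (b i != 0) && ((b j)^T <= (b i)^T)%MS.
have Pj : P j by rewrite /P bj submx_refl.
case: (arg_minnP (fun i : 'I_n => nat_of_ord i) Pj) => i /andP[bi ji] imin.
exists i; last exact/sub_colP.
rewrite inE bi /=; apply/forallP => l; apply/implyP => li; apply/implyP => bl.
apply/negP => il; have := imin l; rewrite /P bl (submx_trans ji il) => /(_ isT).
by rewrite leqNgt li.
Qed.

Lemma points_distinct i j c : i \in points -> j \in points -> i != j -> b j <> c *: b i.
Proof.
move=> iP jP ij E; have := points_neq0 jP; rewrite E scaler_eq0 negb_or => /andP[c0 _].
move: ij; rewrite -val_eqE neq_ltn => /orP[ij|ji].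
  move: jP; rewrite inE => /andP[_ /forallP/(_ i)]; rewrite ij (points_neq0 iP) /=.
  by case/sub_colP; exists c.
move: iP; rewrite inE => /andP[_ /forallP/(_ j)]; rewrite ji (points_neq0 jP) /=.
by case/sub_colP; exists c^-1; rewrite E scalerA mulVf // scale1r.
Qed.

Lemma collinear_or_free (O : {set 'I_n}) : O \subset points ->
  (exists u v, forall j, j \in O -> span2 u v (b j)) \/
  exists x y z, [/\ [/\ x \in O, y \in O & z \in O], uniq [:: x; y; z] &
    free3 (b x) (b y) (b z)].
Proof.
move=> OP; case: (pickP (mem O)) => [x /= xO|O0]; last first.
  by left; exists 0, 0 => j jO; have := O0 j; rewrite /= jO.
have xP := subsetP OP x xO.
case: (pickP [pred y in O | y != x]) => [y /andP[/= yO yx]|Ox]; last first.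
  left; exists (b x), 0 => j jO; have := Ox j; rewrite /= jO /= => /negbFE/eqP ->.
  by apply/span2P; exists 1, 0; rewrite scale1r scale0r addr0.
have yP := subsetP OP y yO.
have xy c : b y <> c *: b x by apply: points_distinct; rewrite // eq_sym.
case: (pickP [pred z in O | ~~ span2 (b x) (b y) (b z)]) => [z /andP[/= zO nz]|Oz].
  right; exists x, y, z; split=> //; last exact: free3_of_span2 (points_neq0 xP) xy nz.
  rewrite /= !inE negb_or eq_sym yx /= andbT; apply/andP; split.
    apply: contraNneq nz => <-; apply/span2P; exists 1, 0.
    by rewrite scale1r scale0r addr0.
  apply: contraNneq nz => <-; apply/span2P; exists 0, 1.
  by rewrite scale1r scale0r add0r.
by left; exists (b x), (b y) => j jO; have := Oz j; rewrite /= jO /= => /negbFE.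
Qed.

Variable Z : 'M[k]_(4, n) -> Prop.
Hypotheses (n8 : (n <= 8)%N) (Zc : curve_closed Z)
  (Zm : forall M c s t, Z (M *m moment 3 c s t)).
Hypothesis Bf : row_free B.
Hypothesis cones : forall i, b i != 0 -> exists Q, cone_at B (b i) Q.

Lemma split_points_class (f : 'rV[k]_4) (u v : 'cV[k]_4) :
  f != 0 -> (forall j, j \in points -> ev f (b j) = 0 \/ span2 u v (b j)) -> Z B.
Proof.
move=> f0 H; apply: (split_class Zc Zm cones (f := f) (u := u) (v := v)) => // j.
have [j0|/points_repr[i iP [c E]]] := eqVneq (b j) 0.
  by left; rewrite -/(b j) j0 ev0.
rewrite -/(b j) E; case: (H i iP) => [fi|/span2P[s [t ->]]].
  by left; rewrite evZ fi mulr0.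
by right; exists (c * s), (c * t); rewrite scalerDr !scalerA.
Qed.

(** * A plane with as many points as possible *)

Variable S : {set 'I_n}.
Hypotheses (SP : S \subset points) (Sc : coplanar S).
Hypothesis Smax : forall T : {set 'I_n}, T \subset points -> coplanar T -> (#|T| <= #|S|)%N.

Lemma off_plane (f : 'rV[k]_4) : f != 0 -> (forall j, j \in S -> ev f (b j) = 0) ->
  forall j, j \in points :\: S -> ev f (b j) != 0.
Proof.
move=> f0 fS j; rewrite inE => /andP[jS jP]; apply/eqP => fj.
have := Smax (T := j |: S); rewrite cardsU1 jS ltnn => H; apply: notF; apply: H.
  by rewrite subUset sub1set jP.
by apply/coplanarP; exists f => // l; rewrite !inE => /orP[/eqP->|/fS].
Qed.

(** A line containing S would span with x a plane that has more points. *)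
Lemma not_collinear x u v : x \in points :\: S ->
  ~ (forall j, j \in S -> span2 u v (b j)).
Proof.
move=> xO H; have [f f0 [fu fv fx]] := kill3 u v (b x).
have := off_plane f0 _ xO; rewrite fx eqxx => E; apply: notF; apply: E => j /H/span2P.
by case=> [s [t ->]]; rewrite evD !evZ fu fv !mulr0 addr0.
Qed.

(** If the cone at one of x, y, z contains the line through the other two, [cone_plane_split]
    applies. Otherwise [three_conics] would identify a fourth point of S with one of three
    independent ones. *)
Lemma plane_section x y z (f : 'rV[k]_4) (w : 'cV[k]_4) :
  (3 < #|S|)%N -> x \in points :\: S -> y \in points :\: S -> z \in points :\: S ->
  (forall v, exists c d e, v = c *: b x + d *: b y + e *: b z + ev f v *: w) ->
  exists u v, forall j, j \in S -> ev f (b j) = 0 \/ span2 u v (b j).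
Proof.
move=> S4 xO yO zO spn; have [g g0 gS] := coplanarP _ Sc.
have off := off_plane g0 gS.
have ptO i : i \in points :\: S -> i \in points by rewrite inE => /andP[].
have [Qx [Qxn QxB Qxx Px]] := cones (points_neq0 (ptO x xO)).
have [Qy [Qyn QyB Qyy Py]] := cones (points_neq0 (ptO y yO)).
have [Qz [Qzn QzB Qzz Pz]] := cones (points_neq0 (ptO z zO)).
have conclude (u v : 'cV[k]_4) (Q : 'M[k]_4) :
    (forall p, ev g p = 0 -> qform Q p = 0 ->
      ev f p = 0 \/ exists s t, p = s *: u + t *: v) ->
    (forall j, qform Q (b j) = 0) ->
    exists u v, forall j, j \in S -> ev f (b j) = 0 \/ span2 u v (b j).
  move=> H QB; exists u, v => j jS.
  by have [|/span2P] := H (b j) (gS j jS) (QB j); [left | right].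
have [yz|nx] := eqVneq (polar Qx (b y) (b z)) 0.
  have [u [v H]] := cone_plane_split (off x xO) Qxn Qxx (QxB y) (QxB z) Px spn yz.
  exact: conclude H QxB.
have [xz|ny] := eqVneq (polar Qy (b x) (b z)) 0.
  have spn' v : exists c d e, v = c *: b y + d *: b x + e *: b z + ev f v *: w.
    have [c [d [e E]]] := spn v; exists d, c, e; rewrite {1}E.
    by congr (_ + _ + _); rewrite addrC.
  have [u [v H]] := cone_plane_split (off y yO) Qyn Qyy (QyB x) (QyB z) Py spn' xz.
  exact: conclude H QyB.
have [xy|nz] := eqVneq (polar Qz (b x) (b y)) 0.
  have spn' v : exists c d e, v = c *: b z + d *: b x + e *: b y + ev f v *: w.
    have [c [d [e E]]] := spn v; exists e, c, d; rewrite {1}E.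
    by congr (_ + _); rewrite addrC addrA.
  have [u [v H]] := cone_plane_split (off z zO) Qzn Qzz (QzB x) (QzB y) Pz spn' xy.
  exact: conclude H QzB.
have [[u [v H]]|[p1 [p2 [p3 [[P1 P2 P3] u123 F]]]]] := collinear_or_free SP.
  by case: (not_collinear xO H).
have [p4 P4 n4] : exists2 p4, p4 \in S & p4 \notin [set p1; p2; p3].
  have : ~~ (S \subset [set p1; p2; p3]).
    apply: contraL S4 => /subset_leq_card; rewrite -leqNgt => /leq_trans; apply.
    have /eq_card-> : [set p1; p2; p3] =i [:: p1; p2; p3] by move=> i; rewrite !inE orbA.
    by rewrite (card_uniqP u123).
  by case/subsetPn => p4 P4 n4; exists p4.
have [h [w' [h0 [h1 h2 h3] spnh]]] := free3_coords F.
have gw : ev g w' != 0.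
  apply: contraNneq g0 => gw; apply/eqP/rowP => i; rewrite mxE.
  have [c [d [e E]]] := spnh (delta_mx i 0).
  have -> : g 0 i = ev g (delta_mx i 0) by rewrite /ev -colE mxE.
  by rewrite E !evD !evZ !gS // gw !mulr0 !addr0.
have spng v : ev g v = 0 -> exists c d e, v = c *: b p1 + d *: b p2 + e *: b p3.
  have [c [d [e E]]] := spnh v; move=> gv; exists c, d, e.
  have hv : ev h v = 0.
    move: gv; rewrite {1}E !evD !evZ !gS // !mulr0 !add0r => /eqP.
    by rewrite mulf_eq0 (negPf gw) orbF => /eqP.
  by rewrite {1}E hv scale0r addr0.
have Qp Q p : Q \in [:: Qx; Qy; Qz] -> p \in [:: b p1; b p2; b p3; b p4] -> qform Q p = 0.
  by rewrite !inE => /or3P[]/eqP-> /or4P[]/eqP->;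
    [apply: QxB | apply: QxB | apply: QxB | apply: QxB | apply: QyB | apply: QyB
    | apply: QyB | apply: QyB | apply: QzB | apply: QzB | apply: QzB | apply: QzB].
have [c p4E] := three_conics g0 (off x xO) (off y yO) (off z zO)
  (And4 Qxx (QxB y) (QxB z) Px) (And4 (QyB x) Qyy (QyB z) Py)
  (And4 (QzB x) (QzB y) Qzz Pz) nx ny nz spng Qp (gS p4 P4).
have SPi i : i \in S -> i \in points by apply/subsetP.
move: n4; rewrite !inE !negb_or -andbA => /and3P[n1 n2 n3].
by case: p4E => E; exfalso;
  [apply: (@points_distinct p1 p4 c) | apply: (@points_distinct p2 p4 c)
  | apply: (@points_distinct p3 p4 c)]; rewrite ?SPi // eq_sym.
Qed.

Lemma coplanar_small (s : seq 'I_n) (f : 'rV[k]_4) : f != 0 -> uniq s ->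
  {subset s <= points} -> (forall j, j \in s -> ev f (b j) = 0) -> (size s <= #|S|)%N.
Proof.
move=> f0 us sP sf; have /eq_card cs : [set j in s] =i s by move=> j; rewrite inE.
rewrite -(card_uniqP us) -cs; apply: Smax.
  by apply/subsetP => j; rewrite inE => /sP.
by apply/coplanarP; exists f => // j; rewrite inE => /sf.
Qed.

(** No plane has more than three points; the plane of x, y, z has three, so #|S| = 3, and these
    three together with S are six points in general position. *)
Lemma small_plane_class x y z :
  (#|S| <= 3)%N -> x \in points :\: S -> y \in points :\: S -> z \in points :\: S ->
  uniq [:: x; y; z] -> Z B.
Proof.
move=> S3 xO yO zO u.
have OP j : j \in points :\: S -> j \in points by rewrite inE => /andP[].
have {}S3 : #|S| = 3%N.
  apply/eqP; rewrite eqn_leq S3; have [f f0 [fx fy fz]] := kill3 (b x) (b y) (b z).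
  apply: (coplanar_small (s := [:: x; y; z]) f0 u).
    by move=> j; rewrite !in_cons in_nil orbF => /or3P[]/eqP->; apply: OP.
  by move=> j; rewrite !in_cons in_nil orbF => /or3P[]/eqP->.
pose L := [:: x; y; z] ++ enum S.
have szL : size L = 6%N by rewrite size_cat -cardE S3.
have uL : uniq L.
  rewrite cat_uniq u enum_uniq andbT; apply/hasPn => j; rewrite mem_enum => jS.
  by apply: contraTN jS; rewrite !inE => /or3P[]/eqP->; [move: xO | move: yO | move: zO];
    rewrite inE => /andP[].
have LP : {subset L <= points}.
  move=> j; rewrite mem_cat mem_enum => /orP[|/(subsetP SP)//].
  by rewrite !in_cons in_nil orbF => /or3P[]/eqP->; apply: OP.
apply: (general_position_class Zm cones (i := fun l => nth x L l)) => f a c d e us lt6 f0.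
apply/eqP/negPn/negP => fn.
pose s := [seq nth x L l | l <- [:: a; c; d; e]].
have lt l : l \in [:: a; c; d; e] -> (l < size L)%N.
  by move=> ls; rewrite szL; apply: (allP lt6).
suff : (size s <= #|S|)%N by rewrite S3.
apply: (coplanar_small fn).
- rewrite map_inj_in_uniq // => l m /lt ll /lt lm /eqP.
  by rewrite nth_uniq // => /eqP.
- by move=> _ /mapP[l /lt ll ->]; apply: LP; apply: mem_nth.
by move=> _ /mapP[l ls ->]; apply/eqP; apply: (allP f0).
Qed.

(* Four points off the plane cannot be independent: the plane spanned by three
   of them contains exactly one point of S, always the same one. *)
Lemma plane_section_point x y z (f : 'rV[k]_4) (w : 'cV[k]_4) : #|S| = 4%N ->
  x \in points :\: S -> y \in points :\: S -> z \in points :\: S -> uniq [:: x; y; z] ->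
  f != 0 -> ev f (b x) = 0 -> ev f (b y) = 0 -> ev f (b z) = 0 ->
  (forall v, exists c d e, v = c *: b x + d *: b y + e *: b z + ev f v *: w) ->
  exists p u v, [/\ p \in S, ev f (b p) = 0 &
    forall q, q \in S -> q != p -> span2 u v (b q)].
Proof.
move=> S4 xO yO zO u f0 fx fy fz spn.
have [|u' [v' H]] := plane_section _ xO yO zO spn; first by rewrite S4.
case: (pickP [pred p in S | ev f (b p) == 0]) => [p /andP[/= pS /eqP fp]|Sf]; last first.
  case: (not_collinear (x := x) (u := u') (v := v') xO) => j jS.
  by have := Sf j; rewrite /= jS /= => /eqP fj; case: (H j jS).
exists p, u', v'; split=> // q qS qp; case: (H q qS) => // fq; exfalso.
have OP j : j \in points :\: S -> (j \in points) && (j \notin S) by rewrite inE andbC.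
have /andP[xP xS] := OP _ xO; have /andP[yP yS] := OP _ yO; have /andP[zP zS] := OP _ zO.
(* A second point of S on the plane f = 0 would give that plane five points, against the maximum of
   four. *)
have /(_ f0) : f != 0 -> (size [:: p; q; x; y; z] <= #|S|)%N.
  move=> _; apply: (coplanar_small f0).
  - have ne i j : i \in S -> j \notin S -> i != j by move=> iS; apply: contraNneq => <-.
    rewrite cons_uniq cons_uniq u andbT !in_cons !in_nil !orbF !negb_or eq_sym qp.
    by rewrite !ne.
  - move=> j; rewrite !in_cons in_nil orbF.
    by case/or4P=> [/eqP->|/eqP->|/eqP->|/orP[]/eqP->] //; apply: (subsetP SP).
  move=> j; rewrite !in_cons in_nil orbF.
  by case/or4P=> [/eqP->|/eqP->|/eqP->|/orP[]/eqP->].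
by rewrite S4.
Qed.

(** If p and p' differ, the two remaining points of S lie on both lines, which then coincide and
    contain all of S. *)
Lemma same_section_point p u v p' u' v' x : #|S| = 4%N -> x \in points :\: S ->
  p \in S -> (forall q, q \in S -> q != p -> span2 u v (b q)) ->
  p' \in S -> (forall q, q \in S -> q != p' -> span2 u' v' (b q)) -> p = p'.
Proof.
move=> S4 xO pS Hp p'S Hp'; apply/eqP/negPn/negP => pp'.
have S2 : #|S :\: [set p; p']| = 2%N.
  have : [set p; p'] \subset S by rewrite subUset !sub1set pS.
  by move=> /setIidPr E; rewrite cardsD E S4 cards2 pp'.
have /cards2P[q [q' [qq' qE]]] : #|S :\: [set p; p']| == 2%N by rewrite S2.
have : q \in S :\: [set p; p'] by rewrite qE !inE eqxx.
rewrite !inE negb_or -andbA => /and3P[qp qp' qS].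
have : q' \in S :\: [set p; p'] by rewrite qE !inE eqxx orbT.
rewrite !inE negb_or -andbA => /and3P[q'p q'p' q'S].
have SPi i : i \in S -> i \in points by apply/subsetP.
have qn : b q != 0 by apply: points_neq0; apply: SPi.
have qq'n c : b q' <> c *: b q by apply: points_distinct => //; apply: SPi.
apply: (not_collinear (u := b q) (v := b q') xO) => j jS.
have [->|jp] := eqVneq j p.
  by apply: (span2_exchange qn qq'n (u := u') (v := v')); apply: Hp'.
by apply: (span2_exchange qn qq'n (u := u) (v := v)); apply: Hp.
Qed.

(** The points outside S are collinear or contain an independent triple. With a triple, either #|S|
    <= 3, or its plane contains all points outside S, or a fourth point t completes a tetrahedron,
    which is contradictory. *)
Lemma maximal_plane_class : Z B.
Proof.
have [g g0 gS] := coplanarP _ Sc.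
have OP : points :\: S \subset points by apply: subsetDl.
have [[u [v H]]|[x [y [z [[xO yO zO] uxyz F]]]]] := collinear_or_free OP.
  apply: (split_points_class g0 (u := u) (v := v)) => j jP.
  have [jS|jS] := boolP (j \in S); first by left; apply: gS.
  by right; apply: H; rewrite inE jS.
have [S3|S4] := leqP #|S| 3; first exact: small_plane_class S3 xO yO zO uxyz.
have [f [w [f0 [fx fy fz] spn]]] := free3_coords F.
case: (pickP [pred t in points :\: S | ev f (b t) != 0]) => [t /andP[/= tO ft]|Of]; last first.
  have [u [v H]] := plane_section S4 xO yO zO spn.
  apply: (split_points_class f0 (u := u) (v := v)) => j jP.
  have [jS|jS] := boolP (j \in S); first exact: H.
  by left; apply/eqP; have := Of j; rewrite /= inE jS jP /= => /negbFE.
exfalso.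
have tne i : ev f (b i) = 0 -> t != i by move=> fi; apply: contraNneq ft => ->; rewrite fi.
have [tx ty tz] : [/\ t != x, t != y & t != z] by split; apply: tne.
(* Four points outside S and at least four in it exhaust n <= 8. *)
have {}S4 : #|S| = 4%N.
  apply/eqP; rewrite eqn_leq S4 andbT.
  have := @subset_leq_card _ [set j in [:: t; x; y; z]] (points :\: S).
  have /eq_card-> : [set j in [:: t; x; y; z]] =i [:: t; x; y; z] by move=> j; rewrite inE.
  have /card_uniqP-> : uniq [:: t; x; y; z] by rewrite cons_uniq uxyz !inE !negb_or tx ty tz.
  have sub : [set j in [:: t; x; y; z]] \subset points :\: S.
    by apply/subsetP => j; rewrite inE !in_cons in_nil orbF => /or4P[]/eqP->.
  move=> /(_ sub) /=; rewrite cardsD (setIidPr SP).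
  have := max_card (mem points); rewrite card_ord => /leq_trans/(_ n8).
  by move: #|points| #|S|; clear; lia.
have Ft (p q : 'I_n) : (forall a c, a *: b p + c *: b q = 0 -> a = 0 /\ c = 0) ->
    ev f (b p) = 0 -> ev f (b q) = 0 -> free3 (b t) (b p) (b q).
  move=> pq fp fq a c d E.
  have a0 : a = 0.
    have := congr1 (ev f) E; rewrite !evD !evZ fp fq !mulr0 !addr0 ev0.
    by move/eqP; rewrite mulf_eq0 (negPf ft) orbF => /eqP.
  by move: E; rewrite a0 scale0r add0r => /pq[-> ->].
have yz a c : a *: b y + c *: b z = 0 -> a = 0 /\ c = 0.
  by move=> E; have := F 0 a c; rewrite scale0r add0r E => /(_ erefl)[].
have xz a c : a *: b x + c *: b z = 0 -> a = 0 /\ c = 0.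
  by move=> E; have := F a 0 c; rewrite scale0r addr0 E => /(_ erefl)[].
have xy a c : a *: b x + c *: b y = 0 -> a = 0 /\ c = 0.
  by move=> E; have := F a c 0; rewrite scale0r addr0 E => /(_ erefl)[].
have [f1 [w1 [f10 [f1t f1y f1z] spn1]]] := free3_coords (Ft y z yz fy fz).
have [f2 [w2 [f20 [f2t f2x f2z] spn2]]] := free3_coords (Ft x z xz fx fz).
have [f3 [w3 [f30 [f3t f3x f3y] spn3]]] := free3_coords (Ft x y xy fx fy).
move: (uxyz); rewrite /= !inE !negb_or andbT => /andP[/andP[nxy nxz] nyz].
have [p [u [v [pS fp Hp]]]] := plane_section_point S4 xO yO zO uxyz f0 fx fy fz spn.
have [|p1 [u1 [v1 [p1S fp1 Hp1]]]] :=
    plane_section_point S4 tO yO zO _ f10 f1t f1y f1z spn1.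
  by rewrite /= !inE negb_or ty tz nyz.
have [|p2 [u2 [v2 [p2S fp2 Hp2]]]] :=
    plane_section_point S4 tO xO zO _ f20 f2t f2x f2z spn2.
  by rewrite /= !inE negb_or tx tz nxz.
have [|p3 [u3 [v3 [p3S fp3 Hp3]]]] :=
    plane_section_point S4 tO xO yO _ f30 f3t f3x f3y spn3.
  by rewrite /= !inE negb_or tx ty nxy.
(* All four faces of the tetrahedron meet S in the same point p, but the faces have no common
   point. *)
rewrite -(same_section_point S4 xO pS Hp p1S Hp1) in fp1.
rewrite -(same_section_point S4 xO pS Hp p2S Hp2) in fp2.
rewrite -(same_section_point S4 xO pS Hp p3S Hp3) in fp3.
have spnt v' : exists c d e h, v' = c *: b x + d *: b y + e *: b z + h *: b t.
  have [c [d [e E]]] := spn v'; have [c' [d' [e' E']]] := spn (b t).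
  pose r := ev f v' / ev f (b t).
  exists (c - r * c'), (d - r * d'), (e - r * e'), r; rewrite {1}E [in r *: b t]E'.
  by rewrite /r; apply/colP => i; rewrite !mxE; field.
have nz (h : 'rV[k]_4) : h != 0 -> ~ [/\ ev h (b x) = 0, ev h (b y) = 0, ev h (b z) = 0 & ev h (b t) = 0].
  move=> h0 [hx hy hz ht]; case/negP: h0; apply/eqP/rowP => i; rewrite [RHS]mxE.
  have -> : h 0 i = ev h (delta_mx i 0) by rewrite /ev -colE mxE.
  have [c [d [e [r ->]]]] := spnt (delta_mx i 0).
  by rewrite !evD !evZ hx hy hz ht !mulr0 !addr0.
have pP : p \in points by apply: (subsetP SP).
have [c [d [e E]]] := spn (b p); rewrite fp scale0r addr0 in E.
move: fp1 fp2 fp3; rewrite E !evD !evZ f1y f1z f2x f2z f3x f3y !mulr0 !addr0 !add0r.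
move=> /eqP + /eqP + /eqP; rewrite !mulf_eq0.
have [f1x|_] := eqVneq (ev f1 (b x)) 0; first by case: (nz f1 f10).
have [f2y|_] := eqVneq (ev f2 (b y)) 0; first by case: (nz f2 f20).
have [f3z|_] := eqVneq (ev f3 (b z)) 0; first by case: (nz f3 f30).
rewrite !orbF => /eqP c0 /eqP d0 /eqP e0.
by have := points_neq0 pP; rewrite E c0 d0 e0 !scale0r !addr0 eqxx.
Qed.

End Configuration.

Lemma spanning_class (k : closedFieldType) (n : nat) (Z : 'M[k]_(4, n) -> Prop)
    (B : 'M[k]_(4, n)) :
  (n <= 8)%N -> curve_closed Z -> (forall M c s t, Z (M *m moment 3 c s t)) ->
  row_free B -> (forall i, col i B != 0 -> exists Q, cone_at B (col i B) Q) -> Z B.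
Proof.
move=> n8 Zc Zm Bf cones.
pose P (S : {set 'I_n}) := (S \subset points B) && coplanar B S.
have P0 : P set0.
  rewrite /P sub0set; apply/coplanarP; exists (delta_mx 0 0) => [|j]; last by rewrite inE.
  apply/eqP => /rowP/(_ 0); rewrite !mxE !eqxx => /eqP.
  by rewrite oner_eq0.
case: (arg_maxnP (fun S : {set 'I_n} => #|S|) P0) => S /andP[SP Sc] Smax.
apply: (maximal_plane_class n8 Zc Zm Bf cones SP Sc) => T TP Tc.
by apply: Smax; rewrite /P TP.
Qed.

(** * The two inclusions *)

Lemma cols_setT (R : comNzRingType) (r n : nat) (A : 'M[R]_(r, n)) :
  cols n A [set: 'I_n] = A.
Proof.
apply/matrixP => i j; rewrite (colsE _ j) ?cardsT ?card_ord //.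
rewrite (_ : enum [set: 'I_n] = enum 'I_n) ?nth_ord_enum //.
by apply: eq_enum => l; rewrite !inE.
Qed.

Lemma W_psi (k : fieldType) (d n : nat) (p : conf k d n) (A : 'M[k]_(d.+1, n))
    (I : {set 'I_d.+4}) (J : {set 'I_n}) :
  W_locus p -> hcoords p A -> #|I| = 6%N -> #|J| = d.+4 -> psi (cols d.+4 A J) I = 0.
Proof. by move=> pW pA I6 Jd; rewrite -eval_psi_poly; apply: pW. Qed.

Lemma W_sub_V_codim4 (k : closedFieldType) (d : nat) (p : conf k d d.+4) :
  (0 < d <= 4)%N -> W_locus p -> V_locus p.
Proof.
case/andP=> d0 d4 pW f _ fU A pA.
have Zc := @vanishes_on_closed _ _ _ f.
have Zg := vanishes_on_good d0 fU.
have [Af|Af] := boolP (row_free A); last exact: curve_class_degenerate Zc Zg d4 Af.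
apply: (curve_class_full Zc Zg Af) => I I6.
by rewrite -(cols_setT A); apply: (W_psi pW pA) => //; rewrite cardsT card_ord.
Qed.

Lemma W_sub_V_3_8 (k : closedFieldType) (p : conf k 3 8) : W_locus p -> V_locus p.
Proof.
move=> pW f _ fU A pA.
have Zc := @vanishes_on_closed _ _ _ f.
have Zg := vanishes_on_good (isT : (0 < 3)%N) fU.
have Zm := curve_closed_moment Zc Zg.
have [Af|Af] := boolP (row_free A); last exact: planar_class Zm Af.
have [B Bf AB] : exists2 B : 'M_(4, 8), row_free B & A *m B^T = 0.
  by apply: kernel_rows; rewrite (eqP Af).
have nE : 8 = (3 + 3).+2 by [].
have Dc : curve_closed (dual_class (e := 3) (vanishes_on f)) by apply: dual_class_closed.
have Dm := curve_closed_moment Dc (dual_class_good nE Zc Zg).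
suff DB : dual_class (e := 3) (vanishes_on f) B by apply: DB.
apply: spanning_class => // i bi.
apply: (dual_cone Af AB bi) => I I6.
by apply: (W_psi pW pA) => //; rewrite cardsC1 card_ord.
Qed.

Lemma V_sub_W (k : closedFieldType) (d n : nat) (p : conf k d n) :
  V_locus p -> W_locus p.
Proof.
move=> pV I J I6 Jd; apply: pV => [|q]; first exact: psi_poly_multihomogeneous.
exact: psi_poly_U.
Qed.

Local Close Scope ring_scope.

Theorem corollary4p26 (k : closedFieldType) (d n : nat)
    (hdn : (d, n) = (3, 7) \/ (d, n) = (3, 8) \/ (d, n) = (4, 8))
    (p : conf k d n) :
  W_locus p <-> V_locus p.
Proof.
split; last exact: V_sub_W.
by case: hdn p => [[-> ->]|[[-> ->]|[-> ->]]] p;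
  [apply: W_sub_V_codim4 | apply: W_sub_V_3_8 | apply: W_sub_V_codim4].
Qed.
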